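(* Let $n\ge 2$ and $0\le k<n$ be integers. Then $$\max\Big\{\big(2-2^{-1/n}\big)^{-n},\ \sigma(n,k)\Big\}\ \ge\ \sigma(n+1,k+1).$$ In particular, for every $n\ge 2$, $\sigma(n,n-1)\le \sigma(2,1)\le \frac13(\sqrt2+1)$.
   Context: A convex body is a compact convex set with nonempty interior. For a convex body $K\subset\mathbb{R}^n$ and an integer $0\le k<n$, $$\mathrm{Sym}_k(K)=\frac{1}{\mathrm{vol}_n(K)}\max_{\mathcal L}\mathrm{vol}_n\big(K\cap \mathrm{refl}_{\mathcal L}(K)\big),$$ the maximum over all $k$-dimensional affine flats $\mathcal L$, with $\mathrm{refl}_{\mathcal L}$ the orthogonal reflection through $\mathcal L$. Define $\sigma(n,k)=\inf\{\mathrm{Sym}_k(K): K\subset\mathbb{R}^n \text{ a convex body}\}$. *)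

(* Defs.v *)
From HB Require Import structures.
From mathcomp Require Import all_boot all_order all_algebra.
From mathcomp Require Import all_classical all_reals all_analysis.

Set Implicit Arguments.
Unset Strict Implicit.
Unset Printing Implicit Defensive.

Import Order.TTheory GRing.Theory Num.Theory.
Import numFieldNormedType.Exports.
Local Open Scope classical_set_scope.
Local Open Scope ring_scope.

Section Defs.
Variable R : realType.

Definition box (n : nat) (a b : 'rV[R]_n) : set 'rV[R]_n :=
  [set x | forall j : 'I_n, a 0 j <= x 0 j <= b 0 j].

Definition box_vol (n : nat) (a b : 'rV[R]_n) : \bar R :=
  (\prod_(j < n) Num.max (b 0 j - a 0 j) 0)%:E.

(* n-dimensional Lebesgue (outer) measure: infimum of the total volume of
   countable covers by boxes.  On Lebesgue-measurable sets (in particular on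
   convex sets) this is the Lebesgue measure vol_n. *)
Definition vol (n : nat) (A : set 'rV[R]_n) : \bar R :=
  ereal_inf [set s : \bar R | exists a b : nat -> 'rV[R]_n,
     A `<=` \bigcup_i box (a i) (b i) /\
     s = (\sum_(0 <= i <oo) box_vol (a i) (b i))%E].

Definition convex_set (n : nat) (A : set 'rV[R]_n) : Prop :=
  forall x y, A x -> A y -> forall t : R, 0 <= t <= 1 ->
    A (t *: x + (1 - t) *: y).

Definition convex_body (n : nat) (K : set 'rV[R]_n) : Prop :=
  compact K /\ convex_set K /\ (K°) !=set0.

(* A k-dimensional affine flat L = p + span(rows of U), where the k rows of
   U : 'M_(k,n) are orthonormal (U U^T = I_k).  Every k-flat arises this way.
   The orthogonal reflection through L is
     x |-> p + 2 P(x - p) - (x - p),   P = U^T U the orthogonal projector. *)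
Definition orthonormal_frame (k n : nat) (U : 'M[R]_(k, n)) : Prop :=
  U *m U^T = 1%:M.

Definition refl_flat (k n : nat) (p : 'rV[R]_n) (U : 'M[R]_(k, n))
  (x : 'rV[R]_n) : 'rV[R]_n :=
  p + 2%:R *: ((x - p) *m (U^T *m U)) - (x - p).

(* Sym_k(K): the maximum (written as a supremum) over all k-flats of
   vol(K ∩ refl_L(K)) / vol(K). *)
Definition Sym (n k : nat) (K : set 'rV[R]_n) : \bar R :=
  ereal_sup [set r : \bar R | exists (p : 'rV[R]_n) (U : 'M[R]_(k, n)),
     orthonormal_frame U /\
     r = (vol (K `&` (refl_flat p U @` K)) * (vol K)^-1)%E].

Definition sigma (n k : nat) : \bar R :=
  ereal_inf [set Sym k K | K in convex_body (n := n)].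

End Defs.

(* Main.v *)
(* Upper bounds come from elongated bodies: if [C] in dimension [n + 1] is stretched by
   [h] in the first coordinate and [h] tends to infinity, the reflections in
   (k + 1)-flats that keep a fixed share of the volume converge, after rescaling, to
   maps that preserve the first coordinate and reflect each section in a k-flat, or
   that reverse the first coordinate and act isometrically on the sections.  Hence
   [sigma (n + 1) (k + 1)] is at most the largest volume ratio realised by such maps.
   For the cone over a body [K] with [Sym k K] near [sigma n k], the first kind gives
   [Sym k K] and the second at most [(2 - 2^(-1/n))^(-n)].  For the planar body
   [0 <= y <= min(x, 2 - x)], [x <= sqrt 2], both kinds give an overlap of at most [2/3]
   out of [2 sqrt 2 - 2].

   The constant [(2 - 2^(-1/n))^(-n)] is at most [3/5], and so is dominated by
   [sigma 2 1]: a planar body contains an ellipse (the one of maximal area) of at least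
   [pi / (3 sqrt 3) > 3/5] of its area, and an ellipse is symmetric about its axes.  To
   bound the body, make the ellipse the unit disc; maximality forces contact points
   within [pi / 3] of every direction, and the tangents there confine the body. *)
Require Import Defs.
From HB Require Import structures.
From mathcomp Require Import all_boot all_order all_algebra.
From mathcomp Require Import fingroup perm measurable_realfun ring lra.
From mathcomp Require Import all_classical all_reals all_analysis.
Set Implicit Arguments.
Unset Strict Implicit.
Unset Printing Implicit Defensive.
Import Order.TTheory GRing.Theory Num.Theory.
Import numFieldNormedType.Exports.
Local Open Scope classical_set_scope.
Local Open Scope ring_scope.

(** * Outer volume *)

(** [vol] is an infimum over box covers, and the bodies are never treated as measurable sets.
    Cavalieri's principle is therefore split into two inequalities: a compact set is bounded above
    through open neighbourhoods of its sections, and a section bound is integrated against an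
    arbitrary cover to bound a set below.

    The obstacle in the limit is compactness. Stretching by [h] multiplies one off-diagonal block of
    the linear part of a reflection by [h], so the rescaled maps might escape to infinity. A large
    entry in that block would squeeze the overlap into a thin slab, so keeping a fixed share of the
    volume bounds it. The same block of the unscaled reflection then tends to 0, and orthogonality
    leaves only a sign on the first axis: this is why exactly two kinds of limit maps occur.

    The value [3/5] is a rational number in the narrow window between
    [(2 - 2^(-1/2))^(-2) = 0.598...] and [pi / (3 sqrt 3) = 0.604...]; the numerical estimates have
    to fit in it. *)

Section VolBasics.
Variable R : realType.

Lemma box_vol_ge0 n (a b : 'rV[R]_n) : (0 <= box_vol a b)%E.
Proof. by rewrite lee_fin; apply: prodr_ge0 => j _; rewrite le_max lexx orbT. Qed.

Lemma vol_cover n (A : set 'rV[R]_n) (a b : nat -> 'rV[R]_n) :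
  A `<=` \bigcup_i box (a i) (b i) ->
  (vol A <= \sum_(0 <= i <oo) box_vol (a i) (b i))%E.
Proof. by move=> Aab; apply: ereal_inf_lbound; exists a, b. Qed.

Lemma vol_ge0 n (A : set 'rV[R]_n) : (0 <= vol A)%E.
Proof.
apply: le_ereal_inf_tmp => _ [a [b [_ ->]]].
by apply: nneseries_ge0 => i _ _; exact: box_vol_ge0.
Qed.

Lemma vol_le n (A B : set 'rV[R]_n) : A `<=` B -> (vol A <= vol B)%E.
Proof.
move=> AB; apply: le_ereal_inf_tmp => _ [a [b [Bab ->]]].
by apply: vol_cover; exact: subset_trans Bab.
Qed.

Lemma vol_near_cover n (A : set 'rV[R]_n) (c : R) : (vol A < c%:E)%E ->
  exists a b : nat -> 'rV[R]_n, A `<=` \bigcup_i box (a i) (b i) /\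
    (\sum_(0 <= i <oo) box_vol (a i) (b i) < c%:E)%E.
Proof.
by move=> /ereal_inf_lt[_ [a [b [Aab ->]]] sc]; exists a, b.
Qed.

Lemma vol_bigcup n (A : nat -> set 'rV[R]_n) :
  (vol (\bigcup_i A i) <= \sum_(0 <= i <oo) vol (A i))%E.
Proof.
(* Near-optimal covers exist only for sets of finite [vol]; an infinite term makes the bound
   trivial. *)
have [[i ioo]|] := pselect (exists i, vol (A i) = +oo%E).
  rewrite (eseries_pinfty _ _ ioo) ?leey// => k _.
  by rewrite -ltNye (lt_le_trans _ (vol_ge0 _)).
rewrite -forallNE => Aoo.
suff add2e (e : {posnum R}) :
    (vol (\bigcup_i A i) <= \sum_(0 <= i <oo) vol (A i) + e%:num%:E)%E.
  by apply/lee_addgt0Pr => _/posnumP[].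
rewrite (le_trans _ (epsilon_trick _ _ _))//; last by move=> k; exact: vol_ge0.
pose P k (B : nat -> 'rV[R]_n * 'rV[R]_n) :=
  A k `<=` \bigcup_i box (B i).1 (B i).2 /\
  (\sum_(0 <= i <oo) box_vol (B i).1 (B i).2
     <= vol (A k) + (e%:num / (2 ^ k.+1)%:R)%:E)%E.
have [G PG] : {G : nat -> nat -> 'rV[R]_n * 'rV[R]_n & forall k, P k (G k)}.
  apply: (@choice _ _ P) => k.
  have fk : vol (A k) \is a fin_num.
    by rewrite ge0_fin_numE ?vol_ge0// ltey; apply/eqP/Aoo.
  have ek : 0 < e%:num / (2 ^ k.+1)%:R by [].
  have := vol_near_cover (A := A k) (c := fine (vol (A k)) + e%:num / (2 ^ k.+1)%:R).
  rewrite EFinD fineK// lteDl// lte_fin => /(_ ek)[a [b [Aab /ltW sab]]].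
  by exists (fun i => (a i, b i)).
pose F (x : nat * nat) : \bar R := box_vol (G x.1 x.2).1 (G x.1 x.2).2.
have F0 x : (0 <= F x)%E by exact: box_vol_ge0.
have /card_esym/ppcard_eqP[f] := card_nat2.
apply: (@le_trans _ _ (\esum_(x in setT) F x)).
  apply: (@le_trans _ _ (\sum_(0 <= i <oo) F (f i))%E).
    apply: vol_cover => t [k _] /(PG k).1 [j _ tkj].
    exists (f^-1%FUN (k, j)) => //=.
    by rewrite !invK ?inE.
  rewrite nneseries_esumT// (reindex_esum setT setT f)//.

rewrite (_ : \esum_(x in setT) F x =
    (\sum_(0 <= i <oo) \sum_(0 <= j <oo) F (i, j))%E); last first.
  rewrite nneseries_esumT; last by move=> i; apply: nneseries_ge0.
  under [RHS]eq_esum => i _ do rewrite nneseries_esumT//.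
  rewrite esum_esum//.
  by congr esum; apply/seteqP; split => // -[].
apply: lee_nneseries => [i _ _|i _]; last exact: (PG i).2.
by apply: nneseries_ge0 => j _ _; exact: F0.
Qed.

(** In dimension 0 every box has volume 1, an empty product, so even the empty set has infinite
    [vol]. In positive dimension a finite union can be padded with empty sets for free. *)
Lemma vol_setU n (A B : set 'rV[R]_n) : (0 < n)%N ->
  (vol (A `|` B) <= vol A + vol B)%E.
Proof.
case: n A B => // n A B _.
have v0 : vol (set0 : set 'rV[R]_n.+1) = 0%E.
  apply/eqP; rewrite eq_le vol_ge0 andbT.
  have /vol_cover : set0 `<=` \bigcup_(i in [set: nat])
      box ((fun=> 0) i : 'rV[R]_n.+1) ((fun=> 0) i) by [].
  rewrite eseries0// => i _ _; rewrite /box_vol big_ord_recl mxE subrr maxxx.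
  by rewrite mul0r.
have := vol_bigcup (fun i => if i == 0%N then A else if i == 1%N then B else set0).
rewrite (nneseries_split 0 2)//; last by move=> k _; exact: vol_ge0.
rewrite big_nat_recl// big_nat1/= eseries0 ?adde0; last first.
  by move=> [|[|i]].
apply: le_trans; apply: vol_le => x [Ax|Bx]; first by exists 0%N.
by exists 1%N.
Qed.

Lemma vol_le_box n (a b : 'rV[R]_n.+1) (A : set 'rV[R]_n.+1) :
  A `<=` box a b -> (vol A <= box_vol a b)%E.
Proof.
move=> Aab.
have := vol_cover (A := A) (a := fun i => if i == 0%N then a else 0)
  (b := fun i => if i == 0%N then b else 0).
rewrite (nneseries_split 0 1)//; last by move=> k _; exact: box_vol_ge0.
rewrite big_nat1/= eseries0 ?adde0; last first.
  by case=> // i _ _ /=; rewrite /box_vol big_ord_recl mxE subrr maxxx mul0r.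
by apply => x /Aab ?; exists 0%N.
Qed.

(* The outer measure is determined by boxes, so a set relation that does not
   expand boxes by more than a factor [c] does not expand any set by more. *)
Lemma vol_image_le n m (f : 'rV[R]_n -> set 'rV[R]_m) (c : R) : 0 < c ->
  (forall a b, (vol (\bigcup_(x in box a b) f x) <= c%:E * box_vol a b)%E) ->
  forall X, (vol (\bigcup_(x in X) f x) <= c%:E * vol X)%E.
Proof.
move=> c0 fbox X; rewrite -lee_pdivrMl//.
apply: le_ereal_inf_tmp => _ [a [b [Xab ->]]].
rewrite lee_pdivrMl// -nneseriesZl; [|by move=> ? _; exact: box_vol_ge0..].
apply: (@le_trans _ _ (vol (\bigcup_i \bigcup_(x in box (a i) (b i)) f x))).
  by apply: vol_le => y [x /Xab [i _ xi] fxy]; exists i => //; exists x.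
apply: le_trans (vol_bigcup _) _.
by apply: lee_nneseries => [i _ _|i _]; [exact: vol_ge0|exact: fbox].
Qed.

End VolBasics.

(** * Sections and Cavalieri's principle *)

Section Coordinates.
Variable R : realType.

Definition vcons n (t : R) (y : 'rV[R]_n) : 'rV[R]_n.+1 :=
  \row_i (if unlift ord0 i is Some j then y 0 j else t).
Definition vtl n (x : 'rV[R]_n.+1) : 'rV[R]_n := \row_j x 0 (lift ord0 j).

Lemma vcons0 n t (y : 'rV[R]_n) : vcons t y 0 0 = t.
Proof. by rewrite mxE unlift_none. Qed.
Lemma vconsS n t (y : 'rV[R]_n) j : vcons t y 0 (lift ord0 j) = y 0 j.
Proof. by rewrite mxE liftK. Qed.
Lemma vtlE n (x : 'rV[R]_n.+1) j : vtl x 0 j = x 0 (lift ord0 j).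
Proof. by rewrite mxE. Qed.
Lemma vconsK n t (y : 'rV[R]_n) : vtl (vcons t y) = y.
Proof. by apply/rowP => j; rewrite vtlE vconsS. Qed.
Lemma vcons_vtl n (x : 'rV[R]_n.+1) : vcons (x 0 0) (vtl x) = x.
Proof.
apply/rowP => i; rewrite mxE; case: unliftP => [j ->|->] //; first by rewrite vtlE.
Qed.
Lemma vtlD n (x y : 'rV[R]_n.+1) : vtl (x + y) = vtl x + vtl y.
Proof. by apply/rowP => j; rewrite !mxE. Qed.
Lemma vtlZ n a (x : 'rV[R]_n.+1) : vtl (a *: x) = a *: vtl x.
Proof. by apply/rowP => j; rewrite !mxE. Qed.
Lemma vtlN n (x : 'rV[R]_n.+1) : vtl (- x) = - vtl x.
Proof. by apply/rowP => j; rewrite !mxE. Qed.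

Lemma vtl_continuous n : continuous (@vtl n).
Proof.
move=> x A /nbhs_ballP[e /= e0 eA].
suff : nbhs x [set y | A (vtl y)] by [].
apply: filterS (nbhsx_ballx x e e0) => y [_ xy]; apply: eA.
by split=> // i j; rewrite ord1 !vtlE.
Qed.

Definition sect n (E : set 'rV[R]_n.+1) (t : R) : set 'rV[R]_n :=
  [set y | E (vcons t y)].

Lemma boxE n (a b x : 'rV[R]_n.+1) :
  box a b x <-> (a 0 0 <= x 0 0 <= b 0 0) /\ box (vtl a) (vtl b) (vtl x).
Proof.
split=> [xab|[x0 xS] i]; first by split => // j; rewrite !vtlE.
by have [j ->|->//] := unliftP ord0 i; have := xS j; rewrite !vtlE.
Qed.

Lemma box_volE n (a b : 'rV[R]_n.+1) :
  box_vol a b = ((Num.max (b 0 0 - a 0 0) 0)%:E * box_vol (vtl a) (vtl b))%E.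
Proof.
rewrite /box_vol big_ord_recl EFinM; congr (_ * (_)%:E)%E.
by apply: eq_bigr => j _; rewrite !vtlE.
Qed.

Lemma vol_cylinder n (c d : R) (Y : set 'rV[R]_n.+1) : c < d ->
  (vol [set x : 'rV[R]_n.+2 | (c <= x 0 0 <= d)%R /\ Y (vtl x)]
    <= (d - c)%:E * vol Y)%E.
Proof.
move=> cd; have dc0 : 0 < d - c by rewrite subr_gt0.
pose f (y : 'rV[R]_n.+1) := [set x : 'rV[R]_n.+2 | c <= x 0 0 <= d /\ vtl x = y].
have := vol_image_le (f := f) dc0 _ Y.
rewrite [X in vol X](_ : _ =
    [set x : 'rV[R]_n.+2 | c <= x 0 0 <= d /\ Y (vtl x)]); last first.
  apply/seteqP; split => [x [y Yy [x0 xy]]|x [x0 Yx]]; last by exists (vtl x).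
  by split; rewrite ?xy.
apply => a b.
have := @vol_le_box _ _ (vcons c a) (vcons d b) (\bigcup_(x in box a b) f x).
rewrite box_volE !vcons0 !vconsK max_l; last exact: ltW.
by apply => x [y yab [x0 xy]]; apply/boxE; rewrite !vcons0 !vconsK xy.
Qed.

Lemma box_vol_fattened_cvg n (a b : 'rV[R]_n) :
  (\prod_(j < n) Num.max (b 0 j - a 0 j + d *+ 2) 0) @[d --> (0 : R)] -->
  \prod_(j < n) Num.max (b 0 j - a 0 j) 0.
Proof.
apply: cvg_big; first by move=> x; exact: mul_continuous.
move=> j _; pose m (x : R) := Num.max x 0.
have mc : continuous m.
  move=> x; rewrite (_ : m = fun x => (x + 0 + `|x - 0|) / 2); last first.
    by apply/funext => y; rewrite /m maxr_absE.
  apply: cvgMl; apply: cvgD; first by apply: cvgD; [exact: cvg_id|exact: cvg_cst].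
  by apply: cvg_norm; apply: cvgB; [exact: cvg_id|exact: cvg_cst].
apply: (@cvg_comp _ _ _ (fun d => b 0 j - a 0 j + d *+ 2) m _
  (nbhs (b 0 j - a 0 j))); last exact: mc.
have cont : continuous (fun d : R => b 0 j - a 0 j + d *+ 2).
  move=> x; apply: cvgD; first exact: cvg_cst.
  by apply: cvgMn; exact: cvg_id.
by have := cont 0; rewrite /continuous_at mul0rn addr0.
Qed.

Lemma open_obox n (a b : 'rV[R]_n) :
  open [set x : 'rV[R]_n | forall j, a 0 j < x 0 j < b 0 j].
Proof.
rewrite openE => x xab.
suff : nbhs x [set y : 'rV[R]_n | forall j, a 0 j < y 0 j < b 0 j] by [].
apply: (@filter_forall _ _ (fun j => [set y : 'rV[R]_n | a 0 j < y 0 j < b 0 j])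
  (nbhs x) (nbhs_filter x)) => j.
have /andP[ax xb] := xab j; near=> y; apply/andP; split; near: y.
  by apply: (cvgr_gt (x 0 j)) => //; exact: coord_continuous.
by apply: (cvgr_lt (x 0 j)) => //; exact: coord_continuous.
Unshelve. all: by end_near. Qed.

(** Outer regularity: the boxes of a near-optimal cover are fattened into open ones, the [i]-th at a
    cost of [e / 2^(i+1)]. It brings compactness to bear on [vol], both for slicing and for limits
    of maps. *)
Lemma vol_open_cover n (A : set 'rV[R]_n) (c : R) : (vol A < c%:E)%E ->
  exists U, [/\ open U, A `<=` U & (vol U <= c%:E)%E].
Proof.
move=> /vol_near_cover[a [b [Aab sc]]].
set s := (X in (X < _)%E) in sc.
have s0 : (0 <= s)%E by apply: nneseries_ge0 => i _ _; exact: box_vol_ge0.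
have sf : s \is a fin_num by rewrite ge0_fin_numE// (lt_trans sc)// ltry.
pose e := c - fine s.
have e0 : 0 < e by rewrite subr_gt0 -lte_fin fineK.
have /choice[d dP] : forall i, exists d : R, 0 < d /\
  (box_vol (a i - const_mx d) (b i + const_mx d) <=
   box_vol (a i) (b i) + (e / (2 ^ i.+1)%:R)%:E)%E.
  move=> i; have ei : 0 < e / (2 ^ i.+1)%:R by rewrite divr_gt0.
  have := @box_vol_fattened_cvg _ (a i) (b i).
  move=> /(cvgr_lt (\prod_(j < n) Num.max (b i 0 j - a i 0 j) 0)).
  move=> /(_ (\prod_(j < n) Num.max (b i 0 j - a i 0 j) 0 + e / (2 ^ i.+1)%:R)).
  rewrite ltrDl => /(_ ei) /nbhs_ballP[r /= r0 rb].
  exists (r / 2); split; first by rewrite divr_gt0.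
  rewrite /box_vol -EFinD lee_fin ltW//.
  have /rb : ball 0 r (r / 2).
    rewrite /ball/= sub0r normrN ger0_norm; last by rewrite divr_ge0// ltW.
    by rewrite ltr_pdivrMr// ltr_pMr// ltr1n.
  congr (_ < _); apply: eq_bigr => j _; rewrite !mxE; congr Num.max.
  by rewrite mulr2n; ring.
exists (\bigcup_i [set x : 'rV[R]_n | forall j,
   (a i - const_mx (d i)) 0 j < x 0 j < (b i + const_mx (d i)) 0 j]); split.
- by apply: bigcup_open => i _; exact: open_obox.
- move=> x /Aab [i _ xi]; exists i => // j; have /andP[ax xb] := xi j.
  have [di _] := dP i; rewrite !mxE; apply/andP; split.
    by rewrite (lt_le_trans _ ax)// ltrBlDr ltrDl.
  by rewrite (le_lt_trans xb)// ltrDl.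
- apply: (@le_trans _ _ (\sum_(0 <= i <oo)
    (box_vol (a i) (b i) + (e / (2 ^ i.+1)%:R)%:E))%E).
    apply: (@le_trans _ _ (\sum_(0 <= i <oo)
      box_vol (a i - const_mx (d i)) (b i + const_mx (d i)))%E).
      apply: vol_cover => x [i _ xi]; exists i => // j.
      by have /andP[/ltW -> /ltW ->] := xi j.
    by apply: lee_nneseries => [i _ _|i _]; [exact: box_vol_ge0|exact: (dP i).2].
  apply: le_trans (epsilon_trick _ _ (ltW e0)) _.
    by move=> i; exact: box_vol_ge0.
  by rewrite -/s -(fineK sf) -EFinD lee_fin /e addrC subrK.
Qed.

(** Upper semicontinuity of the sections of a compact set, as in the tube lemma: a point of [E] over
    [t] has a neighbourhood projecting into [U], and a point off [t] has one that stays away from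
    height [t]. *)
Lemma sect_subset_near n (E : set 'rV[R]_n.+1) (U : set 'rV[R]_n) (t : R) :
  compact E -> open U -> sect E t `<=` U ->
  exists2 d : R, 0 < d & forall x, E x -> `|x 0 0 - t| < d -> U (vtl x).
Proof.
move=> /compact_near_coveringP cE oU EU.
have := cE R (nbhs (0 : R)^'+) (fun d x => `|x 0 0 - t| < d -> U (vtl x)) _.
case=> [x Ex|d d0 dP].
  have [xt|xt] := eqVneq (x 0 0) t.
    have Ux : U (vtl x) by apply: EU; rewrite /sect/= -xt vcons_vtl.
    exists ([set y | U (vtl y)], setT) => /=; last by move=> [y z] [/= ? _].
    split; last exact: (@filterT _ (0 : R)^'+).
    by apply: vtl_continuous; exact: open_nbhs_nbhs.
  pose r := `|x 0 0 - t| / 2.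
  have r0 : 0 < r by rewrite divr_gt0// normr_gt0 subr_eq0.
  exists ([set y : 'rV[R]_n.+1 | r < `|y 0 0 - t|], [set d | d < r]) => /=; last first.
    by move=> [y z] [/= yr /ltW zr] /lt_le_trans/(_ zr)/(lt_trans yr); rewrite ltxx.
  split; last exact: nbhs_right_lt.
  apply: filterS (nbhsx_ballx x r r0) => y [_ /(_ 0 0)]; rewrite /ball/= => xy.
  rewrite -(ltrD2l r) -mulr2n -mulr_natr /r divfK//.
  rewrite (le_lt_trans (ler_distD (y 0 0) _ _))// ltrD2r.
  exact: xy.
have d20 : 0 < d / 2 by rewrite divr_gt0.
exists (d / 2) => //; move=> x Ex; apply: (dP (d / 2)) => //=.
by rewrite sub0r normrN gtr0_norm// ltr_pdivrMr// ltr_pMr// ltr1n.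
Qed.

(** Cousin's lemma for intervals that contain their tag [t]. The local property at the supremum of
    the reachable points joins one just below it to points just above it. It replaces integration in
    [vol_slab_le], where the section volumes are not known to depend measurably on the height. *)
Lemma cousin (P : R -> R -> Prop) (a b : R) : a < b ->
  (forall c d e, a <= c -> c < d -> d < e -> e <= b -> P c d -> P d e -> P c e) ->
  (forall t, a <= t <= b -> exists2 r : R, 0 < r &
    forall c d, a <= c -> c <= t -> t <= d -> d <= b -> c < d ->
      t - r < c -> d < t + r -> P c d) ->
  P a b.
Proof.
move=> ab Padd Ploc.
pose S := [set x | a < x <= b /\ P a x].
have [r0 r00 Pr0] := Ploc a (introT andP (conj (lexx a) (ltW ab))).
have Sne : S !=set0.
  pose x := Num.min b (a + r0 / 2).
  have ax : a < x by rewrite lt_min ab ltrDl divr_gt0.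
  have xb : x <= b by rewrite ge_min lexx.
  exists x; split; first by rewrite ax xb.
  apply: Pr0 => //; [exact: ltW|by rewrite ltrBlDr ltrDl|].
  by rewrite gt_min ltrD2l ltr_pdivrMr// ltr_pMr// ltr1n orbT.
have Sub : has_ubound S by exists b => x [/andP[]].
have supS : has_sup S by [].
set s := sup S.
have sb : s <= b by apply: ge_sup => // x [/andP[]].
have as_ : a < s.
  have [x Sx] := Sne; have [/andP[ax _] _] := Sx.
  by apply: lt_le_trans ax _; apply: ub_le_sup.
have [r r_gt0 Pr] := Ploc s (introT andP (conj (ltW as_) sb)).
have [x Sx sx] := sup_adherent r_gt0 supS.
have [/andP[ax xb] Pax] := Sx.
have xs : x <= s by apply: ub_le_sup.
have ext y : s <= y -> y <= b -> y < s + r -> P a y.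
  move=> sy yb yr; have [xy|xy] := ltP x y; last first.
    by have -> : y = x by apply/eqP; rewrite eq_le xy (le_trans xs).
  by apply: (Padd a x y) => //; apply: Pr => //; exact: ltW.
have [bs|sb'] := ltP b (s + r); first exact: ext.
pose y := s + r / 2.
have yr : y < s + r by rewrite ltrD2l ltr_pdivrMr// ltr_pMr// ltr1n.
have sy : s < y by rewrite ltrDl divr_gt0.
have Sy : S y.
  split; last by apply: ext => //; [exact: ltW|rewrite (le_trans (ltW yr))].
  by rewrite (lt_trans as_ sy)/= (le_trans (ltW yr)).
by have := ub_le_sup Sub Sy; rewrite leNgt sy.
Qed.

Definition slab n (c d : R) (E : set 'rV[R]_n.+1) : set 'rV[R]_n.+1 :=
  E `&` [set x | c <= x 0 0 <= d].

(** Upper half of Cavalieri's principle, with the integral of [g] written as an increment of its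
    primitive. Around each height [E] lies in a cylinder over an open set of volume at most
    [g t + e'], while the slopes of [G] exceed [g t - e']; the total error is [2 e'] per unit of
    length. *)
Lemma vol_slab_le n (E : set 'rV[R]_n.+2) (a b : R) (G g : R -> R) : a < b ->
  compact E ->
  (forall t, a <= t <= b -> (vol (sect E t) <= (g t)%:E)%E /\ is_derive t 1 G (g t)) ->
  (vol (slab a b E) <= (G b - G a)%:E)%E.
Proof.
move=> ab cE Eg.
apply/lee_addgt0Pr => e e0; rewrite -EFinD.
pose e' := e / (b - a) / 2.
have ba0 : 0 < b - a by rewrite subr_gt0.
have e'0 : 0 < e' by rewrite !divr_gt0.
suff : (vol (slab a b E) <= (G b - G a + (e' *+ 2) * (b - a))%:E)%E.
  congr (_ <= (_ + _)%:E)%E; rewrite /e' -mulr_natr divfK// divfK//.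
  by rewrite gt_eqF.
pose P c d := (vol (slab c d E) <= (G d - G c + (e' *+ 2) * (d - c))%:E)%E.
apply: (@cousin P) => // [c d k _ cd dk _ Pcd Pdk|t tab].
  rewrite /P; apply: (@le_trans _ _ (vol (slab c d E `|` slab d k E))).
    apply: vol_le => x [Ex /andP[cx xk]]; have [xd|xd] := leP (x 0 0) d.
      by left; split => //=; rewrite cx.
    by right; split => //=; rewrite ltW.
  apply: le_trans (vol_setU _ _ _) _ => //.
  apply: le_trans (leeD Pcd Pdk) _; rewrite -EFinD lee_fin.
  by rewrite le_eqVlt; apply/orP; left; apply/eqP; ring.
have [Et dG] := Eg t tab.
have [U [oU EU volU]] : exists U, [/\ open U, sect E t `<=` U &
    (vol U <= (g t + e')%:E)%E].
  by apply: vol_open_cover; rewrite (le_lt_trans Et)// lte_fin ltrDl.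
have [d d0 dP] := sect_subset_near cE oU EU.
(* [q] is the slope function of [G] based at [t], continuous at [t] with value [g t]; the increment
   over [[c, k]] is later split at the tag [t] into two such slopes. *)
have /is_derive1_caratheodory[q [Gq qc qt]] := dG.
have /cvgr_gt/(_ (g t - e')) := qc.
rewrite qt ltrBlDr ltrDl => /(_ e'0)/nbhs_ballP[r /= r0 rP].
exists (Num.min d r); first by rewrite lt_min d0.
move=> c k ac ct tk kb ck; rewrite ltrBlDr => tc kt.
rewrite /P; apply: (@le_trans _ _ ((k - c)%:E * vol U)%E).
  apply: le_trans _ (vol_cylinder _ ck); apply: vol_le => x [Ex /= xck].
  split => //; apply: dP => //; move: xck => /andP[cx xk].
  have cd : t < c + d by rewrite (lt_le_trans tc)// lerD2l ge_min lexx.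
  have kd : k < t + d by rewrite (lt_le_trans kt)// lerD2l ge_min lexx.
  by rewrite ltr_norml; apply/andP; split; lra.
apply: (@le_trans _ _ ((k - c)%:E * (g t + e')%:E)%E).
  by rewrite lee_pmul2l// lte_fin subr_gt0.
rewrite -EFinM lee_fin.
have qc' : g t - e' < q c.
  apply: rP; rewrite /ball/= ger0_norm ?subr_ge0//.
  by rewrite ltrBlDl (lt_le_trans tc)// lerD2l ge_min lexx orbT.
have qk : g t - e' < q k.
  apply: rP; rewrite /ball/= distrC ger0_norm ?subr_ge0//.
  by rewrite ltrBlDl (lt_le_trans kt)// lerD2l ge_min lexx orbT.
have -> : G k - G c = q k * (k - t) + q c * (t - c).
  by rewrite -(subrKA (G t)) Gq -(opprB (G c)) Gq; ring.
have k1 : (g t - e') * (k - t) <= q k * (k - t).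
  by rewrite ler_wpM2r ?subr_ge0// ltW.
have c1 : (g t - e') * (t - c) <= q c * (t - c).
  by rewrite ler_wpM2r ?subr_ge0// ltW.
rewrite mulr2n; lra.
Qed.

End Coordinates.

(** * Lower bounds by slicing, and the volume of a box *)

Section Lower.
Variable R : realType.

Lemma is_derive_mulrl (c x : R) : is_derive x 1 (fun t => c * t) c.
Proof.
have -> : (fun t => c * t) = c \*: (@id R) by [].
by apply: is_derive_eq; rewrite /GRing.scale/= mulr1.
Qed.

(** Cutting each box of a cover at height [c] covers both halves at no extra cost. This lets lower
    bounds on adjacent slabs be added, although [vol] is only an infimum. *)
Lemma vol_split n (X : set 'rV[R]_n.+1) (c : R) :
  (vol (X `&` [set x | (x 0 0 <= c)%R]) + vol (X `&` [set x | (c <= x 0 0)%R])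
    <= vol X)%E.
Proof.
apply: le_ereal_inf_tmp => _ [a [b [Xab ->]]].
pose b' i := vcons (Num.min (b i 0 0) c) (vtl (b i)).
pose a' i := vcons (Num.max (a i 0 0) c) (vtl (a i)).
apply: (@le_trans _ _ (\sum_(0 <= i <oo)
    (box_vol (a i) (b' i) + box_vol (a' i) (b i)))%E).
  rewrite nneseriesD; [|by move=> *; exact: box_vol_ge0..].
  apply: leeD; apply: vol_cover => x [/Xab [i _ /boxE[/andP[ax xb] tx]] /= xc];
    exists i => //; apply/boxE; rewrite vcons0 vconsK; split => //.
    by rewrite ax le_min xb xc.
  by rewrite xb ge_max ax xc.
apply: lee_nneseries => [i _ _|i _]; first by rewrite adde_ge0// box_vol_ge0.
rewrite !box_volE !vcons0 !vconsK -!EFinM -EFinD lee_fin -mulrDl.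
apply: ler_wpM2r; first by have := box_vol_ge0 (vtl (a i)) (vtl (b i)).
move: (a i 0 0) (b i 0 0) => p q; rewrite !maxEle !minEle.
by do ![case: ifPn; rewrite -?ltNge => ?]; lra.
Qed.

Lemma vol_slab_split n (E : set 'rV[R]_n.+1) (a b c : R) : a <= b -> b <= c ->
  (vol (slab a b E) + vol (slab b c E) <= vol (slab a c E))%E.
Proof.
move=> ab bc; apply: le_trans (vol_split (slab a c E) b).
apply: leeD; apply: vol_le => x [Ex /= /andP[h1 h2]]; do 2![split => //] => /=;
  by rewrite ?h1 ?h2 ?(le_trans ab h1) ?(le_trans h2).
Qed.

(** Lower half of Cavalieri's principle. For any cover of [E], the boxes met at height [t] have
    bases covering the section, so [g t] is at most a sum of step functions of [t], whose termwise
    integral is at most the total volume of the cover. *)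
Lemma vol_ge_integral n (E : set 'rV[R]_n.+2) (a b : R) (g : R -> R) :
  measurable_fun `[a, b] g ->
  (forall t, a <= t <= b -> 0 <= g t /\ ((g t)%:E <= vol (sect E t))%E) ->
  (\int[lebesgue_measure]_(t in `[a, b]) (g t)%:E <= vol E)%E.
Proof.
move=> mg gE; apply: le_ereal_inf_tmp => _ [A [B [EAB ->]]].
pose I i : set R := `[A i 0 0, B i 0 0]%classic.
have mI i : measurable (I i) by exact: measurable_itv.
pose v i := fine (box_vol (vtl (A i)) (vtl (B i))).
have v0 i : 0 <= v i by have := box_vol_ge0 (vtl (A i)) (vtl (B i)).
pose h i (t : R) := ((v i)%:E * (\1_(I i) t)%:E)%E.
have h0 i t : (0 <= h i t)%E by rewrite mule_ge0// lee_fin.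
have mind i : measurable_fun `[a, b] (fun t : R => (\1_(I i) t : R)%:E).
  by apply/measurable_EFinP; exact: measurable_indic.
have mh i : measurable_fun `[a, b] (h i).
  exact: measurable_funeM.
apply: (@le_trans _ _ (\int[lebesgue_measure]_(t in `[a, b])
    (\sum_(0 <= i <oo) h i t))%E).
  apply: ge0_le_integral => //=.
  - by move=> t /=; rewrite in_itv/= => /gE[]; rewrite lee_fin.
  - exact/measurable_EFinP.
  - by apply: ge0_emeasurable_sum => // k _; exact: mh.
  - move=> t /=; rewrite in_itv/= => /gE[_ gt]; apply: le_trans gt _.
    (* A box that misses height [t] is replaced by a point box, of volume 0. *)
    pose A' i := if A i 0 0 <= t <= B i 0 0 then vtl (A i) else 0.
    pose B' i := if A i 0 0 <= t <= B i 0 0 then vtl (B i) else 0.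
    apply: (@le_trans _ _ (\sum_(0 <= i <oo) box_vol (A' i) (B' i))%E).
      apply: vol_cover => y /EAB[i _ /boxE[]]; rewrite vcons0 vconsK => ti yi.
      by exists i => //; rewrite /A' /B' ti.
    apply: lee_nneseries => [i _ _|i _]; first exact: box_vol_ge0.
    rewrite /A' /B' /h indicE mem_setE/= in_itv/=; case: ifP => _.
      by rewrite mule1.
    by rewrite mule0 /box_vol big_ord_recl mxE subrr maxxx mul0r.
rewrite integral_nneseries//.
apply: lee_nneseries => [i _ _|i _]; first by apply: integral_ge0.
rewrite /h ge0_integralZl//; [|exact: mind|by rewrite lee_fin].
rewrite integral_indic//; last exact: mI.
rewrite [leRHS](box_volE (A i) (B i)) [leRHS]muleC; apply: lee_pmul => //.
  by rewrite lee_fin.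
apply: (@le_trans _ _ (lebesgue_measure (I i))).
  apply: le_measure; rewrite ?inE; last exact: subIsetl.
    by apply: measurableI; [exact: mI|exact: measurable_itv].
  exact: mI.
rewrite /I lebesgue_measure_itv/= lte_fin; case: ltP => h1.
    by rewrite -EFinD lee_fin le_max lexx.
  by rewrite lee_fin le_max lexx orbT.
Qed.

Lemma integral_is_derive (a b : R) (G g : R -> R) : a < b -> continuous g ->
  (forall t : R, is_derive t 1 G (g t)) ->
  (\int[lebesgue_measure]_(t in `[a, b]) (g t)%:E = (G b - G a)%:E)%E.
Proof.
move=> ab cg dG.
have dG' t : derivable G t 1 by have := dG t; case.
have cG : continuous G.
  by move=> t; apply: differentiable_continuous; exact/derivable1_diffP.
rewrite (continuous_FTC2 ab (F := G)) -?EFinB//.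
- exact: continuous_subspaceT.
- split => //.
  + by apply: cvg_at_right_filter; exact: cG.
  + by apply: cvg_at_left_filter; exact: cG.
- by move=> t _; rewrite derive1E; exact: derive_val.
Qed.

Lemma vol_slab_ge n (E : set 'rV[R]_n.+2) (a b : R) (G g : R -> R) : a < b ->
  continuous g -> (forall t : R, is_derive t 1 G (g t)) ->
  (forall t, a <= t <= b -> 0 <= g t /\ ((g t)%:E <= vol (sect E t))%E) ->
  ((G b - G a)%:E <= vol (slab a b E))%E.
Proof.
move=> ab cg dG gE; rewrite -(integral_is_derive ab cg dG).
apply: vol_ge_integral.
  by apply: measurable_funTS; exact: continuous_measurable_fun.
move=> t tab; have [g0 gt] := gE t tab; split => //; apply: le_trans gt _.
by apply: vol_le => y Ey; split; rewrite //= vcons0.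
Qed.

(** The base case of all lower bounds: in dimension one a cover by boxes is compared with the
    Lebesgue measure through its countable subadditivity. *)
Lemma vol1_ge (E : set 'rV[R]_1) (a b : R) : a <= b ->
  (forall t, a <= t <= b -> E (vcons t 0)) -> ((b - a)%:E <= vol E)%E.
Proof.
move=> ab Eab; apply: le_ereal_inf_tmp => _ [A [B [EAB ->]]].
have -> : (b - a)%:E = lebesgue_measure (`[a, b]%classic : set R).
  rewrite lebesgue_measure_itv/= lte_fin; case: ltP => //.
  by move=> ba; have -> : a = b by [apply/eqP; rewrite eq_le ab]; rewrite subrr.
have : (lebesgue_measure (`[a, b]%classic : set R) <= \sum_(0 <= i <oo)
    lebesgue_measure (`[A i ord0 ord0, B i ord0 ord0]%classic : set R))%E.
  apply: measure_sigma_subadditive => //.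
  move=> t /=; rewrite in_itv/= => /Eab/EAB[i _ /boxE[]]; rewrite vcons0 => ti _.
  by exists i => //=; rewrite in_itv.
move=> /le_trans; apply; apply: lee_nneseries => [i _ _|i _] //.
rewrite /box_vol big_ord_recl big_ord0 mulr1 lebesgue_measure_itv/= lte_fin.
case: ltP => h1; first by rewrite -EFinD lee_fin le_max lexx.
by rewrite lee_fin le_max lexx orbT.
Qed.

Lemma vol_box n (a b : 'rV[R]_n.+1) : (forall j, a 0 j <= b 0 j) ->
  vol (box a b) = box_vol a b.
Proof.
move=> ab; apply/eqP; rewrite eq_le vol_le_box//=.
elim: n a b ab => [a b ab|n IH a b ab].
  rewrite /box_vol big_ord_recl big_ord0 mulr1 max_l ?subr_ge0//.
  apply: vol1_ge => // t tab; apply/boxE; rewrite vcons0; split => // -[] //.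
rewrite box_volE max_l ?subr_ge0//.
have [ab0|ab0] := ltP (a 0 0) (b 0 0); last first.
  have -> : a 0 0 = b 0 0 by apply/eqP; rewrite eq_le ab.
  by rewrite subrr mul0e vol_ge0.
set w := box_vol (vtl a) (vtl b).
have w0 : (0 <= w)%E by exact: box_vol_ge0.
apply: (@le_trans _ _ (vol (slab (a 0 0) (b 0 0) (box a b)))); last first.
  by apply: vol_le => x [].
have := @vol_slab_ge _ (box a b) _ _ (fun t => fine w * t) (fun=> fine w) ab0.
rewrite -mulrBr mulrC EFinM fineK//; apply.
- by move=> x; exact: cvg_cst.
- by move=> t; exact: is_derive_mulrl.
- move=> t tab; rewrite ?fineK//; split.
    by move: w0; rewrite -lee_fin /w /box_vol.
  apply: le_trans (IH _ _ _) _ => [j|]; first by rewrite !vtlE.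
  by apply: vol_le => y yab; apply/boxE; rewrite vcons0 vconsK.
Qed.

End Lower.

(** * Volume under affine maps *)

Section Linear.
Variable R : realType.

Lemma vol_set0 n : vol (set0 : set 'rV[R]_n.+1) = 0%E.
Proof.
apply/eqP; rewrite eq_le vol_ge0 andbT.
have := @vol_le_box R n 0 0 set0 (@sub0set _ _).
by rewrite /box_vol big_ord_recl mxE subrr maxxx mul0r.
Qed.

(** The flat case [c = d] is reached by thickening the cylinder by [e / (v + 1)], which costs at
    most [e] because the base has a finite bound. *)
Lemma vol_cylinder_le n (c d : R) (Y : set 'rV[R]_n.+1) (v : R) : c <= d ->
  (vol Y <= v%:E)%E ->
  (vol [set x : 'rV[R]_n.+2 | (c <= x 0 0 <= d)%R /\ Y (vtl x)]
    <= ((d - c) * v)%:E)%E.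
Proof.
move=> cd Yv; apply/lee_addgt0Pr => e e0; rewrite -EFinD.
have v0 : 0 <= v by rewrite -lee_fin (le_trans (vol_ge0 Y)).
have v1 : 0 < v + 1 by rewrite ltr_wpDl.
pose d' := d + e / (v + 1).
have dd' : d < d' by rewrite ltrDl divr_gt0.
apply: le_trans (vol_le _ : (_ <= vol [set x : 'rV[R]_n.+2 |
    (c <= x 0 0 <= d')%R /\ Y (vtl x)])%E) _.
  by move=> x [/andP[h1 h2] h3]; split => //=; rewrite h1 (le_trans h2)// ltW.
apply: le_trans (vol_cylinder _ (le_lt_trans cd dd')) _.
apply: (@le_trans _ _ ((d' - c)%:E * v%:E)%E).
  by rewrite lee_pmul2l// lte_fin subr_gt0 (le_lt_trans cd).
rewrite -EFinM lee_fin /d' addrAC mulrDl lerD2l -mulrA ger_pMr//.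
by rewrite mulrC ler_pdivrMr// mul1r lerDl.
Qed.

(** Only an upper bound, since that is what composes along a factorisation; applied to the inverse
    matrix it becomes the equality [vol_affine]. *)
Definition vol_img n (A : 'M[R]_n.+1) := forall X : set 'rV[R]_n.+1,
  (vol ((fun x => x *m A) @` X) <= `|\det A|%:E * vol X)%E.

Lemma vol_img_box n (A : 'M[R]_n.+1) : \det A != 0 ->
  (forall a b : 'rV[R]_n.+1, (forall j, a 0 j <= b 0 j) ->
    (vol ((fun x => x *m A) @` box a b) <= `|\det A|%:E * box_vol a b)%E) ->
  vol_img A.
Proof.
move=> dA Abox X; have dA0 : 0 < `|\det A| by rewrite normr_gt0.
have H Y : (fun x => x *m A) @` Y = \bigcup_(x in Y) [set x *m A].
  by apply/seteqP; split => [y [x Yx <-]|y [x Yx ->]]; exists x.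
rewrite H; apply: vol_image_le => // a b; rewrite -H.
have [ab|/existsNP[j /negP]] := pselect (forall j, a 0 j <= b 0 j); first exact: Abox.
rewrite -ltNge => ba; rewrite [X in vol X](_ : _ = set0).
  by rewrite vol_set0 mule_ge0// box_vol_ge0.
apply/seteqP; split => // y [x xab _]; have /andP[ax xb] := xab j.
by have := le_trans ax xb; rewrite leNgt ba.
Qed.

Lemma vol_img_mul n (A B : 'M[R]_n.+1) :
  vol_img A -> vol_img B -> vol_img (A *m B).
Proof.
move=> HA HB X.
have -> : (fun x => x *m (A *m B)) @` X =
    (fun x => x *m B) @` ((fun x => x *m A) @` X).
  apply/seteqP; split => [y [x Xx <-]|y [_ [x Xx <-] <-]].
    by exists (x *m A); [exists x|rewrite mulmxA].
  by exists x => //; rewrite mulmxA.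
apply: le_trans (HB _) _; rewrite det_mulmx normrM mulrC EFinM -muleA.
by apply: lee_wpmul2l.
Qed.

Lemma vol_img1 n : vol_img (1%:M : 'M[R]_n.+1).
Proof.
move=> X; rewrite det1 normr1 mul1e; apply: vol_le => y [x Xx <-].
by rewrite mulmx1.
Qed.

Lemma vol_img_perm n (s : 'S_n.+1) : vol_img (perm_mx s : 'M[R]_n.+1).
Proof.
apply: vol_img_box; first by rewrite det_perm signr_eq0.
move=> a b ab; rewrite det_perm normr_sign mul1e.
have E x : x *m (perm_mx s : 'M[R]_n.+1) = col_perm s^-1%g x by rewrite col_permE invgK.
apply: le_trans (vol_le_box (a := col_perm s^-1%g a) (b := col_perm s^-1%g b) _) _.
  by move=> y [x xab <-] j; rewrite E !mxE; exact: xab.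
rewrite [leRHS]/box_vol (reindex_inj (@perm_inj _ s^-1%g))/= lee_fin.
by rewrite le_eqVlt; apply/orP; left; apply/eqP/eq_bigr => j _; rewrite !mxE.
Qed.

Lemma vcons_row_mx n t (y : 'rV[R]_n) : vcons t y = row_mx (t%:M : 'M[R]_1) y.
Proof.
apply/rowP => i; rewrite !mxE; case: splitP => j ij.
  by rewrite ord1 in ij; have -> : i = ord0 by [exact/val_inj]; rewrite unlift_none mxE ord1.
by have -> : i = lift ord0 j by [apply/val_inj; rewrite /= ij /bump leq0n]; rewrite liftK.
Qed.

Lemma box_compact n (a b : 'rV[R]_n) : compact (box a b).
Proof.
have := @rV_compact R n (fun j => `[a 0 j, b 0 j]%classic) _.
by apply => j; exact: segment_compact.
Qed.

Lemma mulmxr_continuous n (A : 'M[R]_n.+1) :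
  continuous (fun x : 'rV[R]_n.+1 => x *m A).
Proof.
move=> x; apply/(@cvgrPdist_lt _ _ _ (nbhs x)) => e e0.
pose M := \sum_i \sum_j `|A i j| + 1.
have M0 : 0 < M by rewrite ltr_wpDl// sumr_ge0// => i _; rewrite sumr_ge0.
apply: filterS (nbhsx_ballx x (e / M) (divr_gt0 e0 M0)) => y [_ xy] /=.
rewrite -mulmxBl; rewrite [ltLHS]/Num.norm/= mx_normrE; apply/bigmax_ltP; split => // -[i j] _ /=.
rewrite mxE (le_lt_trans (ler_norm_sum _ _ _))//.
apply: (@le_lt_trans _ _ (\sum_k (e / M) * `|A k j|)).
  apply: ler_sum => k _; rewrite normrM ler_wpM2r// !mxE.
  exact/ltW/xy.
rewrite -mulr_sumr -mulrA gtr_pMr// mulrC ltr_pdivrMr// mul1r /M.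
rewrite ltr_pwDr//; apply: ler_sum => k _.
by rewrite (bigD1 j)//= lerDl sumr_ge0.
Qed.

(* A shear by a multiple of the first coordinate translates every section. *)
Lemma vol_img_shear n (v : 'rV[R]_n.+1) :
  vol_img (block_mx 1%:M v 0 1%:M : 'M[R]_(1 + n.+1)).
Proof.
have d1 : \det (block_mx 1%:M v 0 1%:M : 'M[R]_(1 + n.+1)) = 1.
  by rewrite det_ublock !det1 mul1r.
apply: vol_img_box; first by rewrite d1 oner_eq0.
move=> a b ab; rewrite d1 normr1 mul1e.
have E (x : 'rV[R]_(1 + n.+1)) : x *m block_mx 1%:M v 0 1%:M =
    vcons (x 0 0) (x 0 0 *: v + vtl x).
  rewrite -{1}(vcons_vtl x) !vcons_row_mx mul_row_block mulmx1 mulmx0 addr0.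
  by rewrite mulmx1 mul_scalar_mx.
set I := (X in vol X).
have Isub : I `<=` [set x | a 0 0 <= x 0 0 <= b 0 0].
  by move=> y [x /boxE[x0 _] <-]; rewrite E /= vcons0.
rewrite box_volE max_l ?subr_ge0//.
have w0 := box_vol_ge0 (vtl a) (vtl b).
set w := box_vol _ _ in w0 *.
have secv t : (vol (sect I t) <= w)%E.
  have -> : w = box_vol (vtl a + t *: v) (vtl b + t *: v).
    rewrite /w /box_vol; congr EFin; apply: eq_bigr => j _.
    by rewrite !mxE opprD addrACA subrr addr0.
  apply: vol_le_box => y [x /boxE[x0 xS]]; rewrite E => xy j.
  have t0 : x 0 0 = t by have /(congr1 (fun z : 'rV[R]_n.+2 => z 0 0)) := xy; rewrite !vcons0.
  have /(congr1 (@vtl _ _)) := xy; rewrite !vconsK t0 => <-.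
  by have := xS j; rewrite !mxE [t * _ + _]addrC !lerD2r.
(* A box that is flat in the first coordinate is outside the scope of [vol_slab_le] and is treated
   as a cylinder over one section. *)
have [ab0|ba0] := ltP (a 0 0) (b 0 0); last first.
  have IS : I `<=` [set x : 'rV[R]_n.+2 |
      a 0 0 <= x 0 0 <= b 0 0 /\ sect I (a 0 0) (vtl x)].
    move=> y Iy; have /andP[h1 h2] := Isub _ Iy; split; first exact: Isub.
    have <- : y 0 0 = a 0 0 by apply/eqP; rewrite eq_le h1 (le_trans h2).
    by rewrite /sect/= vcons_vtl.
  apply: le_trans (vol_le IS) _.
  have -> : w = (fine w)%:E by [].
  by rewrite -EFinM; apply: vol_cylinder_le (secv _); exact: ab.
have := @vol_slab_le R n I (a 0 0) (b 0 0) (fun t => fine w * t) (fun=> fine w) ab0.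
rewrite -mulrBr mulrC EFinM => H.
have IS : I `<=` slab (a 0 0) (b 0 0) I.
  by move=> y Iy; split => //; exact: Isub.
apply: le_trans (vol_le IS) _; apply: H => [|t tab].
  apply: (@continuous_compact _ _ (fun x : 'rV[R]_n.+2 => x *m _)); last exact: box_compact.
  by apply: continuous_subspaceT; exact: mulmxr_continuous.
by split; [exact: secv|exact: is_derive_mulrl].
Qed.

Lemma vol_img_diag n (a : R) (D : 'M[R]_n.+1) : a != 0 -> \det D != 0 -> vol_img D ->
  vol_img (block_mx a%:M 0 0 D : 'M[R]_(1 + n.+1)).
Proof.
move=> a0 D0 HD.
have dE : \det (block_mx a%:M 0 0 D : 'M[R]_(1 + n.+1)) = a * \det D.
  by rewrite det_ublock det_scalar1.
apply: vol_img_box; first by rewrite dE mulf_neq0.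
move=> l u lu; rewrite dE.
have E (x : 'rV[R]_(1 + n.+1)) : x *m block_mx a%:M 0 0 D =
    vcons (a * x 0 0) (vtl x *m D).
  rewrite -{1}(vcons_vtl x) !vcons_row_mx mul_row_block !mulmx0 addr0 add0r.
  by rewrite -scalar_mxM mulrC.
rewrite box_volE max_l ?subr_ge0//.
set w := box_vol _ _.
have w0 : (0 <= w)%E := box_vol_ge0 _ _.
have -> : (`|a * \det D|%:E * ((u 0 0 - l 0 0)%:E * w) =
    ((`|a| * (u 0 0 - l 0 0)) * (`|\det D| * fine w))%:E)%E.
  have -> : w = (fine w)%:E by [].
  by rewrite /= -!EFinM normrM; congr EFin; ring.
have HDw : (vol ((fun x => x *m D) @` box (vtl l) (vtl u)) <= (`|\det D| * fine w)%:E)%E.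
  apply: le_trans (HD _) _; rewrite EFinM; apply: lee_wpmul2l => //.
  by rewrite vol_le_box.
have lu0 : l 0 0 <= u 0 0 by [].
have [ap|an] := ger0P a.
- rewrite mulrBr; apply: le_trans (vol_cylinder_le _ HDw).
    apply: vol_le => y [x /boxE[/andP[h1 h2] hx] <-]; rewrite E /= vcons0 vconsK.
    by split; [rewrite !ler_wpM2l//|exists (vtl x)].
  by rewrite ler_wpM2l.
- have -> : - a * (u 0 0 - l 0 0) = a * l 0 0 - a * u 0 0 by ring.
  apply: le_trans (vol_cylinder_le _ HDw).
    apply: vol_le => y [x /boxE[/andP[h1 h2] hx] <-]; rewrite E /= vcons0 vconsK.
    by split; [rewrite !ler_wnM2l// ltW|exists (vtl x)].
  by rewrite ler_wnM2l// ltW.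
Qed.

(** The shear is a product of shears with one nonzero entry, each conjugate by a transposition of
    coordinates to a shear covered by [vol_img_shear]. *)
Lemma vol_img_lshear n (v : 'cV[R]_n.+1) :
  vol_img (block_mx 1%:M 0 v 1%:M : 'M[R]_(1 + n.+1)).
Proof.
rewrite (matrix_sum_delta v); under eq_bigr do rewrite big_ord1.
elim/big_rec: _ => [|j w _ IH].
  by rewrite -scalar_mx_block; exact: vol_img1.
set c := v j 0.
have -> : block_mx 1%:M 0 (c *: delta_mx j 0 + w) 1%:M =
    (block_mx 1%:M 0 (c *: delta_mx j 0) 1%:M : 'M[R]_(1 + n.+1)) *m
    block_mx 1%:M 0 w 1%:M.
  by rewrite mulmx_block !(mulmx0, mul0mx, mulmx1, mul1mx, addr0, add0r).
apply: vol_img_mul => //.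
pose P : 'M[R]_(1 + n.+1) := tperm_mx (lshift _ 0) (rshift _ j).
have -> : block_mx 1%:M 0 (c *: delta_mx j 0) 1%:M =
    P *m block_mx 1%:M (c *: delta_mx 0 j) 0 1%:M *m P.
  have E1 : block_mx 1%:M (c *: delta_mx 0 j) 0 1%:M =
      1%:M + c *: delta_mx (lshift n.+1 (0 : 'I_1)) (rshift 1 j).
    apply/matrixP => p q; rewrite -(splitK p) -(splitK q) /unsplit.
    case: (fintype.split p) => p'; case: (fintype.split q) => q';
      rewrite ?(block_mxEul, block_mxEur, block_mxEdl, block_mxEdr) !mxE
        ?(eq_lshift, eq_rshift, eq_lrshift, eq_rlshift)
        ?(andbT, andbF, mulr0, addr0, add0r) //.
  have E2 : block_mx 1%:M 0 (c *: delta_mx j 0) 1%:M =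
      1%:M + c *: delta_mx (rshift 1 j) (lshift n.+1 (0 : 'I_1)).
    apply/matrixP => p q; rewrite -(splitK p) -(splitK q) /unsplit.
    case: (fintype.split p) => p'; case: (fintype.split q) => q';
      rewrite ?(block_mxEul, block_mxEur, block_mxEdl, block_mxEdr) !mxE
        ?(eq_lshift, eq_rshift, eq_lrshift, eq_rlshift)
        ?(andbT, andbF, mulr0, addr0, add0r) //.
  rewrite E1 E2 /P -xrowE -xcolE; apply/matrixP => p q; rewrite !mxE.
  rewrite (inj_eq perm_inj); congr (_ + _ * (_ && _)%:R).
    by rewrite -{2}(tpermR (lshift n.+1 (0 : 'I_1)) (rshift 1 j)) (inj_eq perm_inj).
  by rewrite -{2}(tpermL (lshift n.+1 (0 : 'I_1)) (rshift 1 j)) (inj_eq perm_inj).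
apply: vol_img_mul; last exact: vol_img_perm.
by apply: vol_img_mul; [exact: vol_img_perm|exact: vol_img_shear].
Qed.

(** Gaussian elimination: a column swap brings a nonzero pivot to the corner, and the result factors
    as lower shear, block diagonal, upper shear, with the Schur complement [D] left to the
    induction. *)
Theorem vol_img_unit n (A : 'M[R]_n.+1) : \det A != 0 -> vol_img A.
Proof.
elim: n A => [A dA|n IH A dA].
  apply: vol_img_box => // a b ab; rewrite /box_vol big_ord1.
  have A1 : A = (A 0 0)%:M by rewrite -mx11_scalar.
  have dE : \det A = A 0 0 by rewrite A1 det_scalar1 -A1.
  rewrite max_l ?subr_ge0// dE -EFinM.
  have xA (x : 'rV[R]_1) : x *m A = A 0 0 *: x by rewrite {1}A1 mul_mx_scalar.
  have [ap|an] := ger0P (A 0 0).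
    apply: le_trans (vol_le_box (a := A 0 0 *: a) (b := A 0 0 *: b) _) _.
      move=> y [x xab <-] j; have /andP[h1 h2] := xab j.
      by rewrite xA !mxE !ler_wpM2l.
    by rewrite /box_vol big_ord1 !mxE -mulrBr max_l// mulr_ge0// subr_ge0.
  apply: le_trans (vol_le_box (a := A 0 0 *: b) (b := A 0 0 *: a) _) _.
    move=> y [x xab <-] j; have /andP[h1 h2] := xab j.
    by rewrite xA !mxE !ler_wnM2l// ltW.
  rewrite /box_vol big_ord1 !mxE -mulrBr max_l//.
    by rewrite lee_fin le_eqVlt; apply/orP; left; apply/eqP; ring.
  by rewrite mulr_le0 ?subr_le0// ltW.
have [j Aj] : exists j, A 0 j != 0.
  apply/existsP; apply: contraNT dA; rewrite negb_exists => /forallP A0.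
  rewrite (expand_det_row _ 0) big1// => j _.
  by have := A0 j; rewrite negbK => /eqP ->; rewrite mul0r.
pose B : 'M[R]_(1 + n.+1) := A *m tperm_mx 0 j.
have AB : A = B *m tperm_mx 0 j.
  by rewrite /B -mulmxA -perm_mxM tperm2 perm_mx1 mulmx1.
have dB : \det B != 0 by rewrite det_mulmx mulf_neq0// det_perm signr_eq0.
have B0 : B 0 0 != 0 by rewrite /B -xcolE mxE tpermL.
rewrite AB; apply: vol_img_mul; last exact: vol_img_perm.
set a := B 0 0 in B0.
have ulE : ulsubmx B = a%:M.
  rewrite [LHS]mx11_scalar; congr (_%:M).
  rewrite /ulsubmx /lsubmx /usubmx mxE mxE /a; congr (B _ _); exact/val_inj.
pose D := drsubmx B - dlsubmx B *m (a^-1 *: ursubmx B).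
have BE : B = (block_mx 1%:M 0 (a^-1 *: dlsubmx B) 1%:M *m block_mx a%:M 0 0 D) *m
    block_mx 1%:M (a^-1 *: ursubmx B) 0 1%:M.
  rewrite !mulmx_block !(mulmx0, mul0mx, mulmx1, mul1mx, addr0, add0r).
  rewrite mul_scalar_mx scalerA divff// scale1r mul_mx_scalar scalerA divff// scale1r.
  by rewrite /D addrC subrK -ulE submxK.
have dD : \det D != 0.
  apply: contraNneq dB => D0; rewrite BE !det_mulmx det_lblock !det_ublock D0.
  by rewrite mulr0 mulr0 mul0r.
rewrite BE; apply: vol_img_mul; last exact: vol_img_shear.
apply: vol_img_mul; first exact: vol_img_lshear.
by apply: vol_img_diag => //; exact: IH.
Qed.

End Linear.

(** * Exact scaling of volume under affine bijections *)

Section Affine.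
Variable R : realType.

Lemma vol_translate_le n (c : 'rV[R]_n.+1) (X : set 'rV[R]_n.+1) :
  (vol ((fun x => x + c)%R @` X) <= vol X)%E.
Proof.
have H Y : (fun x => x + c)%R @` Y = \bigcup_(x in Y) [set x + c].
  by apply/seteqP; split => [y [x Yx <-]|y [x Yx ->]]; exists x.
rewrite H -[leRHS]mul1e; apply: vol_image_le => // a b; rewrite -H mul1e.
have -> : box_vol a b = box_vol (a + c) (b + c).
  rewrite /box_vol; congr EFin; apply: eq_bigr => j _.
  by rewrite !mxE opprD addrACA subrr addr0.
by apply: vol_le_box => y [x xab <-] j; have := xab j; rewrite !mxE !lerD2r.
Qed.

Lemma vol_affine_le n (A : 'M[R]_n.+1) (c : 'rV[R]_n.+1) (X : set 'rV[R]_n.+1) :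
  \det A != 0 -> (vol ((fun x => x *m A + c)%R @` X) <= `|\det A|%:E * vol X)%E.
Proof.
move=> dA; apply: le_trans (vol_img_unit dA X).
apply: le_trans (vol_translate_le c _); apply: vol_le => y [x Xx <-].
by exists (x *m A) => //; exists x.
Qed.

Lemma vol_affine n (A : 'M[R]_n.+1) (c : 'rV[R]_n.+1) (X : set 'rV[R]_n.+1) :
  \det A != 0 -> vol ((fun x => x *m A + c)%R @` X) = (`|\det A|%:E * vol X)%E.
Proof.
move=> dA; apply/eqP; rewrite eq_le vol_affine_le//=.
have uA : A \in unitmx by rewrite unitmxE unitfE.
have dA' : \det (invmx A) != 0 by rewrite det_inv invr_eq0.
have dA0 : 0 < `|\det A| by rewrite normr_gt0.
rewrite muleC -lee_pdivlMr//.
have := @vol_affine_le _ (invmx A) (- c *m invmx A)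
  ((fun x => x *m A + c)%R @` X) dA'.
rewrite det_inv normfV muleC; apply: le_trans.
apply: vol_le => x Xx; exists (x *m A + c); first by exists x.
by rewrite mulmxDl mulNmx addrK mulmxK.
Qed.

Lemma vol_scale n (a : R) (X : set 'rV[R]_n.+1) : 0 < a ->
  vol ((fun x => a *: x)%R @` X) = ((a ^+ n.+1)%:E * vol X)%E.
Proof.
move=> a0; have d1 : \det (a%:M : 'M[R]_n.+1) != 0.
  by rewrite det_scalar expf_neq0 ?gt_eqF.
have := vol_affine 0 X d1; rewrite det_scalar ger0_norm ?exprn_ge0 ?ltW// => <-.
by congr vol; apply: eq_imagel => x _; rewrite mul_mx_scalar addr0.
Qed.

Lemma orthogonal_det n (A : 'M[R]_n) : A *m A^T = 1%:M -> `|\det A| = 1.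
Proof.
move=> /(congr1 determinant); rewrite det_mulmx det_tr det1 -expr2 => h.
by apply/eqP; rewrite -(@eqrXn2 _ 2)// -normrX h expr1n normr1.
Qed.

Lemma vol_orthogonal n (A : 'M[R]_n.+1) (c : 'rV[R]_n.+1) (X : set 'rV[R]_n.+1) :
  A *m A^T = 1%:M -> vol ((fun x => x *m A + c)%R @` X) = vol X.
Proof.
move=> /orthogonal_det dA; rewrite vol_affine ?dA ?mul1e//.
by rewrite -normr_gt0 dA.
Qed.

Definition tall n (h : R) (x : 'rV[R]_n.+1) : 'rV[R]_n.+1 :=
  vcons (h * x 0 0) (vtl x).

Definition tallmx n (h : R) : 'M[R]_(1 + n) := block_mx h%:M 0 0 1%:M.

Lemma tallE n h (x : 'rV[R]_(1 + n)) : tall h x = x *m tallmx n h.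
Proof.
have -> : x *m tallmx n h =
    row_mx ((x 0 0)%:M : 'M[R]_1) (vtl x) *m block_mx h%:M 0 0 1%:M.
  by rewrite -vcons_row_mx vcons_vtl.
rewrite /tall vcons_row_mx mul_row_block.
by rewrite !mulmx0 addr0 add0r mulmx1 -scalar_mxM mulrC.
Qed.

Lemma det_tallmx n h : \det (tallmx n h) = h.
Proof. by rewrite det_ublock det1 mulr1 det_scalar1. Qed.

Lemma vol_tall n h (X : set 'rV[R]_n.+1) : 0 < h ->
  vol (tall h @` X) = (h%:E * vol X)%E.
Proof.
move=> h0; have dh : \det (tallmx n h) != 0 by rewrite det_tallmx gt_eqF.
have := vol_affine 0 X dh; rewrite det_tallmx gtr0_norm// => <-.
by congr vol; apply: eq_imagel => x _; rewrite tallE addr0.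
Qed.

End Affine.

(** * Limits of matrices along an ultrafilter *)

Section UltraLimits.
Variable R : realType.

Lemma ultra_fmap (T U : Type) (F : set_system T) (f : T -> U) :
  UltraFilter F -> UltraFilter (f @ F).
Proof.
move=> FU; split=> [|G GG sFG]; first exact: fmap_proper_filter.
apply/seteqP; split => // A GA.
have [//|FnA] := in_ultra_setVsetC (f @^-1` A) FU.
have GnA : G (~` A) by apply: sFG.
by have [x []] := filter_ex (filterI GA GnA).
Qed.

Lemma ultra_compact_cvg (T : Type) (U : topologicalType) (F : set_system T)
  (K : set U) (f : T -> U) : UltraFilter F -> compact K -> (forall t, K (f t)) ->
  exists2 l, K l & f @ F --> l.
Proof.
move=> FU; rewrite compact_ultra => cK fK.
have [l [Kl lP]] := cK _ (ultra_fmap f FU) (filterE _ fK).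
by exists l.
Qed.

(** Convergence entry by entry. A fixed ultrafilter finer than [\oo] makes all bounded sequences
    converge at once, in place of successive extractions of subsequences. *)
Definition mcvg p q (F : set_system nat) (u : nat -> 'M[R]_(p, q)) (l : 'M[R]_(p, q)) :=
  forall i j, u m i j @[m --> F] --> l i j.

Lemma ultra_bounded_mcvg p q (F : set_system nat) (u : nat -> 'M[R]_(p, q)) (K : R) :
  UltraFilter F -> (forall m i j, `|u m i j| <= K) ->
  exists l, mcvg F u l.
Proof.
move=> FU uK.
have H (ij : 'I_p * 'I_q) : exists l : R, u m ij.1 ij.2 @[m --> F] --> l.
  have uI m : (`[- K, K]%classic : set R) (u m ij.1 ij.2).
    by rewrite /= in_itv/= -ler_norml.
  have [l _ ul] := ultra_compact_cvg FU (@segment_compact R _ _) uI.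
  by exists l.
have [g gP] := choice H.
exists (\matrix_(i, j) g (i, j)) => i j; rewrite mxE; exact: (gP (i, j)).
Qed.

Section mcvg.
Variables (F : set_system nat) (FF : ProperFilter F).

Lemma mcvg_unique p q (u : nat -> 'M[R]_(p, q)) l l' :
  mcvg F u l -> mcvg F u l' -> l = l'.
Proof.
move=> ul ul'; apply/matrixP => i j.
exact: (cvg_unique (@Rhausdorff R) (ul i j) (ul' i j)).
Qed.

Lemma mcvg_cst p q (l : 'M[R]_(p, q)) : mcvg F (fun=> l) l.
Proof. by move=> i j; exact: cvg_cst. Qed.

Lemma mcvgD p q (u v : nat -> 'M[R]_(p, q)) k l :
  mcvg F u k -> mcvg F v l -> mcvg F (fun m => u m + v m) (k + l).
Proof.
move=> uk vl i j; rewrite mxE; under eq_fun do rewrite mxE.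
exact: cvgD.
Qed.

Lemma mcvgN p q (u : nat -> 'M[R]_(p, q)) k :
  mcvg F u k -> mcvg F (fun m => - u m) (- k).
Proof.
move=> uk i j; rewrite mxE; under eq_fun do rewrite mxE.
exact: cvgN.
Qed.

Lemma mcvgZ p q (a : R) (u : nat -> 'M[R]_(p, q)) k :
  mcvg F u k -> mcvg F (fun m => a *: u m) (a *: k).
Proof.
move=> uk i j; rewrite mxE; under eq_fun do rewrite mxE.
exact: cvgMr.
Qed.

Lemma mcvg_tr p q (u : nat -> 'M[R]_(p, q)) k :
  mcvg F u k -> mcvg F (fun m => (u m)^T) k^T.
Proof.
move=> uk i j; rewrite mxE; under eq_fun do rewrite mxE.
exact: uk.
Qed.

Lemma mcvgM p q r (u : nat -> 'M[R]_(p, q)) (v : nat -> 'M[R]_(q, r)) k l :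
  mcvg F u k -> mcvg F v l -> mcvg F (fun m => u m *m v m) (k *m l).
Proof.
move=> uk vl i j; rewrite mxE; under eq_fun do rewrite mxE.
apply: cvg_big => [x|s _]; first exact: add_continuous.
by apply: cvgM; [exact: uk|exact: vl].
Qed.

Lemma cvg_mcvg n (u : nat -> 'rV[R]_n) l : u @ F --> l -> mcvg F u l.
Proof.
move=> ul i j; apply: (@cvg_comp _ _ _ u (fun M : 'rV[R]_n => M i j) _ (nbhs l)) => //.
exact: coord_continuous.
Qed.

End mcvg.
End UltraLimits.

(** * Reflections of tall bodies *)

Section Reflections.
Variable R : realType.

Definition reflmx k n (U : 'M[R]_(k, n)) : 'M[R]_n := 2%:R *: (U^T *m U) - 1%:M.

Lemma refl_flatE k n (p : 'rV[R]_n) (U : 'M[R]_(k, n)) x :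
  refl_flat p U x = x *m reflmx U + (p - p *m reflmx U).
Proof.
rewrite /refl_flat /reflmx !mulmxBr !mulmx1 -!scalemxAr !mulmxBl.
by apply/rowP => j; rewrite !mxE; ring.
Qed.

Lemma reflmx_tr k n (U : 'M[R]_(k, n)) : (reflmx U)^T = reflmx U.
Proof. by rewrite /reflmx linearB linearZ/= trmx_mul trmxK trmx1. Qed.

Lemma reflmxK k n (U : 'M[R]_(k, n)) : orthonormal_frame U ->
  reflmx U *m reflmx U = 1%:M.
Proof.
move=> UU; have PP : (U^T *m U) *m (U^T *m U) = U^T *m U.
  by rewrite mulmxA -[U^T *m U *m U^T]mulmxA UU mulmx1.
rewrite /reflmx mulmxBl mulmxBr mul1mx mulmx1 -scalemxAl -scalemxAr PP.
by rewrite scalerA; apply/matrixP => i j; rewrite !mxE; ring.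
Qed.

Lemma reflmx_orthogonal k n (U : 'M[R]_(k, n)) : orthonormal_frame U ->
  reflmx U *m (reflmx U)^T = 1%:M.
Proof. by move=> UU; rewrite reflmx_tr reflmxK. Qed.

Lemma orthogonal_entry_le k n (A : 'M[R]_(k, n)) i j : A *m A^T = 1%:M -> `|A i j| <= 1.
Proof.
move=> /matrixP/(_ i i); rewrite !mxE eqxx (bigD1 j)//= mxE -expr2 => h.
rewrite -(@ler_pXn2r _ 2) ?nnegrE ?ler01 ?normr_ge0//.
rewrite expr1n -normrX ger0_norm ?sqr_ge0//.
have -> : 1 = (true%:R : R) by [].
by rewrite -h lerDl sumr_ge0// => l _; rewrite mxE -expr2 sqr_ge0.
Qed.

(** [Q] is the reflection in the hyperplane orthogonal to [v = u - e]; as [u] and [e] are both unit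
    vectors, [2 v.u = v.v], so it sends [u] to [e]. *)
Lemma householder k (u : 'cV[R]_k.+1) : u^T *m u = 1%:M ->
  exists Q : 'M[R]_k.+1, Q^T *m Q = 1%:M /\ Q *m u = delta_mx 0 0.
Proof.
move=> u1; set e : 'cV[R]_k.+1 := delta_mx 0 0.
have [->|ue] := eqVneq u e; first by exists 1%:M; rewrite trmx1 !mul1mx.
pose v := u - e.
have ee : e^T *m e = 1%:M :> 'M[R]_1.
  by rewrite /e trmx_delta mul_delta_mx; apply/matrixP => i j; rewrite !ord1 !mxE.
pose d : R := (v^T *m v) 0 0.
have vv : v^T *m v = d%:M by rewrite [LHS]mx11_scalar.
have vu2 : 2%:R *: (v^T *m u) = d%:M.
  have vT : v^T = u^T - e^T by rewrite /v linearB.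
  rewrite -vv {2}/v mulmxBr vT !mulmxBl u1 ee.
  have -> : u^T *m e = e^T *m u.
    by rewrite -[LHS]trmxK trmx_mul trmxK [LHS]mx11_scalar mxE -mx11_scalar.
  by move: (e^T *m u) => w; apply/matrixP => i j; rewrite !mxE; ring.
have d0 : d != 0.
  rewrite /d mxE psumr_eq0; last by move=> i _; rewrite mxE -expr2 sqr_ge0.
  apply: contra ue => /allP v0; rewrite -subr_eq0; apply/eqP/colP => i.
  have := v0 i (mem_index_enum i); rewrite mxE -expr2 sqrf_eq0 => /eqP.
  by move=> vi; rewrite -/v vi mxE.
have QT : (1%:M - (2%:R / d) *: (v *m v^T))^T = 1%:M - (2%:R / d) *: (v *m v^T).
  by rewrite linearB/= linearZ/= trmx1 trmx_mul trmxK.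
exists (1%:M - (2%:R / d) *: (v *m v^T)); split.
  rewrite QT mulmxBl mul1mx.
  rewrite -scalemxAl mulmxBr mulmx1 -scalemxAr.
  rewrite mulmxA -[v *m v^T *m v]mulmxA vv mul_mx_scalar -scalemxAl !scalerA.
  rewrite scalerBr scalerA.
  have -> : 2%:R / d * (2%:R / d * d) = 2%:R / d + 2%:R / d by field.
  move: (v *m v^T) => w; apply/matrixP => i j; rewrite !mxE; ring.
rewrite mulmxBl mul1mx -scalemxAl -mulmxA -scalerA.

have -> : v *m (v^T *m u) = (d / 2%:R) *: v.
  have -> : v^T *m u = (d / 2%:R)%:M.
    apply/(@scalerI _ _ (2%:R : R)); first by rewrite pnatr_eq0.
    by rewrite vu2 scale_scalar_mx; congr _%:M; field.
  by rewrite mul_mx_scalar.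
rewrite !scalerA.
have -> : 2%:R / d * (d / 2%:R) = 1 :> R by field.
by rewrite scale1r /v opprB addrC subrK.
Qed.

Lemma mul_block_vcons n (s : R) (v : 'rV[R]_n) (A : 'M[R]_n) (r x : 'rV[R]_(1 + n)) :
  x *m block_mx s%:M v 0 A + r =
  vcons (s * x 0 0 + r 0 0) (x 0 0 *: v + vtl x *m A + vtl r).
Proof.
have -> : x *m block_mx s%:M v 0 A =
    row_mx ((x 0 0)%:M : 'M[R]_1) (vtl x) *m block_mx s%:M v 0 A.
  by rewrite -vcons_row_mx vcons_vtl.
rewrite mul_row_block mulmx0 addr0 -scalar_mxM mul_scalar_mx.
rewrite -{1}(vcons_vtl r) !vcons_row_mx add_row_mx -raddfD/= mulrC.
by [].
Qed.

Lemma gram0 p q (u : 'M[R]_(p, q)) : u^T *m u = 0 -> u = 0.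
Proof.
move=> /matrixP uu; apply/matrixP => i j; have := uu j j; rewrite !mxE => /eqP.
rewrite psumr_eq0; last by move=> l _; rewrite mxE -expr2 sqr_ge0.
by move=> /allP/(_ i (mem_index_enum i)); rewrite mxE -expr2 sqrf_eq0 => /eqP.
Qed.

(** A unit first column means that the flat contains the first axis. Changing the frame by [Q]
    leaves the projector unchanged and makes that axis the first row; orthonormality kills the rest
    of this row, and the other [k] rows frame the trace of the flat on the sections. *)
Lemma frame_col_unit k n (u : 'cV[R]_k.+1) (V : 'M[R]_(k.+1, n)) :
  orthonormal_frame (row_mx u V) -> u^T *m u = 1%:M ->
  exists2 W : 'M[R]_(k, n), orthonormal_frame W & reflmx V = reflmx W.
Proof.
move=> UU uu; have [Q [QQ Qu]] := householder uu.
have QQ' : Q *m Q^T = 1%:M by apply: mulmx1C.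
pose W' : 'M[R]_(1 + k, n) := Q *m V.
have frW : Q *m row_mx u V = row_mx (Q *m u) W' by rewrite mul_mx_row.
have : (Q *m row_mx u V) *m (Q *m row_mx u V)^T = 1%:M.
  by rewrite trmx_mul mulmxA -(mulmxA Q) UU mulmx1.
rewrite frW tr_row_mx mul_row_col Qu trmx_delta mul_delta_mx => WW0.
have : (delta_mx 0 0 : 'M[R]_(1 + k)) + W' *m W'^T = 1%:M by exact: WW0.
rewrite -(vsubmxK W') tr_col_mx mul_col_row => WW.
have e00 : delta_mx 0 0 = block_mx 1%:M 0 0 0 :> 'M[R]_(1 + k).
  apply/matrixP => i j; rewrite -(splitK i) -(splitK j) /unsplit.
  case: (fintype.split i) => i'; case: (fintype.split j) => j';
    rewrite ?(block_mxEul, block_mxEur, block_mxEdl, block_mxEdr) !mxE -!val_eqE/= ?ord1 ?andbF//.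
move: WW; rewrite e00 add_block_mx !add0r scalar_mx_block => /eq_block_mx[w0 _ _ WW].
exists (dsubmx W') => //.
have {}w0 : usubmx W' = 0.
  rewrite -[LHS]trmxK (@gram0 _ _ (usubmx W')^T) ?trmx0// trmxK.
  by move: w0 => /(congr1 (fun z => z - 1%:M)); rewrite addrAC subrr add0r.
rewrite /reflmx; congr (_ *: _ - _).
have -> : V^T *m V = W'^T *m W' by rewrite /W' trmx_mul mulmxA -(mulmxA V^T) QQ mulmx1.
by rewrite -{1 2}(vsubmxK W') tr_col_mx mul_row_col w0 trmx0 mul0mx add0r.
Qed.

End Reflections.

(** * Bodies stretched to infinity along the first axis *)

Section ThinLimit.
Variables (R : realType) (n k : nat).
Variables (C : set 'rV[R]_n.+2) (B : R).
Hypothesis cC : compact C.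

(* The limits, as [h] tends to infinity, of the reflections conjugated by [tall h]. *)
Definition shearA (W : 'M[R]_(k, n.+1)) (a b : 'rV[R]_n.+1) (x : 'rV[R]_n.+2) :=
  vcons (x 0 0) (refl_flat (x 0 0 *: a + b) W (vtl x)).
Definition shearB (W : 'M[R]_(k.+1, n.+1)) (s : R) (v q : 'rV[R]_n.+1)
    (x : 'rV[R]_n.+2) :=
  vcons (s - x 0 0) (vtl x *m reflmx W + (x 0 0 *: v + q)).

Hypothesis HA : forall W a b, orthonormal_frame W ->
  (vol (C `&` shearA W a b @` C) <= B%:E)%E.
Hypothesis HB : forall W s v q, orthonormal_frame W ->
  (vol (C `&` shearB W s v q @` C) <= B%:E)%E.

(* Upper semicontinuity of [vol (C `&` phi C)] in the affine map [phi]. *)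
Lemma ultra_vol_limit (F : set_system nat) (M : nat -> 'M[R]_n.+2)
    (r : nat -> 'rV[R]_n.+2) M' r' (c : R) : UltraFilter F ->
  mcvg F M M' -> mcvg F r r' ->
  (forall m, (c%:E < vol (C `&` (fun x => x *m M m + r m)%R @` C))%E) ->
  (c%:E <= vol (C `&` (fun x => x *m M' + r')%R @` C))%E.
Proof.
move=> FU MM rr cM; rewrite leNgt; apply/negP => /vol_open_cover.
move=> [U [oU CU volU]].
have [x xP] : {x : nat -> 'rV[R]_n.+2 * 'rV[R]_n.+2 & forall m,
    [/\ C (x m).1, C (x m).2, (x m).1 = (x m).2 *m M m + r m & ~ U (x m).1]}.
  apply: (@choice _ _ (fun m x => [/\ C x.1, C x.2, x.1 = x.2 *m M m + r m & ~ U x.1])).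
  move=> m; apply: contrapT => /forallNP nx.
  have := cM m; rewrite ltNge => /negP; apply; apply: le_trans volU.
  apply: vol_le => x [Cx [y Cy yx]]; apply: contrapT => Ux.
  by apply: (nx (x, y)); split.
have PF : ProperFilter F by exact: ultra_proper.
have Cx m : C (x m).1 by have [] := xP m.
have Cy m : C (x m).2 by have [] := xP m.
have [x' Cx' xx'] := ultra_compact_cvg FU cC Cx.
have [y' Cy' yy'] := ultra_compact_cvg FU cC Cy.
have xE : x' = y' *m M' + r'.
  apply: (mcvg_unique PF (u := fun m => (x m).1)); first exact: cvg_mcvg.
  have -> : (fun m => (x m).1) = (fun m => (x m).2 *m M m + r m).
    by apply/funext => m; have [] := xP m.
  by apply: mcvgD => //; apply: mcvgM => //; exact: cvg_mcvg.
have Ux' : U x' by apply: CU; split => //; exists y'.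
have FUx : F (fun m => U (x m).1) := xx' _ (open_nbhs_nbhs (conj oU Ux')).
by have [m Um] := filter_ex FUx; have [_ _ _] := xP m.
Qed.

Lemma compact_coord_bounded m (K : set 'rV[R]_m) : compact K ->
  exists2 r : R, 0 < r & forall x j, K x -> `|x 0 j| <= r.
Proof.
move=> /compact_bounded[r [_ rP]]; pose s := Num.max r 0 + 1.
have rs : r < s by rewrite ltr_pwDr// le_max lexx.
exists s => [|x j Kx]; first by rewrite ltr_wpDl// le_max lexx orbT.
apply: le_trans (rP s rs x Kx); rewrite [leRHS]/Num.norm /= mx_normrE.
by apply/bigmax_geP; right => /=; exists (0, j).
Qed.

(** The reflection in [U] is block diagonal and squares to 1, so its corner [s] is 1 or -1. If
    [s = 1] the flat contains the first axis and a [k]-frame remains in the sections; if [s = -1] it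
    is orthogonal to that axis and all [k + 1] rows live in the sections. The shear part of [M]
    survives in both cases. *)
Lemma limit_map_le (U : 'M[R]_(k.+1, 1 + n.+1)) (M : 'M[R]_(1 + n.+1))
    (r : 'rV[R]_(1 + n.+1)) : orthonormal_frame U ->
  M *m M = 1%:M -> r *m M + r = 0 ->
  ulsubmx M = ulsubmx (reflmx U) -> drsubmx M = drsubmx (reflmx U) ->
  dlsubmx M = 0 -> ursubmx (reflmx U) = 0 ->
  (vol (C `&` (fun x => x *m M + r)%R @` C) <= B%:E)%E.
Proof.
move=> UU MM rM ulE drE dl0 ur0.
set S := reflmx U in ulE drE ur0.
pose s := S 0 0.
have ulS : ulsubmx S = s%:M.
  rewrite [LHS]mx11_scalar; congr (_%:M).
  rewrite /ulsubmx /lsubmx /usubmx mxE mxE /s; congr (S _ _); exact/val_inj.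
have dlS : dlsubmx S = 0.
  by rewrite -[dlsubmx S]trmxK trmx_dlsub reflmx_tr ur0 trmx0.
set A := drsubmx S in drE.
set v := ursubmx M.
have SE : S = block_mx s%:M 0 0 A by rewrite -ulS -ur0 -dlS submxK.
have ME : M = block_mx s%:M v 0 A by rewrite -ulS -ulE -dl0 -drE submxK.
pose u : 'cV[R]_k.+1 := lsubmx U; pose V : 'M[R]_(k.+1, n.+1) := rsubmx U.
have UE : U = row_mx u V by rewrite hsubmxK.
have /eq_block_mx[uu _ _ AV] : block_mx s%:M 0 0 A =
    block_mx (2%:R *: (u^T *m u) - 1%:M) (2%:R *: (u^T *m V))
      (2%:R *: (V^T *m u)) (reflmx V).
  rewrite -SE /S /reflmx UE tr_row_mx mul_col_row scale_block_mx.
  by rewrite scalar_mx_block opp_block_mx add_block_mx !oppr0 !addr0.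
have ss : s * s = 1.
  have := reflmxK UU; rewrite -/S SE mulmx_block !mul0mx !mulmx0 !addr0 add0r.
  rewrite scalar_mx_block => /eq_block_mx[/matrixP/(_ 0 0) + _ _ _].
  by rewrite -scalar_mxM !mxE.
have mapE x : x *m M + r = vcons (s * x 0 0 + r 0 0) (x 0 0 *: v + vtl x *m A + vtl r).
  by rewrite ME mul_block_vcons.
have : (s - 1) * (s + 1) = 0 by rewrite mulrDr mulrBl mulrBl ss; ring.
move=> /eqP; rewrite mulf_eq0 subr_eq0 addr_eq0 => /orP[|] /eqP s1; last first.
  have u0 : u = 0.
    apply: gram0; apply/(@scalerI _ _ (2%:R : R)); first by rewrite pnatr_eq0.
    by move: uu; rewrite s1 scaler0 => /eqP; rewrite eq_sym subr_eq => /eqP ->;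
      rewrite raddfN/= addNr.
  have VV : orthonormal_frame V.
    by move: UU; rewrite /orthonormal_frame UE u0 tr_row_mx mul_row_col mul0mx add0r.
  apply: le_trans (HB (r 0 0) v (vtl r) VV).
  apply: vol_le => x [Cx [y Cy yx]]; split => //; exists y => //.
  rewrite -yx mapE /shearB -AV s1 mulN1r [- _ + _]addrC; congr vcons.
  by rewrite addrA [vtl y *m A + _]addrC.
have u1 : u^T *m u = 1%:M.
  apply/(@scalerI _ _ (2%:R : R)); first by rewrite pnatr_eq0.
  move: uu; rewrite s1 => /eqP; rewrite eq_sym subr_eq => /eqP ->.
  by rewrite scaler_nat mulr2n.
have [W WW VW] := frame_col_unit (eq_ind _ (fun z => orthonormal_frame z) UU _ UE) u1.
have vA : v *m A = - v.
  move: MM; rewrite {1 2}ME mulmx_block scalar_mx_block => /eq_block_mx[_ + _ _].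
  by rewrite s1 mul1mx => /eqP; rewrite addr_eq0 => /eqP h; rewrite [in RHS]h opprK.
have r0 : vcons (r 0 0 + r 0 0) (r 0 0 *: v + vtl r *m A + vtl r) = 0.
  by rewrite -[RHS]rM [in RHS]ME mul_block_vcons s1 mul1r.
have r00 : r 0 0 = 0.
  have := congr1 (fun z : 'rV[R]_n.+2 => z 0 0) r0; rewrite vcons0 mxE => /eqP.
  by rewrite -mulr2n mulrn_eq0/= => /eqP.
have rA : vtl r *m A = - vtl r.
  have := congr1 (@vtl _ _) r0; rewrite vconsK r00 scale0r add0r => /eqP.
  have -> : vtl (0 : 'rV[R]_n.+2) = 0 by apply/rowP => j; rewrite !mxE.
  by rewrite addr_eq0 => /eqP.
(* As [A] reverses both [v] and [vtl r], adding a multiple of them after [A] amounts to moving the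
   centre of the reflection by half as much. *)
apply: le_trans (HA (2%:R^-1 *: v) (2%:R^-1 *: vtl r) WW).
apply: vol_le => x [Cx [y Cy yx]]; split => //; exists y => //.
rewrite -yx mapE /shearA refl_flatE -VW -AV mulmxDl -!scalemxAl vA rA.
rewrite s1 mul1r r00 addr0; congr vcons; apply/rowP => j; rewrite !mxE.
by field.
Qed.

Lemma tallmxK h : h != 0 -> tallmx n.+1 h *m tallmx n.+1 h^-1 = 1%:M :> 'M[R]_(1 + n.+1).
Proof.
move=> h0; rewrite /tallmx mulmx_block !(mulmx0, mul0mx, addr0, add0r) mulmx1.
by rewrite -scalar_mxM divff// -scalar_mx_block.
Qed.

Lemma ultra_small (F : set_system nat) (u : nat -> R) (L : R) : UltraFilter F ->
  \oo `<=` F -> (forall m, `|u m| <= L / m.+1%:R) -> u m @[m --> F] --> (0 : R).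
Proof.
move=> FU ooF uL.
have : u m @[m --> \oo] --> (0 : R).
  apply/cvgr0Pnorm_lt => e e0; exists (Num.truncn (L / e)).+1 => // m /= Lm.
  apply: le_lt_trans (uL m) _; rewrite ltr_pdivrMr// mulrC -ltr_pdivrMr//.
  apply: lt_le_trans (truncnS_gt _) _; rewrite ler_nat.
  by apply: leq_trans Lm _.
by move=> h A /h /ooF.
Qed.

(** Otherwise every [h = m + 1] admits a flat that violates the bound. Its reflection, conjugated by
    [tall h], is [x |-> x *m M m + r m]; once these maps are bounded, an ultralimit contradicts
    [limit_map_le] through the semicontinuity of the overlap volume. *)
Theorem thin_limit (e : R) : 0 <= B -> 0 < e ->
  exists2 h : R, 0 < h & forall (p : 'rV[R]_n.+2) (U : 'M[R]_(k.+1, n.+2)),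
    orthonormal_frame U ->
    (vol (tall h @` C `&` refl_flat p U @` (tall h @` C)) <= (h * (B + e))%:E)%E.
Proof.
move=> B0 e0; apply: contrapT => /forall2NP nh.
have [pU pUP] : {pU : nat -> 'rV[R]_n.+2 * 'M[R]_(k.+1, n.+2) & forall m,
    orthonormal_frame (pU m).2 /\
    ((m.+1%:R * (B + e))%:E < vol (tall m.+1%:R @` C `&`
      refl_flat (pU m).1 (pU m).2 @` (tall m.+1%:R @` C)))%E}.
  apply: (@choice _ _ (fun m pU => orthonormal_frame pU.2 /\
    ((m.+1%:R * (B + e))%:E < vol (tall m.+1%:R @` C `&`
      refl_flat pU.1 pU.2 @` (tall m.+1%:R @` C)))%E)) => m.
  have [/negP|/existsNP[p /existsNP[U /not_implyP[UU /negP]]]] := nh m.+1%:R.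
    by rewrite ltr0n.
  by rewrite -ltNge => hU; exists (p, U).
pose h m : R := m.+1%:R.
have h0 m : 0 < h m by rewrite ltr0n.
have h0' m : h m != 0 by rewrite gt_eqF.
pose U m : 'M[R]_(k.+1, 1 + n.+1) := (pU m).2.
have UU m : orthonormal_frame (U m) by have [] := pUP m.
pose S m : 'M[R]_(1 + n.+1) := reflmx (U m).
have SS m : S m *m S m = 1%:M by apply: reflmxK.
have S1 m i j : `|S m i j| <= 1.
  by apply: orthogonal_entry_le; exact: reflmx_orthogonal.
pose q m : 'rV[R]_(1 + n.+1) := (pU m).1 - (pU m).1 *m S m.
have qS m : q m *m S m = - q m.
  by rewrite /q mulmxBl -mulmxA SS mulmx1 opprB.
pose T m := tallmx (R := R) n.+1 (h m).
pose T' m := tallmx (R := R) n.+1 (h m)^-1.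
have TT' m : T m *m T' m = 1%:M by exact: tallmxK.
have T'T m : T' m *m T m = 1%:M by exact: mulmx1C.
pose M m := T m *m S m *m T' m.
pose r m := q m *m T' m.
have ME m : M m = block_mx (ulsubmx (S m)) (h m *: ursubmx (S m))
    ((h m)^-1 *: dlsubmx (S m)) (drsubmx (S m)).
  rewrite /M -{1}(submxK (S m)) /T /T' /tallmx !mulmx_block.
  rewrite !(mulmx0, mul0mx, addr0, add0r, mulmx1, mul1mx) mul_mx_scalar.
  by rewrite !mul_scalar_mx mul_mx_scalar scalerA mulVf// scale1r.
have MM m : M m *m M m = 1%:M.
  rewrite /M !mulmxA -(mulmxA (_ *m S m)) T'T mulmx1.
  by rewrite -(mulmxA (T m)) SS mulmx1 TT'.
have rM m : r m *m M m + r m = 0.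
  rewrite /r /M !mulmxA -(mulmxA (q m)) T'T mulmx1 qS mulNmx; exact: addNr.
(* The conjugated map is still an involution, so a point of the overlap lies in [C] together with
   its image. *)
have inv m x : (x *m M m + r m) *m M m + r m = x.
  by rewrite mulmxDl -mulmxA MM mulmx1 -addrA rM addr0.
have volM m : ((B + e)%:E < vol (C `&` (fun x => x *m M m + r m)%R @` C))%E.
  have [_ hlt] := pUP m.
  suff : ((h m * (B + e))%:E < (h m)%:E *
      vol (C `&` (fun x => x *m M m + r m)%R @` C))%E.
    by rewrite EFinM lte_pmul2l// lte_fin.
  rewrite -vol_tall//; apply: lt_le_trans hlt _; apply: vol_le.
  move=> _ [[x Cx <-] [_ [z Cz <-] zx]]; exists x => //; split => //; exists z => //.
  have := congr1 (fun y => y *m T' m) zx.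
  rewrite refl_flatE !tallE -/(S m) -/(T m) -[in RHS]mulmxA TT' mulmx1 => <-.
  by rewrite mulmxDl /M !mulmxA.
have [D D0 CD] := compact_coord_bounded cC.
have ulE (A : 'M[R]_(1 + n.+1)) i j :
    ulsubmx A i j = A (lshift n.+1 i) (lshift n.+1 j) by rewrite !mxE.
have urE (A : 'M[R]_(1 + n.+1)) i j :
    ursubmx A i j = A (lshift n.+1 i) (rshift 1 j) by rewrite !mxE.
have dlE (A : 'M[R]_(1 + n.+1)) i j :
    dlsubmx A i j = A (rshift 1 i) (lshift n.+1 j) by rewrite !mxE.
have drE (A : 'M[R]_(1 + n.+1)) i j :
    drsubmx A i j = A (rshift 1 i) (rshift 1 j) by rewrite !mxE.
have MlS m i j : M m (lshift n.+1 i) (lshift n.+1 j) = S m (lshift n.+1 i) (lshift n.+1 j).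
  by rewrite ME block_mxEul ulE.
have MrS m i j : M m (rshift 1 i) (rshift 1 j) = S m (rshift 1 i) (rshift 1 j).
  by rewrite ME block_mxEdr drE.
have MdlS m i j : M m (rshift 1 i) (lshift n.+1 j) =
    (h m)^-1 * S m (rshift 1 i) (lshift n.+1 j).
  by rewrite ME block_mxEdl [LHS]mxE dlE.
have MurS m i j : M m (lshift n.+1 i) (rshift 1 j) =
    h m * S m (lshift n.+1 i) (rshift 1 j).
  by rewrite ME block_mxEur [LHS]mxE urE.
pose w : R := n.+2%:R * D.
have w0 : 0 < w by rewrite mulr_gt0.
pose L : R := Num.max 1 (w *+ 2 * (D *+ 2) ^+ n.+1 / (B + e)).
have L1 : 1 <= L by rewrite le_max lexx.
(* This is the block multiplied by [h]. For [x] in the overlap, coordinate [j] of the image is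
   bounded by [D], which confines [x 0 0] to an interval of length [2 w / |mu|]. The overlap then
   has volume at most [(2 w / |mu|) (2 D)^(n+1)], while it exceeds [B + e]; solving for [|mu|] gives
   [L]. *)
have ML0 m j : `|M m (lshift n.+1 0) (rshift 1 j)| <= L.
  set mu := M m _ _; have [->|mu0] := eqVneq mu 0; first by rewrite normr0 (le_trans ler01).
  have nmu : 0 < `|mu| by rewrite normr_gt0.
  rewrite le_max; apply/orP; right.
  rewrite ler_pdivlMr; last by rewrite ltr_wpDl.
  pose c := - r m 0 (rshift 1 j) / mu.
  pose a : 'rV[R]_n.+2 := vcons (c - w / `|mu|) (const_mx (- D)).
  pose b : 'rV[R]_n.+2 := vcons (c + w / `|mu|) (const_mx D).
  have sub : C `&` (fun x => x *m M m + r m) @` C `<=` box a b.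
    move=> x [Cx [y Cy yx]].
    have xy : x *m M m + r m = y by rewrite -yx; exact: inv.
    apply/boxE; rewrite !vcons0 !vconsK; split; last first.
      by move=> i; rewrite !mxE; have := CD x (lift ord0 i) Cx; rewrite ler_norml.
    have l0 : lshift n.+1 (0 : 'I_1) = ord0 by apply/val_inj.
    pose Sig := \sum_(i < n.+1) x 0 (rshift 1 i) * M m (rshift 1 i) (rshift 1 j).
    have yE : x 0 0 * mu + Sig + r m 0 (rshift 1 j) = y 0 (rshift 1 j).
      rewrite -xy [RHS]mxE; congr (_ + _).
      by rewrite [RHS]mxE (@big_split_ord _ _ _ 1 n.+1) big_ord1 /mu /= l0.
    have Sigle : `|Sig| <= n.+1%:R * D.
      apply: le_trans (ler_norm_sum _ _ _) _.
      rewrite mulrC mulr_natr -[X in _ *+ X]card_ord -sumr_const.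
      apply: ler_sum => i _; rewrite normrM -[leRHS]mulr1 ler_pM//; first exact: CD.
      by rewrite MrS.
    have yle := CD y (rshift 1 j) Cy.
    have : `|(x 0 0 - c) * mu| <= w.
      have -> : (x 0 0 - c) * mu = y 0 (rshift 1 j) - Sig.
        by rewrite -yE /c; field.
      rewrite (le_trans (ler_normB _ _))// /w -natr1 mulrDl mul1r addrC lerD//.
    rewrite normrM -ler_pdivlMr// ler_norml => /andP[h1 h2].
    by apply/andP; split; lra.
  have := vol_le_box sub.
  move=> /(lt_le_trans (volM m)); rewrite box_volE !vcons0 !vconsK.
  have -> : c + w / `|mu| - (c - w / `|mu|) = w *+ 2 / `|mu|.
    by rewrite mulrnAl; move: (w / _) => z; rewrite mulr2n; ring.
  have wmu : 0 <= w *+ 2 / `|mu| by rewrite divr_ge0 ?mulrn_wge0 ?(ltW w0).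
  have -> : box_vol (const_mx (- D)) (const_mx D : 'rV[R]_n.+1) = ((D *+ 2) ^+ n.+1)%:E.
    rewrite /box_vol -[in RHS](card_ord n.+1) -prodr_const; congr EFin.
    by apply: eq_bigr => i _; rewrite !mxE opprK -mulr2n max_l// mulrn_wge0 ?(ltW D0).
  rewrite max_l// -EFinM lte_fin => /ltW.
  rewrite mulrAC ler_pdivlMr// mulrC; exact.
have ML m i j : `|M m i j| <= L.
  rewrite -(splitK i) -(splitK j) /unsplit.
  case: (fintype.split i) => i'; case: (fintype.split j) => j'.
  - by rewrite MlS (le_trans (S1 _ _ _)).
  - by rewrite ord1; exact: ML0.
  - rewrite MdlS normrM normfV (le_trans _ L1)//.
    rewrite (ger0_norm (ltW (h0 m))) mulrC ler_pdivrMr// mul1r.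
    by rewrite (le_trans (S1 _ _ _))// ler1n.
  - by rewrite MrS (le_trans (S1 _ _ _)).
(* The overlap has positive volume, so some [y] in [C] has its image in [C], and this bounds the
   translation part. *)
have rL m (i : 'I_1) j : `|r m i j| <= D + n.+2%:R * (D * L).
  have [x [Cx [y Cy yx]]] : (C `&` (fun x => x *m M m + r m) @` C) !=set0.
    apply/set0P/eqP => E0; have := volM m.
    by rewrite E0 vol_set0 lte_fin ltNge addr_ge0// ltW.
  have -> : r m i j = x 0 j - (y *m M m) 0 j.
    by rewrite -yx ord1 [X in _ = X - _]mxE addrAC subrr add0r.
  rewrite (le_trans (ler_normB _ _))// lerD//; first exact: CD.
  rewrite [X in `|X|]mxE (le_trans (ler_norm_sum _ _ _))//.
  rewrite mulrC mulr_natr -[X in _ *+ X]card_ord -sumr_const.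
  by apply: ler_sum => l _; rewrite normrM ler_pM ?normr_ge0 ?CD ?ML.
have [F [FU ooF]] := ultraFilterLemma eventually_filter.
have PF : ProperFilter F by exact: ultra_proper.
have U1 m i j : `|U m i j| <= 1 by apply: orthogonal_entry_le; exact: UU.
have [U' UU'] := ultra_bounded_mcvg FU U1.
have [M' MM'] := ultra_bounded_mcvg FU ML.
have [r' rr'] := ultra_bounded_mcvg FU rL.
have SS' : mcvg F S (reflmx U').
  apply: mcvgD; last by apply: mcvgN; exact: mcvg_cst.
  by apply: mcvgZ; apply: mcvgM => //; exact: mcvg_tr.
have sub_cvg (u : nat -> R) (a b : R) : u m @[m --> F] --> a -> u m @[m --> F] --> b -> a = b.
  by move=> ua ub; exact: (cvg_unique (@Rhausdorff R) ua ub).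
suff : ((B + e)%:E <= B%:E)%E by rewrite lee_fin leNgt ltrDl e0.
apply: le_trans (ultra_vol_limit FU MM' rr' volM) _.
apply: (@limit_map_le U').
- apply: (mcvg_unique PF (u := fun m => U m *m (U m)^T)).
    by apply: mcvgM => //; exact: mcvg_tr.
  have -> : (fun m => U m *m (U m)^T) = fun=> 1%:M by apply/funext => m; exact: UU.
  exact: mcvg_cst.
- apply: (mcvg_unique PF (u := fun m => M m *m M m)).
    exact: mcvgM.
  have -> : (fun m => M m *m M m) = fun=> 1%:M by apply/funext => m; exact: MM.
  exact: mcvg_cst.
- apply: (mcvg_unique PF (u := fun m => r m *m M m + r m)).
    by apply: mcvgD => //; exact: mcvgM.
  have -> : (fun m => r m *m M m + r m) = fun=> 0 by apply/funext => m; exact: rM.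
  exact: mcvg_cst.
- apply/matrixP => i j; rewrite !ulE.
  apply: (sub_cvg (fun m => M m (lshift n.+1 i) (lshift n.+1 j))); first exact: MM'.
  have -> : (fun m => M m (lshift n.+1 i) (lshift n.+1 j)) =
      (fun m => S m (lshift n.+1 i) (lshift n.+1 j)) by apply/funext => m; exact: MlS.
  exact: SS'.
- apply/matrixP => i j; rewrite !drE.
  apply: (sub_cvg (fun m => M m (rshift 1 i) (rshift 1 j))); first exact: MM'.
  have -> : (fun m => M m (rshift 1 i) (rshift 1 j)) =
      (fun m => S m (rshift 1 i) (rshift 1 j)) by apply/funext => m; exact: MrS.
  exact: SS'.
- apply/matrixP => i j; rewrite dlE [RHS]mxE.
  apply: (sub_cvg (fun m => M m (rshift 1 i) (lshift n.+1 j))); first exact: MM'.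
  apply: (@ultra_small F _ 1 FU ooF) => m.
  rewrite MdlS normrM normfV mulrC (ger0_norm (ltW (h0 m))).
  by rewrite ler_pM2r ?invr_gt0//; exact: S1.
(* The corresponding block of [M m] is [h m] times this one and is bounded by [L], so this one tends
   to 0. *)
- apply/matrixP => i j; rewrite urE [RHS]mxE.
  apply: (sub_cvg (fun m => S m (lshift n.+1 i) (rshift 1 j))); first exact: SS'.
  apply: (@ultra_small F _ L FU ooF) => m.
  rewrite ler_pdivlMr// mulrC -[X in X * _](ger0_norm (ltW (h0 m))) -normrM.
  by have := ML m (lshift n.+1 i) (rshift 1 j); rewrite MurS.
Qed.

End ThinLimit.

(** * From overlap bounds to bounds on [sigma] *)

Section ConvexBodies.
Variable R : realType.

Lemma row_continuous (T : topologicalType) n (f : T -> 'rV[R]_n) :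
  (forall j, continuous (fun t => f t 0 j)) -> continuous f.
Proof.
move=> fj x A /nbhs_ballP[e /= e0 eA].
suff : nbhs x [set y | A (f y)] by [].
have H : nbhs x [set y | forall j, ball (f x 0 j) e (f y 0 j)].
  apply: (@filter_forall _ _ (fun j => [set y | ball (f x 0 j) e (f y 0 j)])
    (nbhs x) (nbhs_filter x)) => j.
  by apply: (fj j x); exact: nbhsx_ballx.
apply: filterS H => y fxy; apply: eA; split => // i j.
by rewrite ord1; exact: fxy.
Qed.

Lemma affine_continuous n (A : 'M[R]_n.+1) (c : 'rV[R]_n.+1) :
  continuous (fun x : 'rV[R]_n.+1 => x *m A + c).
Proof.
apply: row_continuous => j x.
have -> : (fun x : 'rV[R]_n.+1 => (x *m A + c) 0 j) =
    (fun x : 'rV[R]_n.+1 => (x *m A) 0 j) \+ cst (c 0 j).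
  by apply/funext => y; rewrite /= mxE.
apply: continuousD; last exact: cst_continuous.
apply: (@cvg_comp _ _ _ (fun x : 'rV[R]_n.+1 => x *m A) (fun M : 'rV[R]_n.+1 => M 0 j) _
  (nbhs (x *m A))); first exact: mulmxr_continuous.
exact: coord_continuous.
Qed.

Lemma compact_image n m (f : 'rV[R]_n -> 'rV[R]_m) (K : set 'rV[R]_n) :
  continuous f -> compact K -> compact (f @` K).
Proof.
move=> cf cK; apply: (@continuous_compact _ _ f) => //.
exact: continuous_subspaceT.
Qed.

Lemma compactI n (A B : set 'rV[R]_n) : compact A -> compact B -> compact (A `&` B).
Proof.
move=> cA cB; apply: compact_closedI => //.
by apply: compact_closed => //; exact: norm_hausdorff.
Qed.

Lemma convex_body_affine n (A : 'M[R]_n.+1) (c : 'rV[R]_n.+1) (K : set 'rV[R]_n.+1) :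
  \det A != 0 -> convex_body K -> convex_body ((fun x => x *m A + c) @` K).
Proof.
move=> dA [cK [cvK [p Kp]]]; split.
  by apply: compact_image => //; exact: affine_continuous.
split.
  move=> _ _ [x Kx <-] [y Ky <-] t t01; exists (t *: x + (1 - t) *: y).
    exact: cvK.
  rewrite mulmxDl -!scalemxAl !scalerDr addrACA -scalerDl subrKC scale1r.
  by [].
have uA : A \in unitmx by rewrite unitmxE unitfE.
exists (p *m A + c).
have : nbhs (p *m A + c) [set y | K (y *m invmx A + - c *m invmx A)].
  have := (@affine_continuous n (invmx A) (- c *m invmx A) (p *m A + c)) K.
  by rewrite mulNmx mulmxDl addrK mulmxK//; exact.
apply: filterS => y Ky; exists (y *m invmx A + - c *m invmx A) => //.
by rewrite mulNmx -mulmxBl mulmxKV// subrK.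
Qed.

Lemma convex_body_tall n h (K : set 'rV[R]_n.+1) : 0 < h ->
  convex_body K -> convex_body (tall h @` K).
Proof.
move=> h0 cK; have -> : tall h @` K = (fun x => x *m tallmx n h + 0) @` K.
  by apply: eq_imagel => x _; rewrite tallE addr0.
by apply: convex_body_affine => //; rewrite det_tallmx gt_eqF.
Qed.

Lemma vol_compact_lty n (K : set 'rV[R]_n.+1) : compact K -> (vol K < +oo)%E.
Proof.
move=> /compact_coord_bounded[r r0 rK].
apply: le_lt_trans (@vol_le_box _ _ (const_mx (- r)) (const_mx r) _ _) (ltry _).
by move=> x Kx j; rewrite !mxE -ler_norml; exact: rK.
Qed.

Lemma vol_convex_body_gt0 n (K : set 'rV[R]_n.+1) : convex_body K -> (0 < vol K)%E.
Proof.
move=> [_ [_ [p /nbhs_ballP[e /= e0 eK]]]].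
have e2 : 0 < e / 2 by rewrite divr_gt0.
pose a : 'rV[R]_n.+1 := p - const_mx (e / 2).
pose b : 'rV[R]_n.+1 := p + const_mx (e / 2).
apply: (@lt_le_trans _ _ (vol (box a b))).
  rewrite vol_box => [|j]; last by rewrite !mxE; lra.
  rewrite lte_fin; apply: prodr_gt0 => j _; rewrite !mxE lt_max; apply/orP; left.
  by lra.
apply: vol_le => x xp; apply: eK; split => // i j; rewrite ord1 /ball/=.
have := xp j; rewrite !mxE => /andP[h1 h2].
by rewrite ltr_norml; apply/andP; split; lra.
Qed.

Lemma Sym_le n k (K : set 'rV[R]_n.+1) (c : R) : convex_body K -> 0 <= c ->
  (forall p (U : 'M[R]_(k, n.+1)), orthonormal_frame U ->
    (vol (K `&` refl_flat p U @` K) <= c%:E * vol K)%E) ->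
  (Defs.Sym k K <= c%:E)%E.
Proof.
move=> cK c0 Kc; apply: ge_ereal_sup => _ [p [U [UU ->]]].
have v0 := vol_convex_body_gt0 cK.
have vf : vol K \is a fin_num.
  by rewrite ge0_fin_numE ?vol_compact_lty ?vol_ge0//; case: cK.
have v1 : 0 < fine (vol K) by rewrite fine_gt0// v0 ltey_eq vf.
rewrite -(fineK vf) inver gt_eqF// lee_pdivrMr// fineK//.
exact: Kc.
Qed.

Lemma Sym_vol n k (K : set 'rV[R]_n.+1) (c : R) : convex_body K ->
  (Defs.Sym k K <= c%:E)%E -> forall p (U : 'M[R]_(k, n.+1)), orthonormal_frame U ->
    (vol (K `&` refl_flat p U @` K) <= c%:E * vol K)%E.
Proof.
move=> cK Kc p U UU.
have v0 := vol_convex_body_gt0 cK.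
have vf : vol K \is a fin_num.
  by rewrite ge0_fin_numE ?vol_compact_lty ?vol_ge0//; case: cK.
have v1 : 0 < fine (vol K) by rewrite fine_gt0// v0 ltey_eq vf.
have : (vol (K `&` refl_flat p U @` K) * (vol K)^-1 <= c%:E)%E.
  by apply: le_trans Kc; apply: ereal_sup_ubound; exists p, U.
by rewrite -(fineK vf) inver gt_eqF// lee_pdivrMr.
Qed.

(** The competitor is [C] stretched by the [h] of [thin_limit], taken with slack [e * v] so that
    dividing by the volume, at least [h * v], costs only [e]. *)
Theorem sigma_thin n k (C : set 'rV[R]_n.+2) (B v : R) : convex_body C ->
  0 <= B -> 0 < v -> (v%:E <= vol C)%E ->
  (forall (W : 'M[R]_(k, n.+1)) a b, orthonormal_frame W ->
    (vol (C `&` shearA W a b @` C) <= B%:E)%E) ->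
  (forall (W : 'M[R]_(k.+1, n.+1)) s u q, orthonormal_frame W ->
    (vol (C `&` shearB W s u q @` C) <= B%:E)%E) ->
  (sigma R n.+2 k.+1 <= (B / v)%:E)%E.
Proof.
move=> bC B0 v0 vC HA HB; apply/lee_addgt0Pr => e e0; rewrite -EFinD.
have ev0 : 0 < e * v by rewrite mulr_gt0.
have [h h0 hP] := thin_limit bC.1 HA HB B0 ev0.
have bT := convex_body_tall h0 bC.
apply: le_trans (ereal_inf_lbound _ : (_ <= Defs.Sym k.+1 (tall h @` C))%E) _.
  by exists (tall h @` C).
apply: Sym_le => //; first by rewrite addr_ge0 ?divr_ge0 ?(ltW e0) ?(ltW v0).
move=> p U UU; apply: le_trans (hP p U UU) _; rewrite vol_tall//.
apply: (@le_trans _ _ ((B / v + e)%:E * (h%:E * v%:E))%E).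
  rewrite -!EFinM lee_fin le_eqVlt; apply/orP; left; apply/eqP.
  by field; rewrite gt_eqF.
apply: lee_wpmul2l.
  by rewrite lee_fin addr_ge0 ?divr_ge0 ?(ltW e0) ?(ltW v0).
by apply: lee_wpmul2l => //; rewrite lee_fin ltW.
Qed.

Lemma shearA_affine n k (W : 'M[R]_(k, n.+1)) a b : exists M r,
  shearA W a b = (fun x => x *m M + r).
Proof.
exists (block_mx 1%:M (a - a *m reflmx W) 0 (reflmx W)).
exists (vcons 0 (b - b *m reflmx W) : 'rV[R]_(1 + n.+1)).
apply/funext => x; rewrite (@mul_block_vcons _ n.+1) vcons0 vconsK mul1r addr0 /shearA.
rewrite refl_flatE; congr vcons; rewrite mulmxDl -scalemxAl scalerBr.
by apply/rowP => j; rewrite !mxE; ring.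
Qed.

Lemma shearB_affine n k (W : 'M[R]_(k.+1, n.+1)) s v q : exists M r,
  shearB W s v q = (fun x => x *m M + r).
Proof.
exists (block_mx (-1)%:M v 0 (reflmx W)), (vcons s q : 'rV[R]_(1 + n.+1)).
apply/funext => x; rewrite (@mul_block_vcons _ n.+1) vcons0 vconsK mulN1r /shearB.
by congr vcons; [rewrite addrC|rewrite addrA [_ *: v + _]addrC].
Qed.

Lemma compact_cap_shearA n k (W : 'M[R]_(k, n.+1)) a b (C : set 'rV[R]_n.+2) :
  compact C -> compact (C `&` shearA W a b @` C).
Proof.
move=> cC; apply: compactI => //; apply: compact_image => //.
by have [M [r ->]] := shearA_affine W a b; exact: affine_continuous.
Qed.

Lemma compact_cap_shearB n k (W : 'M[R]_(k.+1, n.+1)) s v q (C : set 'rV[R]_n.+2) :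
  compact C -> compact (C `&` shearB W s v q @` C).
Proof.
move=> cC; apply: compactI => //; apply: compact_image => //.
by have [M [r ->]] := shearB_affine W s v q; exact: affine_continuous.
Qed.

Lemma sect_shearA n k (W : 'M[R]_(k, n.+1)) a b (C : set 'rV[R]_n.+2) t :
  sect (C `&` shearA W a b @` C) t `<=`
    sect C t `&` refl_flat (t *: a + b) W @` sect C t.
Proof.
move=> y [Cy [z Cz zy]]; split => //; exists (vtl z).
  have zt : z 0 0 = t by have := congr1 (fun x : 'rV[R]_n.+2 => x 0 0) zy; rewrite !vcons0.
  by rewrite /sect/= -zt vcons_vtl.
have zt : z 0 0 = t by have := congr1 (fun x : 'rV[R]_n.+2 => x 0 0) zy; rewrite !vcons0.
by have := congr1 (@vtl _ _) zy; rewrite !vconsK zt.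
Qed.

Lemma vol_sect_shearB n k (W : 'M[R]_(k.+1, n.+1)) s v q (C : set 'rV[R]_n.+2) t :
  orthonormal_frame W ->
  (vol (sect (C `&` shearB W s v q @` C) t) <= vol (sect C t))%E /\
  (vol (sect (C `&` shearB W s v q @` C) t) <= vol (sect C (s - t)))%E.
Proof.
move=> WW; split; first by apply: vol_le => y [].
rewrite -[leRHS](vol_orthogonal ((s - t) *: v + q) _ (reflmx_orthogonal WW)).
apply: vol_le => y [Cy [z Cz zy]].
have zt : z 0 0 = s - t.
  have := congr1 (fun x : 'rV[R]_n.+2 => x 0 0) zy; rewrite /= !vcons0 => <-.
  by rewrite subKr.
exists (vtl z); first by rewrite /sect/= -zt vcons_vtl.
by have := congr1 (@vtl _ _) zy; rewrite !vconsK zt.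
Qed.

Lemma shearB_range n k (W : 'M[R]_(k.+1, n.+1)) s v q (C : set 'rV[R]_n.+2) x :
  (C `&` shearB W s v q @` C) x -> exists2 z, C z & z 0 0 = s - x 0 0.
Proof.
by move=> [Cx [z Cz <-]]; exists z => //; rewrite vcons0 subKr.
Qed.

End ConvexBodies.

(** * Cones *)

Section Cone.
Variable R : realType.

Lemma is_derive_affineX (c a b t : R) N :
  is_derive t 1 (fun t => c * (a + b * t) ^+ N.+1)
    (c * (N.+1%:R * b) * (a + b * t) ^+ N).
Proof.
pose f : R -> R := cst a + b \*: id.
have df : is_derive t 1 f b.
  by apply: is_derive_eq; rewrite add0r /GRing.scale/= mulr1.
have -> : (fun t => c * (a + b * t) ^+ N.+1) = c \*: (f ^+ N.+1).
  apply/funext => x; rewrite /GRing.scale/=; congr (_ * _).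
  by rewrite -[LHS]/((f x) ^+ N.+1) fctE.
apply: is_derive_eq; rewrite /GRing.scale/= /f !fctE.
by rewrite /GRing.scale/=; ring.
Qed.

Lemma is_derive_affineX_eq (c a b d t : R) N : c * (N.+1%:R * b) = d ->
  is_derive t 1 (fun t => c * (a + b * t) ^+ N.+1) (d * (a + b * t) ^+ N).
Proof. by move=> <-; exact: is_derive_affineX. Qed.

Lemma continuous_affineX (c a b : R) N : continuous (fun t => c * (a + b * t) ^+ N).
Proof.
move=> t; apply: cvgMr.
apply: (@continuous_comp _ _ _ (fun t => a + b * t) (fun x => x ^+ N)).
  by apply: cvgD; [exact: cvg_cst|apply: cvgMr; exact: cvg_id].
exact: exprn_continuous.
Qed.

Lemma convex_powX (l m p q : R) N : 0 <= l -> 0 <= m -> l + m = 1 -> 0 <= p -> 0 <= q ->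
  (l * p + m * q) ^+ N <= l * p ^+ N + m * q ^+ N.
Proof.
move=> l0 m0 lm p0 q0; elim: N => [|N IH]; first by rewrite !expr0 !mulr1 lm.
rewrite exprS; apply: (@le_trans _ _ ((l * p + m * q) * (l * p ^+ N + m * q ^+ N))).
  by rewrite ler_wpM2l// addr_ge0// mulr_ge0.
have pq : 0 <= (p - q) * (p ^+ N - q ^+ N).
  have [h|h] := leP p q.
    by rewrite mulr_le0// subr_le0// lerXn2r.
  by rewrite mulr_ge0// subr_ge0 ?(ltW h)// lerXn2r// ltW.
have -> : l = 1 - m by rewrite -lm addrK.
rewrite -subr_ge0 !exprS.
have -> : (1 - m) * (p * p ^+ N) + m * (q * q ^+ N) -
    ((1 - m) * p + m * q) * ((1 - m) * p ^+ N + m * q ^+ N) =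
    ((1 - m) * m) * ((p - q) * (p ^+ N - q ^+ N)) by ring.
by rewrite mulr_ge0// mulr_ge0// -lm addrK.
Qed.

(* Jensen's inequality for [z ^+ n.+1] with weights [(2 - a) / 2] and [a / 2] at
   [(2 - a)^-1] and [y / a]; it is an equality at the optimal reflection height. *)
Lemma cone_flip_bound n (a x y : R) : 0 < a -> a < 2 -> a ^+ n = 2^-1 ->
  0 <= x -> 0 <= y -> x <= (1 + y) / 2 ->
  2 * (x ^+ n.+1 - y ^+ n.+1) <= (2 - a) ^- n.
Proof.
move=> a0 a2 an x0 y0 xy.
have b0 : 0 < 2 - a by rewrite subr_gt0.
have xE : x ^+ n.+1 <= ((2 - a) / 2 * (2 - a)^-1 + a / 2 * (y / a)) ^+ n.+1.
  rewrite lerXn2r// ?nnegrE//; last by apply: le_trans xy _; rewrite le_eqVlt; apply/orP; left; apply/eqP; field; rewrite !gt_eqF.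
  by rewrite addr_ge0// ?mulr_ge0 ?divr_ge0 ?invr_ge0 ?(ltW a0) ?(ltW b0).
have := @convex_powX ((2 - a) / 2) (a / 2) (2 - a)^-1 (y / a) n.+1.
move=> /(_ _ _ _ _ _)/(le_trans xE) h.
have {h} : x ^+ n.+1 <= (2 - a) / 2 * (2 - a)^-1 ^+ n.+1 + a / 2 * (y / a) ^+ n.+1.
  by apply: h; rewrite ?divr_ge0 ?invr_ge0 ?(ltW a0) ?(ltW b0)//; field.
have -> : (2 - a) / 2 * (2 - a)^-1 ^+ n.+1 = (2 - a) ^- n / 2.
  by rewrite exprSr exprVn; field; rewrite ?expf_neq0 ?gt_eqF.
have -> : a / 2 * (y / a) ^+ n.+1 = y ^+ n.+1.
  rewrite expr_div_n [a ^+ _]exprS an; field; rewrite ?gt_eqF//.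
lra.
Qed.

Definition cone n (K : set 'rV[R]_n) : set 'rV[R]_n.+1 :=
  [set x : 'rV[R]_n.+1 | 0 <= x 0 0 <= 1 /\ exists2 y, K y & vtl x = (1 - x 0 0) *: y].

Lemma cone_compact n (K : set 'rV[R]_n) : compact K -> compact (cone K).
Proof.
move=> cK; pose f (z : R * 'rV[R]_n) := vcons z.1 ((1 - z.1) *: z.2).
have -> : cone K = f @` (`[0, 1]%classic `*` K).
  apply/seteqP; split => [x [x01 [y Ky xy]]|_ [[t y] [/= t01 Ky] <-]].
    by exists (x 0 0, y); rewrite //= /f /= -xy vcons_vtl.
  by rewrite /cone/= vcons0 vconsK; split; [rewrite in_itv/= in t01|exists y].
apply: (@continuous_compact _ _ f); last first.
  by apply: compact_setX => //; exact: segment_compact.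
apply: continuous_subspaceT; apply: row_continuous => j z.
have [i ->|->] := unliftP ord0 j.
  have -> : (fun t => f t 0 (lift ord0 i)) = (fun t : R * 'rV[R]_n => (1 - t.1) * t.2 0 i).
    by apply/funext => t; rewrite /f vconsS mxE.
  apply: cvgM.
    apply: cvgB; first exact: cvg_cst.
    exact: cvg_fst.
  apply: (@cvg_comp _ _ _ snd (fun M : 'rV[R]_n => M 0 i) _ (nbhs z.2)).
    exact: cvg_snd.
  exact: coord_continuous.
have -> : (fun t => f t 0 ord0) = fst by apply/funext => t; rewrite /f vcons0.
exact: cvg_fst.
Qed.

Lemma cone_convex_body n (K : set 'rV[R]_n) : convex_body K -> convex_body (cone K).
Proof.
move=> [cK [cvK [p Kp]]]; split; first exact: cone_compact.
split.
  move=> x x' [/andP[x0 x1] [y Ky xy]] [/andP[x0' x1'] [y' Ky' xy']] t /andP[t0 t1].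
  have t1' : 0 <= 1 - t by rewrite subr_ge0.
  pose a := t * (1 - x 0 0); pose b := (1 - t) * (1 - x' 0 0).
  have a0 : 0 <= a by rewrite mulr_ge0// subr_ge0.
  have b0 : 0 <= b by rewrite mulr_ge0// subr_ge0.
  have z0 : (t *: x + (1 - t) *: x') 0 0 = 1 - (a + b).
    by rewrite !mxE /a /b; ring.
  split; first by rewrite z0; apply/andP; split; [|lra]; rewrite /a /b; nra.
  rewrite z0 vtlD !vtlZ xy xy' !scalerA -/a -/b subKr.
  (* Both weights vanish only at the apex, where any base point serves. *)
  have [ab|ab] := eqVneq (a + b) 0.
    exists y => //; have [-> ->] : a = 0 /\ b = 0 by split; lra.
    by rewrite addr0 !scale0r addr0.
  exists (a / (a + b) *: y + (1 - a / (a + b)) *: y').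
    apply: cvK => //; rewrite divr_ge0 ?addr_ge0//= ler_pdivrMr ?mul1r ?lerDl//.
    by rewrite lt_neqAle eq_sym ab addr_ge0.
  rewrite scalerDr !scalerA; congr (_ *: _ + _ *: _); field; exact: ab.
pose c : 'rV[R]_n.+1 := vcons 2^-1 (2^-1 *: p).
(* [g] projects from the apex onto the base; at heights strictly between 0 and 1, points that it
   sends into [K] lie in the cone, so its continuity at [c] yields an interior point. *)
pose g (x : 'rV[R]_n.+1) := (1 - x 0 0)^-1 *: vtl x.
have c0 : 1 - c 0 0 != 0 by rewrite vcons0; apply/eqP => h; lra.
have gc : g c = p.
  have h : (1 - 2^-1)^-1 * 2^-1 = 1 :> R by field.
  by rewrite /g vcons0 vconsK scalerA h scale1r.
exists c.
have n1 : nbhs c [set x | K (g x)].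
  have cg : {for c, continuous g}.
    move=> A; rewrite -gc in Kp *; move=> /nbhs_ballP[e /= e0 eA].
    suff : nbhs c [set x | A (g x)] by [].
    have H : nbhs c [set y | forall j, ball (g c 0 j) e (g y 0 j)].
      apply: (@filter_forall _ _ (fun j => [set y | ball (g c 0 j) e (g y 0 j)])
        (nbhs c) (nbhs_filter c)) => j.
      have : {for c, continuous (fun x => g x 0 j)}.
        have -> : (fun x => g x 0 j) = (fun x : 'rV[R]_n.+1 => (1 - x 0 0)^-1 * x 0 (lift ord0 j)).
          by apply/funext => x; rewrite /g mxE vtlE.
        apply: continuousM; last exact: coord_continuous.
        apply: continuousV => //; apply: continuousB; first exact: cst_continuous.
        exact: coord_continuous.
      by apply; exact: nbhsx_ballx.
    apply: filterS H => y fxy; apply: eA; split => // i j.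
    by rewrite ord1; exact: fxy.
  by apply: cg; rewrite gc.
have n2 : nbhs c [set x : 'rV[R]_n.+1 | 0 < x 0 0 < 1].
  have := @open_obox R n.+1 (vcons 0 (vtl c - const_mx 1)) (vcons 1 (vtl c + const_mx 1)).
  move=> oO; apply: (filterS _ (open_nbhs_nbhs (conj oO _))).
    by move=> x /(_ ord0); rewrite !vcons0.
  move=> j; have [i ->|->] := unliftP ord0 j; last by rewrite !vcons0; apply/andP; split; lra.
  rewrite [vcons 0 _ _ _]vconsS [vcons 1 _ _ _]vconsS -vtlE.
  by move: (vtl c) => w; rewrite !mxE; apply/andP; split; lra.
apply: filterS (filterI n1 n2) => x [/= Kg /andP[x0 x1]].
split; first by rewrite !ltW.
by exists (g x) => //; rewrite /g scalerA divff ?scale1r// gt_eqF// subr_gt0.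
Qed.

Lemma sect_cone n (K : set 'rV[R]_n) t : 0 <= t <= 1 ->
  sect (cone K) t = (fun y => (1 - t) *: y) @` K.
Proof.
move=> t01; apply/seteqP; split => [y [_ [z Kz]]|_ [z Kz <-]].
  by rewrite vcons0 vconsK => ->; exists z.
by rewrite /sect/cone/= vcons0 vconsK; split => //; exists z.
Qed.

Lemma vol_scale0 n (a : R) (X : set 'rV[R]_n.+1) : 0 <= a -> (vol X < +oo)%E ->
  vol ((fun x => a *: x)%R @` X) = ((a ^+ n.+1)%:E * vol X)%E.
Proof.
rewrite le_eqVlt => /orP[/eqP <-|a0] Xoo; last exact: vol_scale.
rewrite expr0n/= mul0e; apply/eqP; rewrite eq_le vol_ge0 andbT.
have -> : 0%E = box_vol (0 : 'rV[R]_n.+1) 0.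
  by rewrite /box_vol big_ord_recl mxE subrr maxxx mul0r.
by apply: vol_le_box => _ [x Xx <-] j; rewrite scale0r lexx.
Qed.

Lemma vol_sect_cone n (K : set 'rV[R]_n.+1) t : 0 <= t <= 1 -> (vol K < +oo)%E ->
  vol (sect (cone K) t) = (((1 - t) ^+ n.+1)%:E * vol K)%E.
Proof.
move=> t01 Koo; rewrite sect_cone// vol_scale0//.
by move: t01 => /andP[_ t1]; rewrite subr_ge0.
Qed.

Lemma vol_slab_point n (E : set 'rV[R]_n.+2) c (v : R) :
  (vol (sect E c) <= v%:E)%E -> vol (slab c c E) = 0%E.
Proof.
move=> Ev; apply/eqP; rewrite eq_le vol_ge0 andbT.
have := vol_cylinder_le (lexx c) Ev; rewrite subrr mul0r.
apply: le_trans; apply: vol_le => x [Ex /= xc]; split => //.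
have <- : x 0 0 = c by apply/eqP; rewrite eq_le andbC.
by rewrite /sect/= vcons_vtl.
Qed.

(* The case [a = b] is where [vol_slab_le] needs bounded sections. *)
Lemma vol_slab_le_affineX n (E : set 'rV[R]_n.+2) (a b v p s : R) N : a <= b ->
  s ^+ 2 = 1 -> compact E ->
  (forall t, a <= t <= b -> (vol (sect E t) <= (v * (p + s * t) ^+ N)%:E)%E) ->
  (vol (slab a b E) <= (v / N.+1%:R * s * ((p + s * b) ^+ N.+1 - (p + s * a) ^+ N.+1))%:E)%E.
Proof.
rewrite le_eqVlt => /orP[/eqP <- _ _ Ev|ab ss cE Ev].
  by rewrite (vol_slab_point (Ev a _)) ?lexx// subrr mulr0.
rewrite mulrBr.
apply: (@vol_slab_le _ _ _ _ _ (fun t => v / N.+1%:R * s * (p + s * t) ^+ N.+1)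
  (fun t => v * (p + s * t) ^+ N) ab cE) => t tab; split; first exact: Ev.
apply: is_derive_affineX_eq.
transitivity (v * s ^+ 2); last by rewrite ss mulr1.
have : N.+1%:R != 0 :> R by rewrite pnatr_eq0.
by move: (N.+1%:R : R) => w w0; field.
Qed.

(** The two section bounds, for the cone and for its flipped copy, cross at [s / 2]. Integrating the
    smaller one on each side gives [2 (x^(n+2) - y^(n+2)) V / (n+2)] with [x = 1 - s / 2] and
    [y = 1 - min 1 s], which [cone_flip_bound] controls. *)
Lemma vol_cone_flip n (E : set 'rV[R]_n.+2) (V s a : R) :
  compact E -> 0 <= V -> 0 < a < 2 -> a ^+ n.+1 = 2^-1 ->
  (forall x, E x -> 0 <= x 0 0 <= 1 /\ 0 <= s - x 0 0 <= 1) ->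
  (forall t, 0 <= t <= 1 -> (vol (sect E t) <= (V * (1 - t) ^+ n.+1)%:E)%E) ->
  (forall t, 0 <= s - t <= 1 -> (vol (sect E t) <= (V * (1 - (s - t)) ^+ n.+1)%:E)%E) ->
  (vol E <= ((2 - a) ^- n.+1 * (V / n.+2%:R))%:E)%E.
Proof.
move=> cE V0 /andP[a0 a2] an Ers E1 E2.
have RHS0 : 0 <= (2 - a) ^- n.+1 * (V / n.+2%:R).
  by rewrite mulr_ge0// ?divr_ge0// invr_ge0 exprn_ge0// subr_ge0 ltW.
have [->|/set0P[x0 Ex0]] := eqVneq E set0; first by rewrite vol_set0.
have [/andP[x00 x01] /andP[s0 s1]] := Ers _ Ex0.
have s_ge0 : 0 <= s by lra.
have s_le2 : s <= 2 by lra.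
(* The heights met by both the cone and its flip form [[d, b]], an interval symmetric about
   [s / 2]. *)
pose b := Num.min 1 s; pose d := Num.max 0 (s - 1).
have db : d = s - b by rewrite /d /b; have [h|h] := leP 1 s; [rewrite max_r|rewrite max_l]; lra.
have b1 : b <= 1 by rewrite ge_min lexx.
have bs : b <= s by rewrite ge_min lexx orbT.
have b0 : 0 <= b by rewrite le_min ler01.
have sb : s / 2 <= b by rewrite le_min; apply/andP; split; lra.
have EU : E `<=` slab d (s / 2) E `|` slab (s / 2) b E.
  move=> x Ex; have [/andP[h1 h2] /andP[h3 h4]] := Ers _ Ex.
  have [h|h] := leP (x 0 0) (s / 2); [left|right]; split => //=.
    by rewrite h andbT db lerBlDr -lerBlDl le_min; apply/andP; split; lra.
  by rewrite (ltW h)/= le_min h2; lra.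
have s2 : (1 : R) ^+ 2 = 1 /\ (-1 : R) ^+ 2 = 1 by rewrite expr1n sqrrN expr1n.
have F1 : (vol (slab (s / 2) b E) <= (V / n.+2%:R * -1 *
    ((1 + -1 * b) ^+ n.+2 - (1 + -1 * (s / 2)) ^+ n.+2))%:E)%E.
  apply: vol_slab_le_affineX => //; first exact: s2.2.
  move=> t /andP[t1 t2]; apply: le_trans (E1 t _) _; first by apply/andP; split; lra.
  by rewrite mulN1r.
have F2 : (vol (slab d (s / 2) E) <= (V / n.+2%:R * 1 *
    ((1 - s + 1 * (s / 2)) ^+ n.+2 - (1 - s + 1 * d) ^+ n.+2))%:E)%E.
  apply: vol_slab_le_affineX => //; [by rewrite db; lra|exact: s2.1|].
  move=> t /andP[t1 t2]; rewrite db in t1.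
  apply: le_trans (E2 t _) _; first by apply/andP; split; lra.
  by have -> : 1 - (s - t) = 1 - s + 1 * t by ring.
apply: le_trans (vol_le EU) _; apply: le_trans (vol_setU _ _ _) _ => //.
apply: le_trans (leeD F2 F1) _; rewrite -EFinD lee_fin.
pose x := 1 - s / 2; pose y := 1 - b.
have -> : 1 - s + 1 * (s / 2) = x by rewrite /x; field.
have -> : 1 - s + 1 * d = y by rewrite /y db; ring.
have -> : 1 + -1 * b = y by rewrite /y; ring.
have -> : 1 + -1 * (s / 2) = x by rewrite /x; ring.
have x_ge0 : 0 <= x by rewrite /x; lra.
have y_ge0 : 0 <= y by rewrite /y; lra.
have xy : x <= (1 + y) / 2 by rewrite /x /y; lra.
have h := cone_flip_bound a0 a2 an x_ge0 y_ge0 xy.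
rewrite mulrC; apply: le_trans (ler_wpM2r _ h); last by rewrite divr_ge0.
by rewrite le_eqVlt; apply/orP; left; apply/eqP; ring.
Qed.

Theorem sigma_cone n k (K : set 'rV[R]_n.+1) (a c : R) : convex_body K ->
  0 < a < 2 -> a ^+ n.+1 = 2^-1 -> 0 <= c -> (2 - a) ^- n.+1 <= c ->
  (Defs.Sym k K <= c%:E)%E -> (sigma R n.+2 k.+1 <= c%:E)%E.
Proof.
move=> bK a02 an c0 ac Kc.
have Koo : (vol K < +oo)%E by apply: vol_compact_lty; exact: bK.1.
have K0 := vol_convex_body_gt0 bK.
have Kf : vol K \is a fin_num by rewrite ge0_fin_numE// vol_ge0.
pose V := fine (vol K).
have V0 : 0 < V by rewrite fine_gt0// K0 Koo.
have VK : vol K = V%:E by rewrite fineK.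
pose C := cone K.
have cC : compact C by apply: cone_compact; exact: bK.1.
have Vn : 0 < V / n.+2%:R by rewrite divr_gt0.
have secC t : 0 <= t <= 1 -> vol (sect C t) = (V * (1 - t) ^+ n.+1)%:E.
  by move=> t01; rewrite vol_sect_cone// VK -EFinM mulrC.
have volC : ((V / n.+2%:R)%:E <= vol C)%E.
  have := @vol_slab_ge _ _ C 0 1 (fun t => - (V / n.+2%:R) * (1 + -1 * t) ^+ n.+2)
     (fun t => V * (1 + -1 * t) ^+ n.+1) ltr01.
  rewrite mulr1 mulr0 addr0 subrr expr0n/= mulr0 sub0r expr1n mulr1 opprK => h.
  apply: le_trans (h _ _ _) _; [exact: continuous_affineX| | |by apply: vol_le => x []].
    move=> t; apply: is_derive_affineX_eq.
    have : n.+2%:R != 0 :> R by rewrite pnatr_eq0.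
    by move: (n.+2%:R : R) => w w0; field.
  move=> t t01; rewrite secC// mulN1r lexx; split => //.
  by rewrite mulr_ge0 ?(ltW V0)// exprn_ge0// subr_ge0; case/andP: t01.
have -> : c = c * (V / n.+2%:R) / (V / n.+2%:R) by rewrite mulfK// gt_eqF.
apply: sigma_thin volC _ _ => //.
- exact: cone_convex_body.
- by rewrite mulr_ge0// ltW.
- move=> W p q WW; set E := C `&` _.
  have cE : compact E by exact: compact_cap_shearA.
  have := @vol_slab_le_affineX _ E 0 1 (c * V) 1 (-1) n.+1 ler01.
  rewrite mulr0 mulr1 addr0 subrr expr0n/= expr1n sub0r sqrrN expr1n.
  move=> /(_ erefl cE) h; apply: (@le_trans _ _ (vol (slab 0 1 E))).
    by apply: vol_le => x Ex; split => //; case: Ex => -[].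
  apply: le_trans (h _) _; last first.
    by rewrite lee_fin le_eqVlt; apply/orP; left; apply/eqP; ring.
  move=> t t01; rewrite mulN1r.
  (* The apex section cannot be rescaled to [K], but there the bound is 0 on both sides. *)
  have [t1|t1] := eqVneq t 1.
    have := secC t t01; rewrite t1 subrr expr0n/= !mulr0 => <-.
    by apply: vol_le => y [].
  have t1' : 0 < 1 - t by rewrite subr_gt0 lt_neqAle t1; case/andP: t01.
  (* Reflecting [(1 - t) K] through a point is [1 - t] times the reflection of [K] through the point
     divided by [1 - t]. *)
  pose p' := (1 - t)^-1 *: (t *: p + q).
  have := @Sym_vol _ _ _ _ _ bK Kc p' W WW.
  rewrite -(@lee_pmul2l _ ((1 - t) ^+ n.+1)%:E)// ?lte_fin ?exprn_gt0//.
  rewrite -vol_scale// VK -!EFinM.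
  have -> : (1 - t) ^+ n.+1 * (c * V) = c * V * (1 - t) ^+ n.+1 by ring.
  apply: le_trans; apply: vol_le => y /sect_shearA.
  rewrite sect_cone// => -[[z Kz zy] [_ [w Kw <-] wy]].
  exists z => //; split => //; exists w => //.
  apply/(@scalerI _ _ (1 - t)); first by rewrite gt_eqF.
  rewrite zy -wy !refl_flatE /p' scalerDr scalerBr !scalemxAl !scalerA.
  by rewrite divff ?gt_eqF// scale1r.
- move=> W s v q WW; set E := C `&` _.
  have cE : compact E by exact: compact_cap_shearB.
  have HE := vol_sect_shearB s v q C _ WW.
  apply: (@le_trans _ _ ((2 - a) ^- n.+1 * (V / n.+2%:R))%:E); last first.
    by rewrite lee_fin ler_wpM2r// ltW.
  apply: (@vol_cone_flip _ E V s) => //; first exact: ltW.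
  + move=> x Ex; split; first by case: Ex => -[].
    by have [z [z01 _] <-] := shearB_range Ex.
  + by move=> t t01; rewrite -secC//; have [] := HE t.
  + by move=> t t01; rewrite -secC//; have [] := HE t.
Qed.

End Cone.

(** * A planar body of low symmetry *)

Section Planar.
Variable R : realType.

Lemma vol1_le (Y : set 'rV[R]_1) (lo hi : R) :
  (forall y, Y y -> lo <= y 0 0 <= hi) -> (vol Y <= (Num.max (hi - lo) 0)%:E)%E.
Proof.
move=> Yb; apply: le_trans (vol_le_box (a := const_mx lo) (b := const_mx hi) _) _.
  by move=> y /Yb yb j; rewrite !mxE ord1.
by rewrite /box_vol big_ord1 !mxE.
Qed.

Lemma is_derive_quad (u w t : R) :
  is_derive t 1 (fun t => u * t + w * (t * t / 2)) (u + w * t).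
Proof.
have h1 := is_derive_affineX u 0 1 t 0.
have h2 := is_derive_affineX (w / 2) 0 1 t 1.
have := is_deriveD h1 h2.
have -> : (fun t => u * (0 + 1 * t) ^+ 1) + (fun t => w / 2 * (0 + 1 * t) ^+ 2) =
    (fun t => u * t + w * (t * t / 2)).
  by apply/funext => x; rewrite fctE !mul1r !add0r expr1 expr2; ring.
have -> // : u * (1%:R * 1) * (0 + 1 * t) ^+ 0 + w / 2 * (2%:R * 1) * (0 + 1 * t) ^+ 1 =
    u + w * t.
by rewrite expr0 expr1; field.
Qed.

Section Trapezoids.
Variables (E : set 'rV[R]_2) (lo hi : R).
Hypothesis cE : compact E.

Lemma trapezoid_pos (u w a b : R) :
  (forall t, lo <= t <= hi -> (vol (sect E t) <= (Num.max (u + w * t) 0)%:E)%E) ->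
  lo <= a -> a <= b -> b <= hi -> 0 <= u + w * a -> 0 <= u + w * b ->
  (vol (slab a b E) <= ((b - a) * (u + w * (a + b) / 2))%:E)%E.
Proof.
move=> Euw la ab bh fa fb.
have f0 t : a <= t <= b -> 0 <= u + w * t.
  move=> /andP[a_t tb]; have [h|h] := leP 0 w.
    by apply: le_trans fa _; rewrite lerD2l ler_wpM2l.
  by apply: le_trans fb _; rewrite lerD2l ler_wnM2l// ltW.
have Ef t : a <= t <= b -> (vol (sect E t) <= (u + w * t)%:E)%E.
  move=> tab; apply: le_trans (Euw t _) _; last by rewrite max_l// f0.
  by case/andP: tab => h1 h2; rewrite (le_trans la)//= (le_trans h2).
move: ab; rewrite le_eqVlt => /orP[/eqP ab|ab].
  have aab : a <= a <= b by rewrite lexx/= ab lexx.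
  by move: (vol_slab_point (Ef a aab)); rewrite -ab => ->; rewrite subrr mul0r.
have -> : (b - a) * (u + w * (a + b) / 2) =
   (u * b + w * (b * b / 2)) - (u * a + w * (a * a / 2)) by field.
apply: (@vol_slab_le _ _ _ _ _ (fun t => u * t + w * (t * t / 2))
  (fun t => u + w * t) ab cE) => t tab.
by split; [exact: Ef|exact: is_derive_quad].
Qed.

Lemma trapezoid_neg (u w a b : R) :
  (forall t, lo <= t <= hi -> (vol (sect E t) <= (Num.max (u + w * t) 0)%:E)%E) ->
  lo <= a -> a <= b -> b <= hi -> u + w * a <= 0 -> u + w * b <= 0 ->
  (vol (slab a b E) <= 0)%E.
Proof.
move=> Euw la ab bh fa fb.
have f0 t : a <= t <= b -> u + w * t <= 0.
  move=> /andP[a_t tb]; have [h|h] := leP 0 w.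
    by apply: le_trans fb; rewrite lerD2l ler_wpM2l.
  by apply: le_trans fa; rewrite lerD2l ler_wnM2l// ltW.
have Ef t : a <= t <= b -> (vol (sect E t) <= 0%:E)%E.
  move=> tab; apply: le_trans (Euw t _) _; last by rewrite max_r// f0.
  by case/andP: tab => h1 h2; rewrite (le_trans la)//= (le_trans h2).
move: ab; rewrite le_eqVlt => /orP[/eqP ab|ab].
  have aab : a <= a <= b by rewrite lexx/= ab lexx.
  by move: (vol_slab_point (Ef a aab)); rewrite -ab => ->.
have := @vol_slab_le _ _ E a b (fun=> 0) (fun=> 0) ab cE; rewrite subrr; apply => t tab.
by split; [exact: Ef|exact: is_derive_cst].
Qed.

Lemma slab_cat (a b c A A' : R) : a <= b -> b <= c ->
  (vol (slab a b E) <= A%:E)%E -> (vol (slab b c E) <= A'%:E)%E ->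
  (vol (slab a c E) <= (A + A')%:E)%E.
Proof.
move=> ab bc hA hA'; rewrite EFinD; apply: le_trans (leeD hA hA').
apply: le_trans (vol_setU _ _ _) => //; apply: vol_le => x [Ex /andP[h1 h2]].
by have [h|h] := leP (x 0 0) b; [left|right]; split => //=; rewrite ?h1 ?h ?h2 ?(ltW h).
Qed.

End Trapezoids.

(* [E] stands for the overlap of the triangle [0 <= y <= min t (2 - t)] with its image
   under [y |-> al + be * t - y]. *)
Section Tent.
Variables (E : set 'rV[R]_2) (al be : R).
Hypothesis cE : compact E.
Hypothesis Et : forall x, E x -> 0 <= x 0 0 <= 2.
Hypothesis EP : forall t, 0 <= t <= 2 ->
  (vol (sect E t) <= (Num.max (al + be * t) 0)%:E)%E.
Hypothesis El : forall t, 0 <= t <= 2 ->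
  (vol (sect E t) <= (Num.max (- al + (2 - be) * t) 0)%:E)%E.
Hypothesis Er : forall t, 0 <= t <= 2 ->
  (vol (sect E t) <= (Num.max (4 - al + - (2 + be) * t) 0)%:E)%E.
Hypothesis be0 : 0 <= be.

Let posP a b := @trapezoid_pos E 0 2 cE al be a b EP.
Let posl a b := @trapezoid_pos E 0 2 cE (- al) (2 - be) a b El.
Let posr a b := @trapezoid_pos E 0 2 cE (4 - al) (- (2 + be)) a b Er.
Let negP a b := @trapezoid_neg E 0 2 cE al be a b EP.
Let negl a b := @trapezoid_neg E 0 2 cE (- al) (2 - be) a b El.
Let negr a b := @trapezoid_neg E 0 2 cE (4 - al) (- (2 + be)) a b Er.

Let vol02 A : (vol (slab 0 2 E) <= A%:E)%E -> A <= 2 / 3 -> (vol E <= (2 / 3)%:E)%E.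
Proof.
move=> h hA; apply: (@le_trans _ _ (vol (slab 0 2 E))).
  by apply: vol_le => x Ex; split => //; exact: Et.
by apply: le_trans h _; rewrite lee_fin.
Qed.

Let zero_le : (0 : R) <= 2 / 3. Proof. by rewrite divr_ge0. Qed.

Let p4 : 0 < 2 + be. Proof. by rewrite ltr_wpDr. Qed.
Let p3 : 0 < 1 + be. Proof. by rewrite ltr_wpDr. Qed.
(** Breakpoints of the section bound. With [P t = al + be * t], the right bound [2 (2 - t) - P t]
    vanishes at [t3] and meets [P] at [b]. Below, [ta] is the zero of [P], [t1] that of the left
    bound [2 t - P t], and [a] is where these two meet. *)
Let t3 := (4 - al) / (2 + be).
Let b := (2 - al) / (1 + be).
Let t3E : t3 * (2 + be) = 4 - al. Proof. by rewrite divfK// gt_eqF. Qed.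
Let bE : b * (1 + be) = 2 - al. Proof. by rewrite divfK// gt_eqF. Qed.

(* With [e := 2 - al - be], Titu's inequality
   [e ^ 2 / (4 - be ^ 2) <= (e - 1) ^ 2 / (1 - be ^ 2) + 1 / 3]. *)
Lemma tent_cut_apex : 0 <= al -> be < 1 -> 1 < 2 - al - be -> (vol E <= (2 / 3)%:E)%E.
Proof.
have := (be0, p3, p4, t3E, bE) => -[[[[hbe hp3] hp4] ht3E] hbE].
move=> al0 be1 e1.
pose t1 := al / (2 - be); pose a := al / (1 - be).
have p1 : 0 < 2 - be by lra.
have p2 : 0 < 1 - be by lra.
have t1E : t1 * (2 - be) = al by rewrite divfK// gt_eqF.
have aE : a * (1 - be) = al by rewrite divfK// gt_eqF.
have t10 : 0 <= t1 by rewrite divr_ge0// ltW.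
have a0 : 0 <= a by rewrite divr_ge0// ltW.
have t1a : t1 <= a by rewrite ler_wpM2l// lef_pV2// ?posrE//; lra.
have a1 : a <= 1 by rewrite ler_pdivrMr//; lra.
have b1 : 1 <= b by rewrite ler_pdivlMr//; lra.
have b2 : b <= 2 by rewrite ler_pdivrMr//; lra.
have bt3 : b <= t3 by rewrite -(ler_pM2r p4) t3E; nra.
have t32 : t3 <= 2 by rewrite ler_pdivrMr//; lra.
have h1 : (vol (slab 0 t1 E) <= 0%:E)%E by apply: negl => //; lra.
have h2 : (vol (slab t1 a E) <= ((a - t1) * (- al + (2 - be) * (t1 + a) / 2))%:E)%E.
  by apply: posl => //; lra.
have h3 : (vol (slab a b E) <= ((b - a) * (al + be * (a + b) / 2))%:E)%E.
  by apply: posP => //; lra.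
have h4 : (vol (slab b t3 E) <= ((t3 - b) * (4 - al + - (2 + be) * (b + t3) / 2))%:E)%E.
  by apply: posr => //; lra.
have h5 : (vol (slab t3 2 E) <= 0%:E)%E by apply: negr => //; lra.
have := slab_cat t10 (le_trans (le_trans (le_trans t1a (le_trans a1 b1)) bt3) t32) h1
  (slab_cat t1a (le_trans (le_trans (le_trans a1 b1) bt3) t32) h2
  (slab_cat (le_trans a1 b1) (le_trans bt3 t32) h3 (slab_cat bt3 t32 h4 h5))).
move/vol02; apply; rewrite -subr_ge0.
set X := (Z in 0 <= Z).
have -> : X = 2 * (3 * (1 - al - be) - (1 - be ^+ 2)) ^+ 2 /
    (3 * ((2 - be) * (2 + be)) * ((1 - be) * (1 + be))).
  by rewrite /X /t1 /a /b /t3; field; rewrite !gt_eqF.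
apply: divr_ge0; first by apply: mulr_ge0 => //; exact: sqr_ge0.
by apply: ltW; rewrite !mulr_gt0.
Qed.

Lemma tent_apex : 0 <= al -> 0 < 2 - al - be -> 2 - al - be <= 1 \/ 1 <= be ->
  (vol E <= (2 / 3)%:E)%E.
Proof.
have := (be0, p3, p4, t3E, bE) => -[[[[hbe hp3] hp4] ht3E] hbE].
move=> al0 e0 e1.
pose t1 := al / (2 - be).
have p1 : 0 < 2 - be by lra.
have t1E : t1 * (2 - be) = al by rewrite divfK// gt_eqF.
have t10 : 0 <= t1 by rewrite divr_ge0// ltW.
have t11 : t1 <= 1 by rewrite ler_pdivrMr//; lra.
have t31 : 1 <= t3 by rewrite ler_pdivlMr//; lra.
have t32 : t3 <= 2 by rewrite ler_pdivrMr//; lra.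
have h1 : (vol (slab 0 t1 E) <= 0%:E)%E by apply: negl => //; lra.
have h2 : (vol (slab t1 1 E) <= ((1 - t1) * (- al + (2 - be) * (t1 + 1) / 2))%:E)%E.
  by apply: posl => //; lra.
have h4 : (vol (slab 1 t3 E) <= ((t3 - 1) * (4 - al + - (2 + be) * (1 + t3) / 2))%:E)%E.
  by apply: posr => //; lra.
have h5 : (vol (slab t3 2 E) <= 0%:E)%E by apply: negr => //; lra.
have := slab_cat t10 (le_trans (le_trans t11 t31) t32) h1
  (slab_cat t11 (le_trans t31 t32) h2 (slab_cat t31 t32 h4 h5)).
move/vol02; apply.
set X := (Z in Z <= _).
have -> : X = 2 * (2 - al - be) ^+ 2 / ((2 - be) * (2 + be)).
  by rewrite /X /t1 /t3; field; rewrite !gt_eqF.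
rewrite ler_pdivrMr ?mulr_gt0//.
case: e1 => e1.
  have : (2 - al - be) ^+ 2 <= 1 * (2 - al - be) by rewrite expr2 ler_wpM2r// ltW.
  have [h|h] := leP be 1; nra.
have : (2 - al - be) ^+ 2 <= (2 - be) ^+ 2 by rewrite lerXn2r// ?nnegrE; lra.
by nra.
Qed.

Lemma tent_empty : 0 <= al -> 2 - al - be <= 0 -> (vol E <= (2 / 3)%:E)%E.
Proof.
have := (be0, p3, p4, t3E, bE) => -[[[[hbe hp3] hp4] ht3E] hbE].
move=> al0 e0.
have h1 : (vol (slab 0 1 E) <= 0%:E)%E by apply: negl => //; lra.
have h2 : (vol (slab 1 2 E) <= 0%:E)%E by apply: negr => //; lra.
have l01 : (0 : R) <= 1 by []. have l12 : (1 : R) <= 2 by lra.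
by move: (slab_cat l01 l12 h1 h2) => /vol02; apply; rewrite addr0.
Qed.

Lemma tent_low : al < 0 -> be <= 1 \/ be - 1 <= - al \/ 2 <= be ->
  (vol E <= (2 / 3)%:E)%E.
Proof.
have := (be0, p3, p4, t3E, bE) => -[[[[hbe hp3] hp4] ht3E] hbE].
move=> al0 hc.
have [h|h] := leP (al + be * 2) 0.
  have h1 : (vol (slab 0 2 E) <= 0%:E)%E by apply: negP => //; lra.
  exact: vol02 h1 zero_le.
have be1 : 0 < be by lra.
pose ta := - al / be.
have taE : ta * be = - al by rewrite divfK// gt_eqF.
have ta0 : 0 <= ta by rewrite divr_ge0//; lra.
have tab : ta <= b by rewrite -(ler_pM2r be1) taE -(ler_pM2r p3) mulrAC bE; nra.
have bt3 : b <= t3 by rewrite -(ler_pM2r p4) t3E -(ler_pM2r p3) mulrAC bE; nra.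
have t32 : t3 <= 2 by rewrite ler_pdivrMr//; lra.
have b0 : 0 <= b := le_trans ta0 tab.
have b2 : b <= 2 := le_trans bt3 t32.
have h1 : (vol (slab 0 ta E) <= 0%:E)%E by apply: negP => //; lra.
have h2 : (vol (slab ta b E) <= ((b - ta) * (al + be * (ta + b) / 2))%:E)%E.
  by apply: posP => //; nra.
have h4 : (vol (slab b t3 E) <= ((t3 - b) * (4 - al + - (2 + be) * (b + t3) / 2))%:E)%E.
  by apply: posr => //; nra.
have h5 : (vol (slab t3 2 E) <= 0%:E)%E by apply: negr => //; lra.
have := slab_cat ta0 (le_trans (le_trans tab bt3) t32) h1
  (slab_cat tab (le_trans bt3 t32) h2 (slab_cat bt3 t32 h4 h5)).
move/vol02; apply.
set X := (Z in Z <= _).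
have -> : X = (2 * be + al) ^+ 2 / ((1 + be) * be * (2 + be)).
  by rewrite /X /ta /b /t3; field; rewrite !gt_eqF.
rewrite ler_pdivrMr ?mulr_gt0//.
have sq1 : (2 * be + al) ^+ 2 <= (2 * be) ^+ 2 by rewrite lerXn2r// ?nnegrE; lra.
(* Dropping [al < 0] from the numerator suffices exactly when [be] is not strictly between 1 and 2;
   in between, the hypothesis [be - 1 <= - al] gives the sharper bound [be + 1]. *)
have [sq2|hm] : 0 <= (be - 1) * (be - 2) \/ 2 * be + al <= be + 1 /\ 1 < be.
- case: hc => [hc|[hc|hc]]; last by left; rewrite mulr_ge0; lra.
    by left; rewrite nmulr_lge0; lra.
  by have [?|?] := leP be 1; [left; rewrite nmulr_lge0; lra|right; lra].
- apply: le_trans sq1 _; rewrite -subr_ge0.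
  have -> : 2 / 3 * ((1 + be) * be * (2 + be)) - (2 * be) ^+ 2 =
    2 / 3 * (be * ((be - 1) * (be - 2))) by field.
  by apply: mulr_ge0 => //; apply: mulr_ge0.
have sq3 : (2 * be + al) ^+ 2 <= (be + 1) ^+ 2 by rewrite lerXn2r// ?nnegrE; lra.
apply: le_trans sq3 _; rewrite -subr_ge0.
have -> : 2 / 3 * ((1 + be) * be * (2 + be)) - (be + 1) ^+ 2 =
  (1 + be) * (be - 1) * (2 * be + 3) / 3 by field.
have p5 : 0 <= be - 1 by lra.
have p6 : 0 <= 2 * be + 3 by lra.
by apply: mulr_ge0 => //; apply: mulr_ge0 => //; apply: mulr_ge0 => //; exact: ltW.
Qed.

(* Titu's inequality again, now with value [2 / (1 + 2 * be)]. *)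
Lemma tent_cut_base : al < 0 -> 1 < be -> be < 2 -> - al < be - 1 ->
  (vol E <= (2 / 3)%:E)%E.
Proof.
have := (be0, p3, p4, t3E, bE) => -[[[[hbe hp3] hp4] ht3E] hbE].
move=> al0 be1 be2 hc.
have p1 : 0 < 2 - be by lra.
have p2 : 0 < be - 1 by lra.
have be_gt0 : 0 < be by lra.
pose ta := - al / be; pose a := - al / (be - 1).
have taE : ta * be = - al by rewrite divfK// gt_eqF.
have aE : a * (be - 1) = - al by rewrite divfK// gt_eqF.
have ta0 : 0 <= ta by rewrite divr_ge0//; lra.
have taa : ta <= a by rewrite ler_wpM2l// ?lef_pV2// ?posrE//; lra.
have a0 : 0 <= a := le_trans ta0 taa.
have a1 : a <= 1 by rewrite ler_pdivrMr//; lra.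
have t31 : 1 <= t3 by rewrite ler_pdivlMr//; lra.
have t32 : t3 <= 2 by rewrite ler_pdivrMr//; lra.
have h1 : (vol (slab 0 ta E) <= 0%:E)%E by apply: negP => //; lra.
have h2 : (vol (slab ta a E) <= ((a - ta) * (al + be * (ta + a) / 2))%:E)%E.
  by apply: posP => //; lra.
have h3 : (vol (slab a 1 E) <= ((1 - a) * (- al + (2 - be) * (a + 1) / 2))%:E)%E.
  by apply: posl => //; lra.
have h4 : (vol (slab 1 t3 E) <= ((t3 - 1) * (4 - al + - (2 + be) * (1 + t3) / 2))%:E)%E.
  by apply: posr => //; lra.
have h5 : (vol (slab t3 2 E) <= 0%:E)%E by apply: negr => //; lra.
have := slab_cat ta0 (le_trans (le_trans (le_trans taa a1) t31) t32) h1
  (slab_cat taa (le_trans (le_trans a1 t31) t32) h2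
  (slab_cat a1 (le_trans t31 t32) h3 (slab_cat t31 t32 h4 h5))).
move/vol02; apply.
(* The deficit [2 / (1 + 2 be) - area] is quadratic in [al] with a double root at
   [- (2 - be) Y / D]; [D] and [Y] display it as a square. *)
pose D := (2 - be) ^+ 2 * (1 + 2 * be) / 2.
pose Y := (be - 1) * be * (2 - be).
have D0 : 0 < D by rewrite divr_gt0// mulr_gt0 ?exprn_gt0//; lra.
have Y0 : 0 < Y by rewrite !mulr_gt0.
have q0 : 0 < 1 + 2 * be by lra.
apply: (@le_trans _ _ (2 / (1 + 2 * be))); last first.
  by rewrite ler_pdivrMr//; lra.
rewrite -subr_ge0.
set X := (Z in 0 <= Z).
have -> : X = ((2 - be) * Y + al * D) ^+ 2 /
    (((2 - be) * (2 + be) / 2) * Y * D).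
  by rewrite /X /ta /a /t3 /Y /D; field; rewrite !gt_eqF.
apply: divr_ge0; first exact: sqr_ge0.
by apply: ltW; rewrite !mulr_gt0 ?invr_gt0.
Qed.

Lemma tent_area_be_ge0 : (vol E <= (2 / 3)%:E)%E.
Proof.
have [al0|al0] := leP 0 al.
  have [e0|e0] := leP (2 - al - be) 0; first exact: tent_empty.
  have [e1|e1] := leP (2 - al - be) 1; first by apply: tent_apex => //; left.
  have [be1|be1] := ltP be 1; first exact: tent_cut_apex.
  by apply: tent_apex => //; right.
have [be1|be1] := leP be 1; first by apply: tent_low => //; left.
have [be2|be2] := leP 2 be; first by apply: tent_low => //; right; right.
have [hc|hc] := leP (be - 1) (- al); first by apply: tent_low => //; right; left.
exact: tent_cut_base.
Qed.

End Tent.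
End Planar.

(** * The truncated triangle and its two kinds of overlap *)

Section PlanarUpper.
Variable R : realType.

(** The mirror [t |-> 2 - t] swaps the left and right bounds and sends [(al, be)] to
    [(al + 2 be, - be)], reducing to [be >= 0]. *)
Lemma tent_area (E : set 'rV[R]_2) (al be : R) : compact E ->
  (forall x, E x -> 0 <= x 0 0 <= 2) ->
  (forall t, 0 <= t <= 2 -> (vol (sect E t) <= (Num.max (al + be * t) 0)%:E)%E) ->
  (forall t, 0 <= t <= 2 -> (vol (sect E t) <= (Num.max (- al + (2 - be) * t) 0)%:E)%E) ->
  (forall t, 0 <= t <= 2 ->
    (vol (sect E t) <= (Num.max (4 - al + - (2 + be) * t) 0)%:E)%E) ->
  (vol E <= (2 / 3)%:E)%E.
Proof.
move=> cE Er H1 H2 H3; have [be0|be0] := leP 0 be.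
  exact: (tent_area_be_ge0 (al := al) (be := be)).
pose M : 'M[R]_(1 + 1) := block_mx (-1)%:M 0 0 1%:M.
have MM : M *m M^T = 1%:M.
  rewrite tr_block_mx !trmx0 trmx1 tr_scalar_mx mulmx_block !mulmx0 !mul0mx !mulmx1.
  rewrite !addr0 add0r -scalar_mxM mulrNN mulr1; symmetry.
  exact: (@scalar_mx_block _ 1 1).
pose f (x : 'rV[R]_2) := x *m M + vcons 2 (0 : 'rV_1).
have fE x : f x = vcons (2 - x 0 0) (vtl x).
  rewrite /f (@mul_block_vcons _ 1) vcons0 vconsK mulN1r addrC.
  by rewrite mulmx1 scaler0 add0r addr0.
have sf t : sect (f @` E) t = sect E (2 - t).
  apply/seteqP; split => y.
    case=> x Ex; rewrite fE => h.
    have h0 : 2 - x 0 0 = t by have := congr1 (fun x : 'rV_2 => x 0 0) h; rewrite !vcons0.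
    have hy : vtl x = y by have := congr1 (@vtl _ _) h; rewrite !vconsK.
    by rewrite /sect/= -hy -h0 subKr vcons_vtl.
  by move=> Ey; exists (vcons (2 - t) y) => //; rewrite fE vcons0 vconsK subKr.
rewrite -(vol_orthogonal (vcons 2 (0 : 'rV_1)) E MM).
have t2 (t : R) : 0 <= t <= 2 -> 0 <= 2 - t <= 2.
  by move=> /andP[t0 t2]; apply/andP; split; lra.
apply: (@tent_area_be_ge0 _ _ (al + 2 * be) (- be)).
- by apply: compact_image => //; exact: affine_continuous.
- by move=> _ [x Ex <-]; rewrite -/(f x) fE vcons0; apply: t2; exact: Er.
- move=> t tt; rewrite sf; apply: le_trans (H1 _ (t2 _ tt)) _.
  by have -> : al + be * (2 - t) = al + 2 * be + - be * t by ring.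
- move=> t tt; rewrite sf; apply: le_trans (H3 _ (t2 _ tt)) _.
  by have -> : 4 - al + - (2 + be) * (2 - t) = - (al + 2 * be) + (2 - - be) * t by ring.
- move=> t tt; rewrite sf; apply: le_trans (H2 _ (t2 _ tt)) _.
  by have -> : - al + (2 - be) * (2 - t) = 4 - (al + 2 * be) + - (2 + - be) * t by ring.
- by rewrite oppr_ge0 ltW.
Qed.

Lemma coord_closed_le n (p q c : R) (i j : 'I_n) :
  closed [set x : 'rV[R]_n | p * x 0 i + q * x 0 j <= c].
Proof.
have cf : continuous (fun x : 'rV[R]_n => p * x 0 i + q * x 0 j).
  have h k : continuous (fun x : 'rV[R]_n => x 0 k) := @coord_continuous R 1 n 0 k.
  move=> x; apply: (continuousD (continuousM (@cst_continuous _ _ p x) (h i x))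
    (continuousM (@cst_continuous _ _ q x) (h j x))).
exact: (continuous_closedP _).1 cf _ (@closed_le _ c).
Qed.

(** With a cut at abscissa [r], the flips overlap in area at most [r^2 / 3] once they reach past the
    cut. The value [sqrt 2] makes this equal to [2 / 3], the bound for the reflections that keep the
    first coordinate. *)
Let r : R := Num.sqrt 2.
Let r0 : 0 <= r. Proof. exact: sqrtr_ge0. Qed.
Let rr : r * r = 2. Proof. by rewrite -expr2 sqr_sqrtr. Qed.

Definition cut_triangle : set 'rV[R]_2 :=
  [set x | [/\ 0 <= vtl x 0 0, vtl x 0 0 <= x 0 0, vtl x 0 0 <= 2 - x 0 0 & x 0 0 <= r]].

Lemma compact_cut_triangle : compact cut_triangle.
Proof.
apply: (@subclosed_compact _ _ (box (const_mx 0) (const_mx 2))).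
- have -> : cut_triangle =
    [set x : 'rV[R]_2 | 0 * x 0 0 + (-1) * x 0 (lift ord0 0) <= 0] `&`
    [set x : 'rV[R]_2 | (-1) * x 0 0 + 1 * x 0 (lift ord0 0) <= 0] `&`
    [set x : 'rV[R]_2 | 1 * x 0 0 + 1 * x 0 (lift ord0 0) <= 2] `&`
    [set x : 'rV[R]_2 | 1 * x 0 0 + 0 * x 0 (lift ord0 0) <= r].
    apply/seteqP; split => x; rewrite /cut_triangle/= vtlE.
      by move=> [h1 h2 h3 h4]; do !split; lra.
    by move=> [[[h1 h2] h3] h4]; split; lra.
  by do !apply: closedI; exact: coord_closed_le.
- exact: box_compact.
- move=> x [h1 h2 h3 h4]; apply/boxE; rewrite !mxE; split; first by apply/andP; split; lra.
  by move=> j; rewrite ord1 ![vtl (const_mx _) _ _]vtlE !mxE -vtlE; apply/andP; split; lra.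
Qed.

Lemma convex_body_cut_triangle : convex_body cut_triangle.
Proof.
split; first exact: compact_cut_triangle.
split.
  move=> x y [x1 x2 x3 x4] [y1 y2 y3 y4] t /andP[t0 t1].
  have {}t1 : 0 <= 1 - t by rewrite subr_ge0.
  rewrite /cut_triangle/= vtlD !vtlZ.
  move: (vtl x) (vtl y) x1 x2 x3 y1 y2 y3 => x' y' x1 x2 x3 y1 y2 y3.
  rewrite !mxE.
  move: (x 0 0) (y 0 0) (x' 0 0) (y' 0 0) x1 x2 x3 x4 y1 y2 y3 y4 => {x y x' y'}.
  by move=> a b c d *; split; nra.
exists (vcons 1 (const_mx (2^-1))).
have oO := @open_obox R 2 (vcons (3/4) (const_mx (1/4))) (vcons (5/4) (const_mx (3/4))).
apply: (filterS _ (open_nbhs_nbhs (conj oO _))).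
  move=> x xO; have := xO 0; have := xO (lift ord0 0).
  rewrite !vcons0 [vcons (3/4) _ _ _]vconsS [vcons (5/4) _ _ _]vconsS !mxE -vtlE.
  move=> /andP[h1 h2] /andP[h3 h4].
  have r54 : 5 / 4 <= r by rewrite -(@ler_sqr _ _)// ?nnegrE// !expr2 rr; lra.
  by split; lra.
move=> j; have [i ->|->] := unliftP ord0 j; last by rewrite !vcons0; apply/andP; split; lra.
by rewrite !vconsS !mxE; apply/andP; split; lra.
Qed.

Lemma vol_cut_triangle : ((2 * r - 2)%:E <= vol cut_triangle)%E.
Proof.
have r1 : 1 < r by rewrite -(@ltr_sqr _ _)// ?nnegrE// !expr2 rr; lra.
have r2 : r < 2 by rewrite -(@ltr_sqr _ _)// ?nnegrE// !expr2 rr; lra.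
have cont (u w : R) : continuous (fun t => u + w * t).
  by move=> t; apply: cvgD; [exact: cvg_cst|apply: cvgMr; exact: cvg_id].
have h1 := @vol_slab_ge _ _ cut_triangle 0 1 _ _ ltr01 (cont 0 1)
  (is_derive_quad 0 1).
have h2 := @vol_slab_ge _ _ cut_triangle 1 r _ _ r1 (cont 2 (-1))
  (is_derive_quad 2 (-1)).
apply: (@le_trans _ _ (vol (slab 0 r cut_triangle))); last by apply: vol_le => x [].
apply: le_trans (vol_slab_split cut_triangle ler01 (ltW r1)).
apply: le_trans (leeD (h1 _) (h2 _)).
- by rewrite -EFinD lee_fin le_eqVlt; apply/orP; left; apply/eqP; rewrite rr; field.
- move=> t /andP[t0 t1]; split; first lra.
  have -> : 0 + 1 * t = t - 0 by ring.
  apply: vol1_ge => // y /andP[y0 yt]; rewrite /sect/cut_triangle/= vconsK !vcons0.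
  by split; lra.
- move=> t /andP[t0 t1]; split; first lra.
  have -> : 2 + -1 * t = (2 - t) - 0 by ring.
  apply: vol1_ge => //; first lra.
  move=> y /andP[y0 yt]; rewrite /sect/cut_triangle/= vconsK !vcons0.
  by split; lra.
Qed.

(** A frame with no rows reflects each section in a point, [y |-> 2 (a t + b) - y]. Every edge
    inequality holds for [y] and for its preimage [z]; pairing them edge by edge gives the three
    linear bounds of [tent_area]. *)
Lemma cut_triangle_shearA (W : 'M[R]_(0, 1)) a b :
  (vol (cut_triangle `&` shearA W a b @` cut_triangle) <= (2 / 3)%:E)%E.
Proof.
set E := _ `&` _.
have Es t y : sect E t y -> [/\ 0 <= y 0 0, y 0 0 <= t, y 0 0 <= 2 - t &
    exists z : R, [/\ 0 <= z, z <= t, z <= 2 - t & y 0 0 = 2 * b 0 0 + 2 * a 0 0 * t - z]].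
  move=> /sect_shearA[]; rewrite {1}/sect/cut_triangle/= vcons0 vconsK.
  move=> [y0 y1 y2 y3] [z]; rewrite /sect/= vcons0 vconsK => -[z0 z1 z2 z3] zy.
  split => //; exists (z 0 0); split => //.
  rewrite -zy /refl_flat [W^T]thinmx0 mul0mx mulmx0 scaler0 addr0 !mxE.
  by ring.
have bnd u w t : (forall y, sect E t y -> u <= y 0 0 <= w) ->
    (vol (sect E t) <= (Num.max (w - u) 0)%:E)%E by exact: vol1_le.
apply: (@tent_area _ (2 * b 0 0) (2 * a 0 0)).
- by apply: compact_cap_shearA; exact: compact_cut_triangle.
- by move=> x [[x0 x1 x2 x3] _]; apply/andP; split; lra.
- move=> t _; rewrite -[_ + _]subr0; apply: bnd => y /Es[y0 y1 y2 [z [z0 z1 z2 zy]]].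
  by apply/andP; split; lra.
- move=> t _.
  have -> : - (2 * b 0 0) + (2 - 2 * a 0 0) * t = t - (2 * b 0 0 + 2 * a 0 0 * t - t) by ring.
  apply: bnd => y /Es[y0 y1 y2 [z [z0 z1 z2 zy]]]; by apply/andP; split; lra.
- move=> t _.
  have -> : 4 - (2 * b 0 0) + - (2 + 2 * a 0 0) * t =
    (2 - t) - (2 * b 0 0 + 2 * a 0 0 * t - (2 - t)) by ring.
  apply: bnd => y /Es[y0 y1 y2 [z [z0 z1 z2 zy]]]; by apply/andP; split; lra.
Qed.

(** The section over [t] has length at most [t], so the overlap has sections of length at most
    [min t (s - t)] over [[d, s - d]]. If [s <= r] the area is at most [s^2 / 4 <= 1 / 2]; otherwise
    it is at most [s^2 / 4 - (s - r)^2], which is largest at [s = 4 r / 3]. *)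
Lemma cut_triangle_shearB (W : 'M[R]_(1, 1)) s u q : orthonormal_frame W ->
  (vol (cut_triangle `&` shearB W s u q @` cut_triangle) <= (2 / 3)%:E)%E.
Proof.
move=> WW; set E := _ `&` _.
have cE : compact E by apply: compact_cap_shearB; exact: compact_cut_triangle.
have Ers x : E x -> 0 <= x 0 0 <= r /\ 0 <= s - x 0 0 <= r.
  move=> Ex; have [z [z0 z1 z2 z3] <-] := shearB_range Ex.
  by case: Ex => -[x0 x1 x2 x3] _; split; apply/andP; split; lra.
have sC t : (vol (sect cut_triangle t) <= (Num.max t 0)%:E)%E.
  rewrite -[t in Num.max t]subr0; apply: vol1_le => y.
  by rewrite /sect/cut_triangle/= vcons0 vconsK => -[y0 y1 y2 y3]; rewrite y0.
have E1 t : (vol (sect E t) <= (Num.max (0 + 1 * t) 0)%:E)%E.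
  by rewrite add0r mul1r; apply: le_trans (sC t); have [] := vol_sect_shearB s u q cut_triangle t WW.
have E2 t : (vol (sect E t) <= (Num.max (s + -1 * t) 0)%:E)%E.
  by rewrite mulN1r; apply: le_trans (sC _); have [] := vol_sect_shearB s u q cut_triangle t WW.
have [->|/set0P[x0 Ex0]] := eqVneq E set0; first by rewrite vol_set0 lee_fin; lra.
have [/andP[x00 x01] /andP[s0 s1]] := Ers _ Ex0.
pose d := Num.max 0 (s - r).
have d0 : 0 <= d by rewrite le_max lexx.
have ds : d <= s / 2 by rewrite ge_max; apply/andP; split; lra.
have h1 : (vol (slab d (s / 2) E) <= ((s / 2 - d) * (0 + 1 * (d + s / 2) / 2))%:E)%E.
  by apply: (@trapezoid_pos _ _ d (s / 2)) => //; lra.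
have h2 : (vol (slab (s / 2) (s - d) E) <=
    ((s - d - s / 2) * (s + -1 * (s / 2 + (s - d)) / 2))%:E)%E.
  by apply: (@trapezoid_pos _ _ (s / 2) (s - d)) => //; lra.
apply: (@le_trans _ _ (vol (slab d (s - d) E))).
  apply: vol_le => x Ex; split => //=; have [/andP[h3 h4] /andP[h5 h6]] := Ers _ Ex.
  rewrite ge_max h3/= lerBrDl -lerBrDr ge_max h5/=.
  by apply/andP; split; lra.
have ds' : s / 2 <= s - d by lra.
apply: le_trans (slab_cat ds ds' h1 h2) _; rewrite lee_fin.
have [h|h] := leP s r.
  have -> : d = 0 by rewrite /d max_l//; lra.
  have ss : s * s <= r * r by rewrite ler_pM//; lra.
  rewrite rr in ss; have -> : (s / 2 - 0) * (0 + 1 * (0 + s / 2) / 2) +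
    (s - 0 - s / 2) * (s + -1 * (s / 2 + (s - 0)) / 2) = s * s / 4 by field.
  by lra.
have -> : d = s - r by rewrite /d max_r//; lra.
rewrite -subr_ge0; set X := (X in 0 <= X).
have -> : X = 3 / 4 * (s - 4 / 3 * r) ^+ 2 + 2 / 3 * (2 - r * r) / 2 by rewrite /X; field.
by rewrite rr subrr mulr0 mul0r addr0 mulr_ge0// sqr_ge0.
Qed.

Theorem sigma_2_1_le : (sigma R 2 1 <= ((Num.sqrt 2 + 1) / 3)%:E)%E.
Proof.
have r1 : 1 < r by rewrite -(@ltr_sqr _ _)// ?nnegrE// !expr2 rr; lra.
have -> : (r + 1) / 3 = 2 / 3 / (2 * r - 2).
  have -> : 2 / 3 / (2 * r - 2) = (r * r - 1) / 3 / (r - 1).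
    by rewrite rr; field; rewrite subr_eq0 gt_eqF//=; apply/eqP; lra.
  by field; rewrite subr_eq0 gt_eqF.
apply: (sigma_thin convex_body_cut_triangle _ _ vol_cut_triangle).
- by rewrite divr_ge0.
- by lra.
- by move=> W a b _; exact: cut_triangle_shearA.
- by move=> W s u q; exact: cut_triangle_shearB.
Qed.

End PlanarUpper.

(** * Symmetry of planar bodies *)

Section PlaneTrig.
Variable R : realType.

(** Tripling the angle gives [(c + 1) (2 c - 1)^2 = 0] for the cosine [c], which is positive. *)
Lemma cos_pi3 : cos (pi / 3) = 2^-1 :> R.
Proof.
have p0 := pi_gt0 R.
have c0 : 0 < cos (pi / 3 : R) by apply: cos_gt0_pihalf; apply/andP; split; lra.
have : cos (pi / 3 + (pi / 3 + pi / 3)) = -1 :> R by rewrite -cospi; congr cos; field.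
have := cos2Dsin2 (pi / 3 : R); rewrite 2!cosD sinD.
move: (cos _) (sin _) c0 => c s c0 cs h.
have : (c + 1) * (2 * c - 1) ^+ 2 = 0.
  have s2 : s ^+ 2 = 1 - c ^+ 2 by rewrite -cs addrC addKr.
  transitivity (c * (c * c - s * s) - s * (s * c + c * s) + 1 + 3 * c * (s ^+ 2 - (1 - c ^+ 2))).
    by ring.
  by rewrite h s2; ring.
move/eqP; rewrite mulf_eq0 sqrf_eq0 gt_eqF ?addr_gt0//= subr_eq0 => /eqP h2.
by rewrite -[c](@mulKf _ 2)// h2 mulr1.
Qed.

Lemma sin_pi3_gt0 : 0 < sin (pi / 3) :> R.
Proof. have p0 := pi_gt0 R; apply: sin_gt0_pi; apply/andP; split; lra. Qed.

Lemma sqr_sin_pi3 : sin (pi / 3) ^+ 2 = 3 / 4 :> R.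
Proof. by rewrite sin2cos2 cos_pi3; field. Qed.

(* The chord of the convex function [tan] on [0, pi / 3] lies above its graph. *)
Lemma sin_le_chord (g : R) : 0 <= g <= pi / 3 ->
  sin g <= 6 * sin (pi / 3) / pi * (g * cos g).
Proof.
have p0 := pi_gt0 R; have q0 := sin_pi3_gt0.
have q2 := sqr_sin_pi3.
set c := 6 * _ / pi => /andP[g0 g3].
have c1 : 1 < c.
  rewrite /c ltr_pdivlMr// mul1r.
  have pi4 : pi < 4 :> R by have := pihalf_lt2 R; rewrite ltr_pdivrMr//; lra.
  by apply: lt_le_trans pi4 _; nra.
pose h x := c * (x * cos x) - sin x.
pose h' x := c * (cos x - x * sin x) - cos x.
have dh (x : R) : is_derive x 1 h (h' x).
  have h1 : is_derive x 1 (c \*: ((@id R) * (@cos R)) - @sin R) (h' x).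
    apply: is_derive_eq; rewrite /h' /GRing.scale/=; ring.
  exact: h1.
have ch a b : {within `[a, b], continuous h}.
  apply: continuous_subspaceT => x; apply: differentiable_continuous.
  by apply/derivable1_diffP; have := dh x; case.
have h0 : h 0 = 0 by rewrite /h mul0r mulr0 sin0 subr0.
have h3 : h (pi / 3) = 0.
  rewrite /h cos_pi3 /c; move: (sin _) => q.
  have pn0 : pi != 0 :> R by rewrite gt_eqF.
  by move: (pi : R) pn0 => p pn0; field.
have h'_dec x y : 0 <= x -> x <= y -> y <= pi / 3 -> h' y <= h' x.
  move=> x0 xy y3.
  have cc : cos y <= cos x.
    have [->//|nxy] := eqVneq x y.
    rewrite ltW// ltr_cos ?in_itv/=; [by rewrite lt_neqAle nxy| |]; apply/andP; split; lra.
  have ss : sin x <= sin y.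
    have [->//|nxy] := eqVneq x y.
    rewrite ltW// ltr_sin ?in_itv/=; [by rewrite lt_neqAle nxy| |]; apply/andP; split; lra.
  have s0 : 0 <= sin x by apply: sin_ge0_pi; apply/andP; split; lra.
  have xs : x * sin x <= y * sin y by rewrite ler_pM.
  have := ler_wpM2l (ltW (lt_trans ltr01 c1)) xs.
  have : (c - 1) * cos y <= (c - 1) * cos x by rewrite ler_wpM2l// subr_ge0 ltW.
  by rewrite /h' => ? ?; lra.
(* [h] vanishes at both ends of the interval; a negative value at [g] would force a negative slope
   before [g] and a positive one after it, against [h'_dec]. *)
rewrite -subr_ge0 -/(h g) leNgt; apply/negP => hg.
have g_gt0 : 0 < g.
  by rewrite lt_neqAle g0 andbT; apply/eqP => g00; move: hg; rewrite -g00 h0 ltxx.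
have g_lt3 : g < pi / 3.
  by rewrite lt_neqAle g3 andbT; apply/eqP => g33; move: hg; rewrite g33 h3 ltxx.
have [x xg hx] := MVT g_gt0 (fun x _ => dh x) (ch _ _).
have [y yg hy] := MVT g_lt3 (fun x _ => dh x) (ch _ _).
move: xg yg; rewrite !in_itv/= => /andP[x0 x1] /andP[y0 y1].
have := h'_dec x y (ltW x0) (ltW (lt_trans x1 y0)) (ltW y1).
rewrite h0 in hx; rewrite h3 in hy.
have hx' : h' x < 0 by nra.
have hy' : 0 < h' y by nra.
by lra.
Qed.

Lemma polar (x y : R) :
  exists r t, [/\ 0 <= r, - pi <= t <= pi, x = r * cos t & y = r * sin t].
Proof.
have p0 := pi_gt0 R.
pose r := Num.sqrt (x ^+ 2 + y ^+ 2).
have xy0 : 0 <= x ^+ 2 + y ^+ 2 by rewrite addr_ge0 ?sqr_ge0.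
have r0 : 0 <= r by exact: sqrtr_ge0.
have rr : r ^+ 2 = x ^+ 2 + y ^+ 2 by rewrite sqr_sqrtr.
clearbody r.
have [r00|rn0] := eqVneq r 0.
  exists 0, 0; rewrite !mul0r lexx; move/eqP: rr; rewrite r00 expr0n/= eq_sym.
  rewrite paddr_eq0 ?sqr_ge0// !sqrf_eq0 => /andP[/eqP -> /eqP ->].
  by split => //; apply/andP; split; lra.
have r_gt0 : 0 < r by rewrite lt_neqAle eq_sym rn0.
have c1 : -1 <= x / r <= 1.
  rewrite -ler_norml normrM normfV (ger0_norm r0) ler_pdivrMr// mul1r.
  by rewrite -(@ler_pXn2r _ 2) ?nnegrE ?normr_ge0// -normrX ger0_norm ?sqr_ge0// rr lerDl sqr_ge0.
have xE : x = r * cos (acos (x / r)) by rewrite acosK ?in_itv//= mulrC divfK.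
have yE : r * sin (acos (x / r)) = `|y|.
  apply/eqP; rewrite sin_acos// -(@eqrXn2 _ 2)//; last by rewrite mulr_ge0 ?sqrtr_ge0.
  rewrite exprMn sqr_sqrtr; last first.
    by move: (x / r) c1 => c /andP[c1 c2]; rewrite expr2; nra.
  by rewrite real_normK ?num_real// expr_div_n mulrBr mulr1 mulrCA divff ?expf_neq0// mulr1 rr addrC addKr.
have a0 := acos_ge0 c1; have api := acos_lepi c1.
have [y0|y0] := leP 0 y.
  exists r, (acos (x / r)); split => //; first by apply/andP; split; lra.
  by rewrite yE ger0_norm.
exists r, (- acos (x / r)); split => //; [by apply/andP; split; lra|by rewrite cosN|].
by rewrite sinN mulrN yE ltr0_norm// opprK.
Qed.

Definition vec2 (a b : R) : 'rV[R]_2 := vcons a (const_mx b).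
Definition dir2 (t : R) := vec2 (cos t) (sin t).
Definition dot2 (x u : 'rV[R]_2) := x 0 0 * u 0 0 + vtl x 0 0 * vtl u 0 0.
Definition mat2 (a b c e : R) : 'M[R]_2 :=
  \matrix_(i, j) if i == 0 then if j == 0 then a else b else if j == 0 then c else e.

Lemma vec20 a b : vec2 a b 0 0 = a. Proof. exact: vcons0. Qed.
Lemma vec21 a b : vtl (vec2 a b) 0 0 = b. Proof. by rewrite vconsK mxE. Qed.
Lemma vec2E (x : 'rV[R]_2) : vec2 (x 0 0) (vtl x 0 0) = x.
Proof.
rewrite -[RHS]vcons_vtl; congr vcons; apply/rowP => j; by rewrite !mxE ord1.
Qed.
Lemma vec2_eq (x y : 'rV[R]_2) : x 0 0 = y 0 0 -> vtl x 0 0 = vtl y 0 0 -> x = y.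
Proof. by move=> h1 h2; rewrite -[x]vec2E -[y]vec2E h1 h2. Qed.

Lemma mulmx2 (x : 'rV[R]_2) (A : 'M[R]_2) j :
  (x *m A) 0 j = x 0 0 * A 0 j + vtl x 0 0 * A (lift ord0 0) j.
Proof. by rewrite mxE !big_ord_recl big_ord0 addr0 vtlE. Qed.

Lemma mat2E a b c d : [/\ mat2 a b c d 0 0 = a, mat2 a b c d 0 (lift ord0 0) = b,
  mat2 a b c d (lift ord0 0) 0 = c & mat2 a b c d (lift ord0 0) (lift ord0 0) = d].
Proof.
by rewrite /mat2 !mxE.
Qed.

Lemma mul_mat2 (x : 'rV[R]_2) a b c d :
  x *m mat2 a b c d = vec2 (x 0 0 * a + vtl x 0 0 * c) (x 0 0 * b + vtl x 0 0 * d).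
Proof.
have [h1 h2 h3 h4] := mat2E a b c d.
by apply: vec2_eq; rewrite ?vec20 ?vec21 ?[in LHS]vtlE mulmx2 ?h1 ?h2 ?h3 ?h4.
Qed.

Lemma det2 (A : 'M[R]_2) :
  \det A = A 0 0 * A (lift ord0 0) (lift ord0 0) - A 0 (lift ord0 0) * A (lift ord0 0) 0.
Proof.
rewrite (expand_det_row A 0) !big_ord_recl big_ord0 addr0 /cofactor !det_mx11 !mxE /=.
rewrite expr0 expr1 mul1r mulN1r mulrN; congr (_ * A _ _ - _ * A _ _); exact: val_inj.
Qed.

Lemma mat2_orthogonal (t e : R) : e ^+ 2 = 1 ->
  mat2 (cos t) (sin t) (- e * sin t) (e * cos t) *m
    (mat2 (cos t) (sin t) (- e * sin t) (e * cos t))^T = 1%:M.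
Proof.
move=> ee; apply/matrixP => i j; rewrite !mxE !big_ord_recl big_ord0 !mxE/= addr0.
have cs := cos2Dsin2 t.
have [i' ->|->] := unliftP ord0 i; have [j' ->|->] := unliftP ord0 j => /=.
- transitivity (e ^+ 2 * (cos t ^+ 2 + sin t ^+ 2)); first by ring.
  by rewrite cs ee !ord1 eqxx mulr1.
- by ring.
- by ring.
- by rewrite -cs; ring.
Qed.

Lemma dir2Z0 (r s : R) : (r *: dir2 s) 0 0 = r * cos s.
Proof. by rewrite mxE vec20. Qed.
Lemma dir2Z1 (r s : R) : vtl (r *: dir2 s) 0 0 = r * sin s.
Proof. by rewrite vtlZ mxE vec21. Qed.

Lemma dir2Z_dot (r s t : R) : dot2 (r *: dir2 s) (dir2 t) = r * cos (s - t).
Proof. by rewrite /dot2 dir2Z0 dir2Z1 vec20 vec21 cosB; ring. Qed.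

Lemma vol_right_triangle (w : R) : 0 <= w ->
  (vol [set x : 'rV[R]_2 | (0 <= x 0 0 <= 1 /\ 0 <= vtl x 0 0 <= w * x 0 0)%R]
    <= (w / 2)%:E)%E.
Proof.
move=> w0; set T := [set x | _].
have cT : compact T.
  apply: (@subclosed_compact _ _ (box (const_mx 0) (vec2 1 w))).
  - have -> : T =
      [set x : 'rV[R]_2 | 0 * x 0 0 + (-1) * x 0 (lift ord0 0) <= 0] `&`
      [set x : 'rV[R]_2 | (- w) * x 0 0 + 1 * x 0 (lift ord0 0) <= 0] `&`
      [set x : 'rV[R]_2 | 1 * x 0 0 + 0 * x 0 (lift ord0 0) <= 1] `&`
      [set x : 'rV[R]_2 | (-1) * x 0 0 + 0 * x 0 (lift ord0 0) <= 0].
      apply/seteqP; split => x; rewrite /T/= vtlE.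
        by move=> [/andP[h1 h2] /andP[h3 h4]]; do !split; lra.
      by move=> [[[h1 h2] h3] h4]; split; apply/andP; split; lra.
    by do !apply: closedI; exact: coord_closed_le.
  - exact: box_compact.
  - move=> x [/andP[h1 h2] /andP[h3 h4]]; apply/boxE; rewrite vec20 !mxE h1 h2; split => // j.
    rewrite ord1 vec21 [vtl (const_mx _) _ _]vtlE mxE h3/=.
    by apply: le_trans h4 _; rewrite -[leRHS]mulr1 ler_wpM2l.
have -> : w / 2 = (0 * 1 + w * (1 * 1 / 2)) - (0 * 0 + w * (0 * 0 / 2)) by field.
apply: (@le_trans _ _ (vol (slab 0 1 T))).
  by apply: vol_le => x Tx; split => //; case: Tx.
apply: (@vol_slab_le _ _ _ _ _ (fun t => 0 * t + w * (t * t / 2))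
  (fun t => 0 + w * t) ltr01 cT) => t t01; split; last exact: is_derive_quad.
have wt : 0 <= w * t - 0 by rewrite subr0 mulr_ge0//; case/andP: t01.
rewrite add0r -[w * t]subr0 -(max_l wt); apply: vol1_le => y.
by rewrite /sect/T/= vcons0 vconsK => -[].
Qed.

(** Half the slope of the chord of [tan]: an area bound per unit of angle. Over a full turn it gives
    [6 sin (pi / 3) = 3 sqrt 3], the area of the equilateral triangle circumscribed about the unit
    disc. *)
Let c : R := 3 * sin (pi / 3) / pi.

(** In coordinates turned to the direction [t], and mirrored if [e = -1], the tangent at [t] cuts
    the sector down to a right triangle with leg 1 and angle [g], of area [tan g / 2 <= c * g]. *)
Lemma vol_half_sector (X : set 'rV[R]_2) (t g e : R) : e = 1 \/ e = -1 ->
  0 <= g <= pi / 3 ->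
  (forall x, X x -> exists r s, [/\ 0 <= r, 0 <= s <= g, r * cos s <= 1 &
    x = r *: dir2 (t + e * s)]) ->
  (vol X <= (c * g)%:E)%E.
Proof.
move=> e1 g03 HX; have /andP[g0 g3] := g03.
have p0 := pi_gt0 R.
have cosg : 0 < cos g by apply: cos_gt0_pihalf; apply/andP; split; lra.
have sing : 0 <= sin g by apply: sin_ge0_pi; apply/andP; split; lra.
have ee : e ^+ 2 = 1 by case: e1 => ->; rewrite ?sqrrN expr1n.
pose w := sin g / cos g.
have w0 : 0 <= w by rewrite divr_ge0// ltW.
apply: (@le_trans _ _ (w / 2)%:E); last first.
  rewrite lee_fin /w ler_pdivrMr// ler_pdivrMr//.
  apply: le_trans (sin_le_chord g03) _; rewrite le_eqVlt; apply/orP; left; apply/eqP.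
  have pn0 : pi != 0 :> R by rewrite gt_eqF.
  have aux (q p k h : R) : p != 0 -> 6 * q / p * (h * k) = 3 * q / p * h * 2 * k.
    by move=> ?; field.
  exact: aux.
apply: le_trans (vol_right_triangle w0).
rewrite -[leRHS](vol_orthogonal 0 _ (mat2_orthogonal t ee)).
apply: vol_le => x /HX[r [s [r0 /andP[s0 sg] rc ->]]].
have coss : 0 <= cos s by apply: cos_ge0_pihalf; apply/andP; split; lra.
have sins : 0 <= sin s by apply: sin_ge0_pi; apply/andP; split; lra.
have sgs : 0 <= sin (g - s) by apply: sin_ge0_pi; apply/andP; split; lra.
exists (vec2 (r * cos s) (r * sin s)).
  rewrite /= vec20 vec21 rc !mulr_ge0//=; split => //.
  rewrite /w mulrAC ler_pdivlMr// mulrCA -mulrA ler_wpM2l// mulrC.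
  by rewrite -subr_ge0 -sinB.
rewrite addr0 mul_mat2 vec20 vec21; apply: vec2_eq; rewrite ?vec20 ?vec21 ?dir2Z0 ?dir2Z1.
  by rewrite cosD; case: e1 => ->; rewrite ?mulN1r ?mul1r ?cosN ?sinN; ring.
by rewrite sinD; case: e1 => ->; rewrite ?mulN1r ?mul1r ?cosN ?sinN; ring.
Qed.

Definition sector (t1 t2 : R) : set 'rV[R]_2 :=
  [set x | exists r s, [/\ 0 <= r, t1 <= s <= t2 & x = r *: dir2 s]].

Definition supported (K : set 'rV[R]_2) (t : R) :=
  forall x, K x -> dot2 x (dir2 t) <= 1.

(** The sector is halved, and each half is bounded by the tangent at its own end; the half angle is
    then in the range of the chord estimate. *)
Lemma vol_sector K (t1 t2 : R) : t1 <= t2 -> t2 - t1 <= 2 * pi / 3 ->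
  supported K t1 -> supported K t2 ->
  (vol (K `&` sector t1 t2) <= (c * (t2 - t1))%:E)%E.
Proof.
move=> t12 t3 h1 h2; pose g := (t2 - t1) / 2.
have g03 : 0 <= g <= pi / 3 by rewrite /g; apply/andP; split; lra.
have -> : c * (t2 - t1) = c * g + c * g by rewrite /g; field.
have hA : (vol (K `&` sector t1 (t1 + g)) <= (c * g)%:E)%E.
  apply: (@vol_half_sector _ t1 g 1) => //; first by left.
  move=> x [Kx [r [s [r0 /andP[s1 s2] xE]]]]; exists r, (s - t1); split => //.
  - by apply/andP; split; lra.
  - by rewrite -dir2Z_dot -xE; exact: h1.
  - by rewrite mul1r subrKC.
have hB : (vol (K `&` sector (t1 + g) t2) <= (c * g)%:E)%E.
  apply: (@vol_half_sector _ t2 g (-1)) => //; first by right.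
  move=> x [Kx [r [s [r0 /andP[s1 s2] xE]]]]; exists r, (t2 - s); split => //.
  - by rewrite /g in s1 *; apply/andP; split; lra.
  - by rewrite -cosN opprB -dir2Z_dot -xE; exact: h2.
  - by rewrite mulN1r subKr.
rewrite EFinD; apply: le_trans (leeD hA hB).
apply: le_trans (vol_setU _ _ _) => //; apply: vol_le => x [Kx [r [s [r0 /andP[s1 s2] xE]]]].
by have [h|h] := leP s (t1 + g); [left|right]; split => //; exists r, s; split => //;
  rewrite ?s1 ?s2 ?h ?(ltW h).
Qed.

(** Rotating by [- t] reduces to [polar]; a negative angle is brought into the window by a full
    turn. *)
Lemma sector_full (t : R) x : sector t (t + 2 * pi) x.
Proof.
have p0 := pi_gt0 R.
pose M := mat2 (cos (- t)) (sin (- t)) (- 1 * sin (- t)) (1 * cos (- t)).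
have [r [s [r0 /andP[s1 s2] h0 h1]]] := polar ((x *m M) 0 0) (vtl (x *m M) 0 0).
have H s' : cos s' = cos s -> sin s' = sin s -> x = r *: dir2 (t + s').
  move=> cs ss; move: h0 h1; rewrite mul_mat2 vec20 vec21 cosN sinN => h0 h1.
  have tt := cos2Dsin2 t.
  apply: vec2_eq; rewrite ?dir2Z0 ?dir2Z1.
    rewrite cosD cs ss mulrBr mulrCA -h0 [r * (_ * _)]mulrCA -h1 -[LHS]mulr1 -{1}tt.
    by ring.
  rewrite sinD cs ss mulrDr mulrCA -h0 [r * (_ * sin s)]mulrCA -h1 -[LHS]mulr1 -{1}tt.
  by ring.
have [s0|s0] := leP 0 s.
  by exists r, (t + s); split; [|apply/andP; split; lra|exact: H].
exists r, (t + (s + pi *+ 2)); split => //; first by rewrite mulr2n; apply/andP; split; lra.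
by apply: H; [exact: cosD2pi|exact: sinD2pi].
Qed.

Definition disc : set 'rV[R]_2 := [set x : 'rV[R]_2 | x 0 0 ^+ 2 + vtl x 0 0 ^+ 2 <= 1].

(** One step of an inscribed polygon: by convexity the disc contains the trapezoid with vertices
    [(a, y)], [(a, -y)], [(b, z)], [(b, -z)], of area [(b - a) (y + z)]. *)
Lemma vol_disc_slab (a b y z A C : R) :
  (A%:E <= vol (slab (-1) a disc))%E -> a < b -> 0 <= y -> 0 <= z ->
  a ^+ 2 + y ^+ 2 <= 1 -> b ^+ 2 + z ^+ 2 <= 1 -> -1 <= a ->
  C <= A + (b - a) * (y + z) -> (C%:E <= vol (slab (-1) b disc))%E.
Proof.
move=> hA ab y0 z0 ay bz a1 CA; apply: (@le_trans _ _ (A + (b - a) * (y + z))%:E) => //.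
apply: le_trans (vol_slab_split disc a1 (ltW ab)); rewrite EFinD; apply: leeD => //.
pose w := (z - y) / (b - a); pose u := y - w * a.
have ba0 : b - a != 0 by rewrite gt_eqF// subr_gt0.
have -> : (b - a) * (y + z) = ((2 * u) * b + (2 * w) * (b * b / 2)) -
    ((2 * u) * a + (2 * w) * (a * a / 2)).
  by rewrite /u /w; field.
apply: (@vol_slab_ge _ _ disc a b (fun t => 2 * u * t + 2 * w * (t * t / 2))
  (fun t => 2 * u + 2 * w * t)) => //.
- by move=> t; apply: cvgD; [exact: cvg_cst|apply: cvgMr; exact: cvg_id].
- by move=> t; exact: is_derive_quad.
move=> t /andP[ta tb]; pose s := (t - a) / (b - a).
have s0 : 0 <= s by rewrite divr_ge0// subr_ge0// ltW.
have s1 : 0 <= 1 - s by rewrite subr_ge0 ler_pdivrMr ?subr_gt0// mul1r lerD2r.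
pose f := (1 - s) * y + s * z.
have tE : t = (1 - s) * a + s * b by rewrite /s; field.
have fE : 2 * u + 2 * w * t = f - (- f).
  by rewrite /f /s /u /w; field.
have f0 : 0 <= f by rewrite addr_ge0// mulr_ge0.
have tf : t ^+ 2 + f ^+ 2 <= 1.
  have ss : 0 <= s * (1 - s) by rewrite mulr_ge0.
  have h1 : (1 - s) * (a ^+ 2 + y ^+ 2) + s * (b ^+ 2 + z ^+ 2) <= (1 - s) * 1 + s * 1.
    by apply: lerD; rewrite ler_wpM2l.
  have h2 : 0 <= s * (1 - s) * ((a - b) ^+ 2 + (y - z) ^+ 2).
    by rewrite mulr_ge0// addr_ge0// sqr_ge0.
  rewrite tE /f -subr_ge0.
  move: h1 h2; rewrite -subr_ge0 => h1 h2; have := addr_ge0 h1 h2.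
  by congr (0 <= _); ring.
rewrite fE; split; first by rewrite opprK addr_ge0.
apply: vol1_ge; first by lra.
move=> v /andP[v1 v2]; rewrite /sect/disc/= vcons0 vconsK vcons0.
apply: le_trans tf; rewrite lerD2l -subr_ge0.
have -> : f ^+ 2 - v ^+ 2 = (f - v) * (v - - f) by ring.
by rewrite mulr_ge0// subr_ge0.
Qed.

(** Twenty trapezoids whose vertices are rational points of the circle, taken from Pythagorean
    triples. The target [3.12] lies just above [3/5 * 3 sqrt 3 = 3.117...], the area needed in
    [Sym_planar_ge]. *)
Lemma vol_disc_ge : ((78 / 25)%:E <= vol disc)%E.
Proof.
have h : (0%:E <= vol (slab (-1) (-1) disc))%E by exact: vol_ge0.
have {}h : ((7 / 2000)%:E <= vol (slab (-1) (-99 / 101) disc))%E.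
  by apply: (@vol_disc_slab (-1) (-99 / 101) 0 (20 / 101) 0 _ h); lra.
have {}h : ((73 / 2000)%:E <= vol (slab (-1) (-12 / 13) disc))%E.
  by apply: (@vol_disc_slab (-99 / 101) (-12 / 13) (20 / 101) (5 / 13) (7 / 2000) _ h); lra.
have {}h : ((237 / 2000)%:E <= vol (slab (-1) (-91 / 109) disc))%E.
  by apply: (@vol_disc_slab (-12 / 13) (-91 / 109) (5 / 13) (60 / 109) (73 / 2000) _ h); lra.
have {}h : ((511 / 2000)%:E <= vol (slab (-1) (-21 / 29) disc))%E.
  by apply: (@vol_disc_slab (-91 / 109) (-21 / 29) (60 / 109) (20 / 29) (237 / 2000) _ h); lra.
have {}h : ((11 / 25)%:E <= vol (slab (-1) (-3 / 5) disc))%E.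
  by apply: (@vol_disc_slab (-21 / 29) (-3 / 5) (20 / 29) (4 / 5) (511 / 2000) _ h); lra.
have {}h : ((263 / 400)%:E <= vol (slab (-1) (-8 / 17) disc))%E.
  by apply: (@vol_disc_slab (-3 / 5) (-8 / 17) (4 / 5) (15 / 17) (11 / 25) _ h); lra.
have {}h : ((891 / 1000)%:E <= vol (slab (-1) (-51 / 149) disc))%E.
  by apply: (@vol_disc_slab (-8 / 17) (-51 / 149) (15 / 17) (140 / 149) (263 / 400) _ h); lra.
have {}h : ((563 / 500)%:E <= vol (slab (-1) (-9 / 41) disc))%E.
  by apply: (@vol_disc_slab (-51 / 149) (-9 / 41) (140 / 149) (40 / 41) (891 / 1000) _ h); lra.
have {}h : ((2703 / 2000)%:E <= vol (slab (-1) (-19 / 181) disc))%E.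
  by apply: (@vol_disc_slab (-9 / 41) (-19 / 181) (40 / 41) (180 / 181) (563 / 500) _ h); lra.
have {}h : ((3121 / 2000)%:E <= vol (slab (-1) 0 disc))%E.
  by apply: (@vol_disc_slab (-19 / 181) 0 (180 / 181) 1 (2703 / 2000) _ h); lra.
have {}h : ((3539 / 2000)%:E <= vol (slab (-1) (19 / 181) disc))%E.
  by apply: (@vol_disc_slab 0 (19 / 181) 1 (180 / 181) (3121 / 2000) _ h); lra.
have {}h : ((399 / 200)%:E <= vol (slab (-1) (9 / 41) disc))%E.
  by apply: (@vol_disc_slab (19 / 181) (9 / 41) (180 / 181) (40 / 41) (3539 / 2000) _ h); lra.
have {}h : ((223 / 100)%:E <= vol (slab (-1) (51 / 149) disc))%E.
  by apply: (@vol_disc_slab (9 / 41) (51 / 149) (40 / 41) (140 / 149) (399 / 200) _ h); lra.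
have {}h : ((4927 / 2000)%:E <= vol (slab (-1) (8 / 17) disc))%E.
  by apply: (@vol_disc_slab (51 / 149) (8 / 17) (140 / 149) (15 / 17) (223 / 100) _ h); lra.
have {}h : ((2681 / 1000)%:E <= vol (slab (-1) (3 / 5) disc))%E.
  by apply: (@vol_disc_slab (8 / 17) (3 / 5) (15 / 17) (4 / 5) (4927 / 2000) _ h); lra.
have {}h : ((5731 / 2000)%:E <= vol (slab (-1) (21 / 29) disc))%E.
  by apply: (@vol_disc_slab (3 / 5) (21 / 29) (4 / 5) (20 / 29) (2681 / 1000) _ h); lra.
have {}h : ((1201 / 400)%:E <= vol (slab (-1) (91 / 109) disc))%E.
  by apply: (@vol_disc_slab (21 / 29) (91 / 109) (20 / 29) (60 / 109) (5731 / 2000) _ h); lra.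
have {}h : ((6169 / 2000)%:E <= vol (slab (-1) (12 / 13) disc))%E.
  by apply: (@vol_disc_slab (91 / 109) (12 / 13) (60 / 109) (5 / 13) (1201 / 400) _ h); lra.
have {}h : ((1247 / 400)%:E <= vol (slab (-1) (99 / 101) disc))%E.
  by apply: (@vol_disc_slab (12 / 13) (99 / 101) (5 / 13) (20 / 101) (6169 / 2000) _ h); lra.
have {}h : ((3121 / 1000)%:E <= vol (slab (-1) 1 disc))%E.
  by apply: (@vol_disc_slab (99 / 101) 1 (20 / 101) 0 (1247 / 400) _ h); lra.
apply: (@le_trans _ _ (vol (slab (-1) 1 disc))); last by apply: vol_le => x [].
by apply: le_trans h; rewrite lee_fin; lra.
Qed.

End PlaneTrig.

(** * Contact directions and the area they allow *)

Section Contact.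
Variable R : realType.
Implicit Types (K : set 'rV[R]_2) (t a : R) (x y u : 'rV[R]_2).

Lemma dir2_dir2 s t : dot2 (dir2 s) (dir2 t) = cos (s - t) :> R.
Proof. by rewrite -[dir2 s]scale1r dir2Z_dot mul1r. Qed.

Lemma dir2_disc t : disc (dir2 t).
Proof. by rewrite /disc/= vec20 vec21 cos2Dsin2. Qed.

Lemma dir2_window (a t : R) : exists s, a <= s <= a + 2 * pi /\ dir2 s = dir2 t :> 'rV[R]_2.
Proof.
have [r [s [r0 sa st]]] := sector_full a (dir2 t).
exists s; split => //; rewrite st; suff -> : r = 1 by rewrite scale1r.
have h0 : cos t = r * cos s by rewrite -dir2Z0 -st vec20.
have h1 : sin t = r * sin s by rewrite -dir2Z1 -st vec21.
have := cos2Dsin2 t; rewrite h0 h1 !exprMn -mulrDr cos2Dsin2 mulr1 => /eqP.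
by rewrite sqrp_eq1// => /eqP.
Qed.

Lemma dot2Bl x y u : dot2 (x - y) u = dot2 x u - dot2 y u.
Proof. by rewrite /dot2 vtlD vtlN !mxE; ring. Qed.

Lemma dot2Dl x y u : dot2 (x + y) u = dot2 x u + dot2 y u.
Proof. by rewrite /dot2 vtlD !mxE; ring. Qed.

Lemma dot2Zl c x u : dot2 (c *: x) u = c * dot2 x u.
Proof. by rewrite /dot2 vtlZ !mxE; ring. Qed.

Lemma dot2C x u : dot2 x u = dot2 u x.
Proof. by rewrite /dot2 mulrC [vtl x _ _ * _]mulrC. Qed.

Lemma dot2_ge0 x : 0 <= dot2 x x.
Proof. by rewrite addr_ge0// -expr2 sqr_ge0. Qed.

Lemma dot2_eq0 x : dot2 x x = 0 -> x = 0.
Proof.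
move=> /eqP; rewrite /dot2 -!expr2 paddr_eq0 ?sqr_ge0// !sqrf_eq0 => /andP[/eqP h0 /eqP h1].
by apply: vec2_eq; rewrite ?h0 ?h1 ?vtlE mxE.
Qed.

(* The separating direction points from the nearest point of [K] to [y]. *)
Lemma separation K y : compact K -> Defs.convex_set K -> K !=set0 -> ~ K y ->
  exists t, forall x, K x -> dot2 x (dir2 t) < dot2 y (dir2 t).
Proof.
move=> cK cvK K0 nKy.
pose f x := dot2 (x - y) (x - y).
have cf : continuous f.
  have h k : continuous (fun x : 'rV[R]_2 => x 0 k) := @coord_continuous R 1 2 0 k.
  have -> : f = fun x => (x 0 0 - y 0 0) * (x 0 0 - y 0 0) +
      (x 0 (lift ord0 0) - y 0 (lift ord0 0)) * (x 0 (lift ord0 0) - y 0 (lift ord0 0)).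
    by apply/funext => x; rewrite /f /dot2 vtlE !mxE.
  have h' k : continuous (fun x : 'rV[R]_2 => x 0 k - y 0 k).
    by move=> x; apply: (continuousB (h k x) (@cst_continuous _ _ (y 0 k) x)).
  move=> x; apply: (continuousD (continuousM (h' _ x) (h' _ x))
    (continuousM (h' _ x) (h' _ x))).
have [p pK pmin] := EVT_min_rV K0 cK (continuous_subspaceT cf).
rewrite inE in pK.
pose w := y - p.
have wK x : K x -> dot2 x w <= dot2 p w.
  move=> Kx; rewrite -subr_le0 -dot2Bl leNgt; apply/negP => xp.
  set A := dot2 (x - p) w in xp; pose B := dot2 (x - p) (x - p).
  have B0 : 0 <= B by exact: dot2_ge0.
  (* Moving from [p] towards [x] by [s] changes the squared distance to [y] by [s (s B - 2 A)]; this
     [s] is at most 1 and keeps [s B <= A], so the change would be negative. *)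
  pose s := A / (A + B).
  have AB : 0 < A + B by lra.
  have s0 : 0 < s by rewrite divr_gt0.
  have s1 : s <= 1 by rewrite ler_pdivrMr// mul1r lerDl.
  have Kz : K (s *: x + (1 - s) *: p) by apply: cvK => //; rewrite (ltW s0).
  have := pmin _ (mem_set Kz); rewrite /f.
  have -> : s *: x + (1 - s) *: p - y = s *: (x - p) - w.
    by rewrite /w scalerBl scale1r scalerBr; apply/rowP => j; rewrite !mxE; ring.
  have -> : p - y = - w by rewrite opprB.
  have -> : dot2 (- w) (- w) = dot2 w w by rewrite /dot2 vtlN !mxE !mulrNN.
  have -> : dot2 (s *: (x - p) - w) (s *: (x - p) - w) =
      s * (s * B - 2 * A) + dot2 w w.
    by rewrite /A /B /dot2 !vtlD !vtlN !vtlZ !vtlD !vtlN !mxE; ring.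
  rewrite lerDr pmulr_rge0// => h.
  have : s * B <= A by rewrite /s mulrAC ler_pdivrMr// ler_wpM2l ?lerDr ?ltW.
  by lra.
have w0 : 0 < dot2 w w.
  rewrite lt_neqAle dot2_ge0 andbT eq_sym; apply/eqP => /dot2_eq0 w00.
  by apply: nKy; have -> : y = p by apply/eqP; rewrite -subr_eq0 -/w w00.
have [r [t [r0 _ h0 h1]]] := polar (w 0 0) (vtl w 0 0).
have wE : w = r *: dir2 t by apply: vec2_eq; rewrite ?dir2Z0 ?dir2Z1.
exists t => x /wK xp.
have : dot2 x w < dot2 y w.
  by apply: le_lt_trans xp _; rewrite -subr_gt0 -dot2Bl.
rewrite wE !(dot2C _ (r *: _)) !dot2Zl !(dot2C (dir2 t)) ltr_pM2l// lt_neqAle r0 andbT.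
by apply/eqP => r00; move: w0; rewrite wE -r00 scale0r /dot2 vtlE !mxE mul0r addr0 ltxx.
Qed.

Lemma dot2_dir2 x t : dot2 x (dir2 t) = x 0 0 * cos t + vtl x 0 0 * sin t.
Proof. by rewrite /dot2 vec20 vec21. Qed.

Lemma dot2_dir2_continuous x : continuous (fun t => dot2 x (dir2 t)).
Proof.
have -> : (fun t => dot2 x (dir2 t)) = (fun t => x 0 0 * cos t + vtl x 0 0 * sin t).
  by apply/funext => t; rewrite dot2_dir2.
by move=> t; apply: cvgD; apply: cvgMr; [exact: continuous_cos|exact: continuous_sin].
Qed.

Lemma supported_closed K : closed [set t | supported K t].
Proof.
have -> : [set t | supported K t] = \bigcap_(x in K) [set t | dot2 x (dir2 t) <= 1] by [].
apply: closed_bigI => x _.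
exact: (continuous_closedP _).1 (@dot2_dir2_continuous x) _ (@closed_le _ 1).
Qed.

Lemma supported_dir2 K s t : dir2 s = dir2 t -> supported K t -> supported K s.
Proof. by move=> st Kt x Kx; rewrite st; exact: Kt. Qed.

Lemma closed_max_itv (S : set R) (a b t : R) : closed S -> S t -> a <= t <= b ->
  exists m, [/\ S m, a <= m <= b & forall s, S s -> a <= s <= b -> s <= m].
Proof.
move=> cS St tab.
have cA : compact (`[a, b]%classic `&` S).
  by apply: compact_closedI => //; exact: segment_compact.
have A0 : (`[a, b]%classic `&` S) !=set0 by exists t; split => //=; rewrite in_itv.
have cid : continuous (@id R) by move=> x; exact: cvg_id.
have [m mA mmax] := compact_EVT_max A0 cA (continuous_subspaceT (cid)).
rewrite inE in mA; case: mA => mab Sm; exists m; split => // s Ss sab.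
by apply: mmax; rewrite inE; split => //=; rewrite in_itv.
Qed.

Lemma closed_min_itv (S : set R) (a b t : R) : closed S -> S t -> a <= t <= b ->
  exists m, [/\ S m, a <= m <= b & forall s, S s -> a <= s <= b -> m <= s].
Proof.
move=> cS St tab.
have cA : compact (`[a, b]%classic `&` S).
  by apply: compact_closedI => //; exact: segment_compact.
have A0 : (`[a, b]%classic `&` S) !=set0 by exists t; split => //=; rewrite in_itv.
have cid : continuous (@id R) by move=> x; exact: cvg_id.
have [m mA mmax] := compact_EVT_min A0 cA (continuous_subspaceT (cid)).
rewrite inE in mA; case: mA => mab Sm; exists m; split => // s Ss sab.
by apply: mmax; rewrite inE; split => //=; rewrite in_itv.
Qed.

(* The first and last contact angles of each third of the circle, starting from a
   contact angle, leave gaps of at most [2 * pi / 3]. *)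
Lemma vol_supported K :
  (forall a, exists t, a - pi / 3 <= t <= a + pi / 3 /\ supported K t) ->
  (vol K <= (6 * sin (pi / 3))%:E)%E.
Proof.
move=> HK; have p0 := pi_gt0 R; pose S := [set t | supported K t].
have cS : closed S by exact: supported_closed.
have [t0 [_ S0]] := HK 0.
pose g : R := 2 * pi / 3.
have S3 : S (t0 + 3 * g).
  apply: (supported_dir2 _ S0); have -> : t0 + 3 * g = t0 + pi *+ 2.
    by rewrite /g mulr2n; field.
  by rewrite /dir2 cosD2pi sinD2pi.
(* The midpoint of a longer gap would have no contact within [pi / 3]. *)
have gap a b : S a -> a <= b -> (forall t, S t -> t <= a \/ b <= t) -> b - a <= g.
  move=> Sa ab nab; rewrite leNgt; apply/negP => gab.
  have [t [/andP[t1 t2] St]] := HK ((a + b) / 2).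
  by have [h|h] := nab t St; rewrite /g in gab; lra.
(* A contact within [pi / 3 = g / 2] of the middle of the second third lies in that third, so its
   first and last contacts [c] and [e] exist. *)
have [t4 [/andP[h41 h42] S4]] := HK (t0 + 3 / 2 * g).
have [a [Sa /andP[a0 a1] amax]] : exists m, [/\ S m, t0 <= m <= t0 + g &
    forall s, S s -> t0 <= s <= t0 + g -> s <= m].
  by apply: closed_max_itv S0 _ => //; rewrite lexx /g; lra.
have t4g : t0 + g <= t4 <= t0 + 2 * g by rewrite /g in h41 h42 *; apply/andP; split; lra.
have [c [Sc /andP[c1 c2] cmin]] := closed_min_itv cS S4 t4g.
have [e [Se /andP[e1 e2] emax]] := closed_max_itv cS S4 t4g.
have [b [Sb /andP[b2 b3] bmin]] : exists m, [/\ S m, t0 + 2 * g <= m <= t0 + 3 * g &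
    forall s, S s -> t0 + 2 * g <= s <= t0 + 3 * g -> m <= s].
  by apply: closed_min_itv S3 _ => //; rewrite lexx andbT /g; lra.
have g0 : 0 < g by rewrite /g; lra.
have ce : c <= e by apply: cmin => //; apply/andP.
have gac : c - a <= g.
  apply: gap => //; first lra.
  move=> t St; have [h|h] := leP t t0; first by left; lra.
  have [h1|h1] := leP t (t0 + g); first by left; apply: amax => //; rewrite (ltW h).
  have [h2|h2] := leP t (t0 + 2 * g); last by right; lra.
  by right; apply: cmin => //; rewrite (ltW h1).
have geb : b - e <= g.
  apply: gap => //; first lra.
  move=> t St; have [h|h] := leP t (t0 + g); first by left; lra.
  have [h1|h1] := leP t (t0 + 2 * g); first by left; apply: emax => //; rewrite (ltW h).
  have [h2|h2] := leP t (t0 + 3 * g); last by right; lra.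
  by right; apply: bmin => //; rewrite (ltW h1).
have V s1 s2 : S s1 -> S s2 -> s1 <= s2 -> s2 - s1 <= g ->
    (vol (K `&` sector s1 s2) <= (3 * sin (pi / 3) / pi * (s2 - s1))%:E)%E.
  by move=> Ss1 Ss2 s12 gs; exact: vol_sector.
have J s1 s2 s3 : s1 <= s2 -> s2 <= s3 ->
    (vol (K `&` sector s1 s2) <= (3 * sin (pi / 3) / pi * (s2 - s1))%:E)%E ->
    (vol (K `&` sector s2 s3) <= (3 * sin (pi / 3) / pi * (s3 - s2))%:E)%E ->
    (vol (K `&` sector s1 s3) <= (3 * sin (pi / 3) / pi * (s3 - s1))%:E)%E.
  move=> s12 s23 h1 h2.
  have -> : s3 - s1 = (s2 - s1) + (s3 - s2) by ring.
  rewrite mulrDr EFinD; apply: le_trans (leeD h1 h2).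
  apply: le_trans (vol_setU _ _ _) => //; apply: vol_le => x [Kx [r [s [r0 /andP[j1 j2] xE]]]].
  by have [h|h] := leP s s2; [left|right]; split => //; exists r, s; split => //;
    rewrite ?j1 ?j2 ?h ?(ltW h).
have h5 : (vol (K `&` sector b (t0 + 3 * g)) <=
    (3 * sin (pi / 3) / pi * (t0 + 3 * g - b))%:E)%E by apply: V => //; lra.
have h4 := J _ _ _ (le_trans e2 b2) b3 (V _ _ Se Sb (le_trans e2 b2) geb) h5.
have eT : e <= t0 + 3 * g by lra.
have ec : e - c <= g by lra.
have h3 := J _ _ _ ce eT (V _ _ Sc Se ce ec) h4.
have ac : a <= c by lra.
have cT : c <= t0 + 3 * g by lra.
have h2 := J _ _ _ ac cT (V _ _ Sa Sc ac gac) h3.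
have aT : a <= t0 + 3 * g by lra.
have a0' : a - t0 <= g by lra.
have h1 := J _ _ _ a0 aT (V _ _ S0 Sa a0 a0') h2.
apply: (@le_trans _ _ (vol (K `&` sector t0 (t0 + 3 * g)))).
  apply: vol_le => x Kx; split => //; have -> : t0 + 3 * g = t0 + 2 * pi by rewrite /g; field.
  exact: sector_full.
apply: le_trans h1 _; rewrite lee_fin le_eqVlt; apply/orP; left; apply/eqP.
have aux (q p : R) : p != 0 -> 3 * q / p * (t0 + 3 * (2 * p / 3) - t0) = 6 * q.
  by move=> ?; field.
by apply: aux; rewrite gt_eqF.
Qed.

End Contact.

(** * The inscribed ellipse of maximal area *)

Section Ellipse.
Variable R : realType.
Implicit Types (K : set 'rV[R]_2) (t a : R) (x y u : 'rV[R]_2).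

Definition inscribed K (B : 'M[R]_2) (q : 'rV[R]_2) := forall u, disc u -> K (u *m B + q).

(* An ellipse slightly longer and thinner than the disc, shifted along [dir2 a]; its
   support function exceeds [1] only at directions [t] with [1 / 2 - k < cos (t - a)]. *)
Lemma near_contact K a (k : R) : compact K -> Defs.convex_set K -> @disc R `<=` K ->
  (forall B q, inscribed K B q -> `|\det B| <= 1) -> 0 < k <= 4^-1 ->
  exists t, 2^-1 - k <= cos (t - a) /\ forall x, K x -> dot2 x (dir2 t) <= 1 + k.
Proof.
move=> cK cvK dK maxK /andP[k0 k4].
(* With [s = cos (t - a)], the parameters solve [(1 - be s)^2 - (al^2 s^2 + b^2 (1 - s^2)) = k (s +
   1) (c - s)]: taking [al = 1 + be] keeps the ellipse tangent to the disc at [- dir2 a], and [be],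
   [b] place the other root at [c = 1/2 - k]. *)
pose be := k * (2^-1 + k) / 2; pose al := 1 + be.
pose c := 2^-1 - k; pose b := Num.sqrt (1 - k * c).
have be0 : 0 < be by rewrite divr_gt0// mulr_gt0//; lra.
have c0 : 0 < c by rewrite /c; lra.
have kc0 : 0 <= 1 - k * c by rewrite /c; nra.
have b0 : 0 <= b by exact: sqrtr_ge0.
have bb : b ^+ 2 = 1 - k * c by rewrite sqr_sqrtr.
pose B := mat2 (al * cos a) (al * sin a) (- (b * sin a)) (b * cos a).
have dB : \det B = al * b.
  have [h1 h2 h3 h4] := mat2E (al * cos a) (al * sin a) (- (b * sin a)) (b * cos a).
  rewrite det2 h1 h2 h3 h4; transitivity (al * b * (cos a ^+ 2 + sin a ^+ 2)); first by ring.
  by rewrite cos2Dsin2 mulr1.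
have [u [du nK]] : exists u, disc u /\ ~ K (u *m B + be *: dir2 a).
  apply: contrapT => H; have : inscribed K B (be *: dir2 a).
    by move=> u du; apply: contrapT => nK; apply: H; exists u.
  move/maxK; rewrite dB ger0_norm; last by rewrite mulr_ge0// addr_ge0// ltW.
  rewrite -(@ler_sqr _ (al * b)) ?nnegrE//; last by rewrite mulr_ge0// addr_ge0// ltW.
  rewrite expr1n exprMn bb; apply/negP; rewrite -ltNge -subr_gt0.
  (* The terms of order [k] cancel, [2 be] against [k c]; the gain in area is of order [k^2]. *)
  have -> : al ^+ 2 * (1 - k * c) - 1 =
    k ^+ 2 * (29 / 16 + 7 / 32 * k + 19 / 16 * k ^+ 2 + k ^+ 3 / 8 + k ^+ 4 / 4).
    by rewrite /al /be /c; field.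
  apply: mulr_gt0; first by rewrite exprn_gt0.
  have h2 : 0 <= k ^+ 2 by rewrite exprn_ge0// ltW.
  have h3 : 0 <= k ^+ 3 by rewrite exprn_ge0// ltW.
  have h4 : 0 <= k ^+ 4 by rewrite exprn_ge0// ltW.
  by lra.
have [t sep] := separation cK cvK (ex_intro _ _ (dK _ (dir2_disc a))) nK.
exists t.
set s := cos (t - a); pose w := sin (t - a).
have sw : s ^+ 2 + w ^+ 2 = 1 by exact: cos2Dsin2.
pose P := al * u 0 0 * s + b * vtl u 0 0 * w.
have yE : dot2 (u *m B + be *: dir2 a) (dir2 t) = P + be * s.
  rewrite dot2Dl dot2Zl dir2_dir2 -[a - t]opprB cosN -/s; congr (_ + _).
  by rewrite dot2_dir2 mul_mat2 vec20 vec21 /P /s /w cosB sinB; ring.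
rewrite yE in sep.
(* Cauchy-Schwarz: the right side is the squared support function of the centred ellipse in
   direction [t]. *)
have PP : P ^+ 2 <= al ^+ 2 * s ^+ 2 + b ^+ 2 * w ^+ 2.
  pose N := al ^+ 2 * s ^+ 2 + b ^+ 2 * w ^+ 2.
  have N0 : 0 <= N by rewrite addr_ge0// mulr_ge0// sqr_ge0.
  apply: (@le_trans _ _ (N * (u 0 0 ^+ 2 + vtl u 0 0 ^+ 2))).
    rewrite -subr_ge0; have -> : N * (u 0 0 ^+ 2 + vtl u 0 0 ^+ 2) - P ^+ 2 =
      (al * s * vtl u 0 0 - b * w * u 0 0) ^+ 2 by rewrite /N /P; ring.
    exact: sqr_ge0.
  by rewrite -[leRHS]mulr1 ler_wpM2l.
have s1 : -1 <= s <= 1 by rewrite cos_geN1 cos_le1.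
case/andP: s1 => sN1 s1.
have one : 1 < P + be * s.
  by have := sep _ (dK _ (dir2_disc t)); rewrite dir2_dir2 subrr cos0.
have be4 : be <= 1 / 8 by rewrite /be; nra.
split.
  rewrite leNgt; apply/negP => sc.
  have bs : 0 <= 1 - be * s by nra.
  suff : P <= 1 - be * s by lra.
  apply: le_trans (ler_norm _) _; rewrite -ler_sqr ?nnegrE// real_normK ?num_real//.
  apply: le_trans PP _; rewrite bb -subr_ge0.
  have -> : w ^+ 2 = 1 - s ^+ 2 by rewrite -sw addrAC subrr add0r.
  have -> : (1 - be * s) ^+ 2 - (al ^+ 2 * s ^+ 2 + (1 - k * c) * (1 - s ^+ 2)) =
     k * ((s + 1) * (c - s)) by rewrite /al /be /c; field.
  by apply: mulr_ge0; [exact: ltW|apply: mulr_ge0; rewrite /c; lra].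
move=> x /sep/ltW/le_trans; apply.
have Pal : P <= al.
  have al0 : 0 <= al by rewrite /al; lra.
  apply: le_trans (ler_norm _) _; rewrite -ler_sqr ?nnegrE// real_normK ?num_real//.
  apply: le_trans PP _; rewrite -[leRHS]mulr1 -sw mulrDr lerD2l ler_wpM2r ?sqr_ge0//.
  by rewrite bb /al; have := mulr_gt0 k0 c0; nra.
have : be * s <= be * 1 by rewrite ler_wpM2l// ltW.
have : be <= k / 2 by rewrite /be; nra.
by rewrite /al in Pal; lra.
Qed.

(** A limit of near contacts with [k = 1 / (m + 4)], the shift keeping [k <= 1/4]. The angles are
    first moved into [[a - pi, a + pi]], where [cos (t - a) >= 1/2] means [|t - a| <= pi / 3]. *)
Lemma contact K a : compact K -> Defs.convex_set K -> @disc R `<=` K ->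
  (forall B q, inscribed K B q -> `|\det B| <= 1) ->
  exists t, a - pi / 3 <= t <= a + pi / 3 /\ supported K t.
Proof.
move=> cK cvK dK maxK; have p0 := pi_gt0 R.
have H (m : nat) : exists t : R, (`[a - pi, a + pi]%classic) t /\
    (2^-1 - m.+4%:R^-1 <= cos (t - a) /\
    forall x, K x -> dot2 x (dir2 t) <= 1 + m.+4%:R^-1).
  have k4 : 0 < (m.+4%:R^-1 : R) <= 4^-1.
    by rewrite invr_gt0 ltr0n/= lef_pV2 ?posrE// ler_nat.
  have [t [t1 t2]] := near_contact a cK cvK dK maxK k4.
  have [s [sa st]] := dir2_window (a - pi) t.
  exists s; split.
    by rewrite /= in_itv/=; move: sa => /andP[? ?]; apply/andP; split; lra.
  by rewrite -dir2_dir2 st dir2_dir2; split.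
have [f fP] := choice H.
have [F [FU ooF]] := ultraFilterLemma eventually_filter.
have PF : ProperFilter F by exact: ultra_proper.
have [t tab ft] := ultra_compact_cvg FU (@segment_compact R (a - pi) (a + pi))
  (fun m => (fP m).1).
have k0 : (m.+4%:R^-1 : R) @[m --> F] --> (0 : R).
  apply: (@ultra_small _ F _ 1 FU ooF) => m.
  rewrite div1r ger0_norm ?invr_ge0// lef_pV2 ?posrE ?ltr0n// ler_nat.
  exact: (leq_addl 3 m).
exists t; split; last first.
  move=> x Kx.
  have h : (dot2 x (dir2 (f m)) - m.+4%:R^-1) @[m --> F] --> dot2 x (dir2 t) - 0.
    apply: cvgB => //.
    apply: (@cvg_comp _ _ _ f (fun s => dot2 x (dir2 s)) F (nbhs t)
      (nbhs (dot2 x (dir2 t))) ft).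
    exact: dot2_dir2_continuous.
  rewrite -[leLHS]subr0.
  apply: (closed_cvg [set x : R | x <= 1] (@closed_le _ 1) _ _ h).
  by apply: filterE => m /=; rewrite lerBlDr; exact: (fP m).2.2.
have c2 : 2^-1 <= cos (t - a).
  have h : (cos (f m - a) + m.+4%:R^-1) @[m --> F] --> cos (t - a) + 0.
    apply: cvgD => //; apply: (@cvg_comp _ _ _ (fun m => f m - a) (@cos R) _ (nbhs (t - a))).
      by apply: cvgB => //; exact: cvg_cst.
    exact: continuous_cos.
  rewrite -[leRHS]addr0.
  apply: (closed_cvg [set x : R | 2^-1 <= x] (@closed_ge _ 2^-1) _ _ h).
  by apply: filterE => m /=; rewrite -lerBlDr; exact: (fP m).2.1.
have : `|t - a| <= pi / 3.
  rewrite leNgt; apply/negP => ta.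
  move: c2; apply/negP; rewrite -ltNge -cos_pi3 -cos_norm.
  move: tab; rewrite /= in_itv/= => /andP[h1 h2].
  have h3 : `|t - a| <= pi by rewrite ler_norml; apply/andP; split; lra.
  rewrite ltr_cos// in_itv/= ?normr_ge0 ?h3//; apply/andP; split; lra.
by rewrite ler_norml => /andP[h1 h2]; apply/andP; split; lra.
Qed.

Lemma ultra_compact_mcvg n (F : set_system nat) (K : set 'rV[R]_n) (f : nat -> 'rV[R]_n) l :
  UltraFilter F -> compact K -> (forall m, K (f m)) -> mcvg F f l -> K l.
Proof.
move=> FU cK Kf fl; have PF : ProperFilter F by exact: ultra_proper.
have [l' Kl' fl'] := ultra_compact_cvg FU cK Kf.
by rewrite (mcvg_unique PF fl (cvg_mcvg fl')).
Qed.

(** The centre and the images of the unit vectors stay in [K], so the inscribed ellipses have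
    bounded parameters, and a maximising sequence converges along an ultrafilter. A small disc in
    the interior makes the maximum positive. *)
Lemma max_ellipse K : convex_body K -> exists A p,
  [/\ \det A != 0, inscribed K A p &
    forall B q, inscribed K B q -> `|\det B| <= `|\det A|].
Proof.
move=> [cK [cvK [p Kp]]].
have [r r0 rK] := compact_coord_bounded cK.
have disc0 : @disc R 0 by rewrite /disc/= vtlE !mxE expr0n/= addr0 ler01.
have qb B q j : inscribed K B q -> `|q 0 j| <= r.
  by move=> /(_ _ disc0); rewrite mul0mx add0r; exact: rK.
have disc10 : disc (vec2 1 0 : 'rV[R]_2) by rewrite /disc/= vec20 vec21 expr0n expr1n addr0.
have disc01 : disc (vec2 0 1 : 'rV[R]_2) by rewrite /disc/= vec20 vec21 expr0n expr1n add0r.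
have Bb B q i j : inscribed K B q -> `|B i j| <= 2 * r.
  move=> BK; have q1 := qb B q j BK.
  have [i' ->|->] := unliftP ord0 i.
    have := rK _ j (BK _ disc01); rewrite mxE mulmx2 vec20 vec21 mul0r mul1r add0r ord1 => h.
    rewrite -[B _ _](addrK (q 0 j)); apply: le_trans (ler_normB _ _) _.
    by rewrite mulr_natl mulr2n lerD.
  have := rK _ j (BK _ disc10); rewrite mxE mulmx2 vec20 vec21 mul0r mul1r addr0 => h.
  rewrite -[B _ _](addrK (q 0 j)); apply: le_trans (ler_normB _ _) _.
  by rewrite mulr_natl mulr2n lerD.
pose V := [set v | exists B q, inscribed K B q /\ v = `|\det B|].
have [e e0 eV] : exists2 e, 0 < e & V e.
  move: Kp => /nbhs_ballP[e /= e0 eK].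
  pose B : 'M[R]_2 := (e / 2)%:M.
  exists (`|\det B|); first by rewrite normr_gt0 det_scalar expf_neq0// gt_eqF// divr_gt0.
  exists B, p; split => // u du; apply: eK; split => // i j.
  rewrite ord1 mul_mx_scalar !mxE /ball/= opprD addrCA addrA addrAC subrK -mulNr normrM normrN.
  rewrite (ger0_norm (_ : 0 <= e / 2)); last by rewrite ltW// divr_gt0.
  have : `|u 0 j| <= 1.
    rewrite -ler_sqr ?nnegrE// real_normK ?num_real// expr1n.
    apply: le_trans du; have [j' ->|->] := unliftP ord0 j; rewrite -?vtlE ?ord1.
      by rewrite lerDr sqr_ge0.
    by rewrite lerDl sqr_ge0.
  by move=> h; have := ler_wpM2l (ltW (_ : 0 < e / 2)) h; rewrite divr_gt0// => /(_ isT); lra.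
have hs : has_sup V.
  split; first by exists e.
  exists (8 * r ^+ 2) => _ [B [q [BK ->]]]; rewrite det2.
  have m i j k l : `|B i j * B k l| <= 2 * r * (2 * r).
    by rewrite normrM ler_pM// (Bb _ q).
  apply: le_trans (ler_normB _ _) _; apply: le_trans (lerD (m _ _ _ _) (m _ _ _ _)) _.
  by rewrite le_eqVlt; apply/orP; left; apply/eqP; ring.
have H (m : nat) : exists Bq : 'M[R]_2 * 'rV[R]_2,
    inscribed K Bq.1 Bq.2 /\ sup V - m.+1%:R^-1 <= `|\det Bq.1|.
  have m0 : 0 < m.+1%:R^-1 :> R by rewrite invr_gt0.
  have [_ [B [q [BK ->]]] h] := sup_adherent m0 hs.
  by exists (B, q); split => //; exact: ltW.
have [f fP] := choice H.
have [F [FU ooF]] := ultraFilterLemma eventually_filter.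
have PF : ProperFilter F by exact: ultra_proper.
have [A fA] : exists A, mcvg F (fun m => (f m).1) A.
  by apply: (ultra_bounded_mcvg FU (K := 2 * r)) => m i j; exact: Bb (fP m).1.
have [b fb] : exists b, mcvg F (fun m => (f m).2) b.
  by apply: (ultra_bounded_mcvg FU (K := r)) => m i j; rewrite ord1; exact: qb (fP m).1.
have AK : inscribed K A b.
  move=> u du; apply: (ultra_compact_mcvg FU cK (f := fun m => u *m (f m).1 + (f m).2)).
    by move=> m; exact: (fP m).1.
  by apply: mcvgD => //; apply: mcvgM => //; exact: mcvg_cst.
have supA : sup V <= `|\det A|.
  have k0 : (m.+1%:R^-1 : R) @[m --> F] --> (0 : R).
    apply: (@ultra_small _ F _ 1 FU ooF) => m.
    by rewrite div1r ger0_norm.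
  have h : (`|\det (f m).1| + m.+1%:R^-1) @[m --> F] --> `|\det A| + 0.
    apply: cvgD => //; apply: cvg_norm; rewrite det2.
    under eq_fun do rewrite det2.
    by apply: cvgB; apply: cvgM; exact: fA.
  rewrite -[leRHS]addr0.
  apply: (closed_cvg [set x : R | sup V <= x] (@closed_ge _ (sup V)) _ _ h).
  by apply: filterE => m /=; rewrite -lerBlDr; exact: (fP m).2.
exists A, b; split => //.
  by rewrite -normr_gt0; apply: lt_le_trans supA; apply: lt_le_trans e0 (ub_le_sup hs.2 eV).
move=> B q BK; apply: le_trans supA; apply: ub_le_sup; first exact: hs.2.
by exists B, q.
Qed.

(** The diagonalising angle is half the polar angle of [(G 0 0 - G o o, 2 G 0 o)]. *)
Lemma symmetric_eigenvector (G : 'M[R]_2) : G^T = G ->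
  exists t l, dir2 t *m G = l *: (dir2 t : 'rV[R]_2).
Proof.
move=> GT; set o : 'I_2 := lift ord0 0.
have G10 : G o 0 = G 0 o by rewrite -[in LHS]GT mxE.
have [r [t [_ _ h0 h1]]] := polar (G 0 0 - G o o) (2 * G 0 o).
pose s := t / 2; exists s.
have tE : t = s + s by rewrite /s; field.
have cs := cos2Dsin2 s.
exists (cos s ^+ 2 * G 0 0 + 2 * cos s * sin s * G 0 o + sin s ^+ 2 * G o o).
have cross : G 0 o * (cos s ^+ 2 - sin s ^+ 2) = cos s * sin s * (G 0 0 - G o o).
  have hc : cos t = cos s ^+ 2 - sin s ^+ 2 by rewrite tE cosD !expr2.
  have hs : sin t = 2 * (cos s * sin s) by rewrite tE sinD; ring.
  rewrite -hc h0; have -> : cos s * sin s = sin t / 2 by rewrite hs; field.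
  have -> : G 0 o = r * sin t / 2 by rewrite -h1; field.
  by ring.
move: cross cs; set c := cos s; set v := sin s => cross cs.
have aux (g h k : R) : h * (c ^+ 2 - v ^+ 2) = c * v * (g - k) ->
    c * g + v * h = (c ^+ 2 * g + 2 * c * v * h + v ^+ 2 * k) * c /\
    c * h + v * k = (c ^+ 2 * g + 2 * c * v * h + v ^+ 2 * k) * v.
  move=> H; split.
    rewrite -[LHS]mul1r -{1}cs.
    transitivity ((c ^+ 2 * g + 2 * c * v * h + v ^+ 2 * k) * c +
      v * (c * v * (g - k) - h * (c ^+ 2 - v ^+ 2))); first by ring.
    by rewrite H subrr mulr0 addr0.
  rewrite -[LHS]mul1r -{1}cs.
  transitivity ((c ^+ 2 * g + 2 * c * v * h + v ^+ 2 * k) * v -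
    c * (c * v * (g - k) - h * (c ^+ 2 - v ^+ 2))); first by ring.
  by rewrite H subrr mulr0 subr0.
have [e0 e1] := aux _ _ _ cross.
by apply: vec2_eq; rewrite ?dir2Z0 ?dir2Z1 ?vtlE mulmx2 vec20 vec21 ?G10.
Qed.

Lemma discE u : disc u <-> (u *m u^T) 0 0 <= 1.
Proof.
by rewrite /disc/= [(u *m _) _ _]mxE !big_ord_recl big_ord0 addr0 ![u^T _ _]mxE -!vtlE !expr2.
Qed.

(* Reflecting in an axis of an ellipse preserves it; the axes of the image of the
   disc under [A] are the eigenvectors of [A^T A]. *)
Lemma ellipse_axis (A : 'M[R]_2) p : \det A != 0 -> exists W : 'M[R]_(1, 2),
  orthonormal_frame W /\ forall u, disc u ->
    exists v, disc v /\ refl_flat p W (v *m A + p) = u *m A + p.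
Proof.
move=> dA; pose G := A^T *m A.
have uA : A \in unitmx by rewrite unitmxE unitfE.
have GT : G^T = G by rewrite /G trmx_mul trmxK.
have uG : G \in unitmx by rewrite /G unitmx_mul unitmx_tr uA.
have [t [l tG]] := symmetric_eigenvector GT.
pose W : 'M[R]_(1, 2) := dir2 t.
have WW : orthonormal_frame W.
  apply/matrixP => i j; rewrite !ord1 !mxE !big_ord_recl big_ord0 addr0 ![W^T _ _]mxE.
  by rewrite /W -!vtlE vec20 vec21 -!expr2 cos2Dsin2.
exists W; split => // u du; set M := reflmx W.
have MM : M *m M = 1%:M by exact: reflmxK.
have MT : M^T = M by exact: reflmx_tr.
have GW : G *m W^T = l *: W^T by rewrite -[in LHS]GT -trmx_mul tG linearZ.
have MG : M *m G = G *m M.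
  rewrite /M /reflmx mulmxBl mulmxBr mul1mx mulmx1 -scalemxAl -scalemxAr.
  by rewrite -[W^T *m W *m G]mulmxA tG mulmxA GW -scalemxAl -scalemxAr.
have comm (X Y : 'M[R]_2) : X \in unitmx -> Y *m X = X *m Y ->
    Y *m invmx X = invmx X *m Y.
  move=> uX YX; rewrite -[LHS]mul1mx -(mulVmx uX) -!mulmxA; congr (_ *m _).
  by rewrite mulmxA -YX -mulmxA mulmxV// mulmx1.
have MVG := comm _ _ uG MG.
(* [Q] is the reflection seen from the disc; it is orthogonal, hence preserves the disc, because [M]
   commutes with [G]. *)
pose Q := A *m M *m invmx A.
have QQ : Q *m Q^T = 1%:M.
  rewrite /Q !trmx_mul MT trmx_inv -!mulmxA [invmx A *m (_ *m _)]mulmxA.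
  have -> : invmx A *m invmx A^T = invmx G.
    apply: (can_inj (mulKmx uG)); rewrite mulmxV// /G -mulmxA [A *m _]mulmxA mulmxV//.
    by rewrite mul1mx mulmxV// unitmx_tr.
  rewrite [M *m (_ *m _)]mulmxA MVG -!mulmxA [M *m (M *m _)]mulmxA MM mul1mx.
  have -> : invmx G = invmx A *m invmx A^T.
    apply: (can_inj (mulKmx uG)); rewrite mulmxV// /G -mulmxA [A *m _]mulmxA mulmxV//.
    by rewrite mul1mx mulmxV// unitmx_tr.
  by rewrite -mulmxA mulVmx ?unitmx_tr// mulmx1 mulmxV.
exists (u *m Q); split.
  by apply/discE; rewrite trmx_mul mulmxA -[u *m Q *m Q^T]mulmxA QQ mulmx1; apply/discE.
have QA : Q *m A = A *m M by rewrite /Q -mulmxA mulVmx// mulmx1.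
rewrite refl_flatE -/M mulmxDl -[u *m Q *m A]mulmxA QA -!mulmxA MM mulmx1.
by rewrite -addrA [p *m M + _]addrC subrK.
Qed.

(** [L] is [K] in coordinates where the maximal ellipse is the unit disc, so both areas scale by the
    same determinant. The reflection itself is taken in the original coordinates, where the ellipse
    and not the disc has to be symmetric. *)
Theorem Sym_planar_ge K : convex_body K -> ((3 / 5)%:E <= Defs.Sym 1 K)%E.
Proof.
move=> bK; have [A [p [dA AK maxA]]] := max_ellipse bK.
have uA : A \in unitmx by rewrite unitmxE unitfE.
have dV : \det (invmx A) != 0 by rewrite det_inv invr_eq0.
pose g x := x *m invmx A + - (p *m invmx A).
pose f x := x *m A + p.
have gK x : f (g x) = x.
  by rewrite /f /g mulmxDl -mulNmx -!mulmxA mulVmx// !mulmx1 subrK.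
have fK x : g (f x) = x.
  by rewrite /f /g mulmxDl -mulmxA mulmxV// mulmx1 addrK.
have [cL [cvL L0]] := convex_body_affine (- (p *m invmx A)) dV bK.
set L := _ @` K in cL cvL L0.
have LE x : L x <-> K (f x).
  split; first by move=> [y Ky <-]; rewrite -/(g y) gK.
  by move=> Kf; exists (f x) => //; exact: fK.
have KE : K = f @` L.
  apply/seteqP; split => [x Kx|_ [y Ly <-]]; last by apply/LE.
  by exists (g x); [apply/LE; rewrite gK|exact: gK].
have dL : @disc R `<=` L by move=> u du; apply/LE; exact: AK.
have maxL B q : inscribed L B q -> `|\det B| <= 1.
  move=> BL; have : inscribed K (B *m A) (q *m A + p).
    by move=> u /BL/LE; rewrite /f mulmxDl mulmxA addrA.
  by move/maxA; rewrite det_mulmx normrM ger_pMl// normr_gt0.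
have vL : (vol L <= (6 * sin (pi / 3))%:E)%E.
  by apply: vol_supported => a; exact: contact.
have vK : vol K = (`|\det A|%:E * vol L)%E by rewrite KE; exact: vol_affine.
have vE : vol (f @` @disc R) = (`|\det A|%:E * vol (@disc R))%E by exact: vol_affine.
have [W [WW HW]] := ellipse_axis p dA.
have EE : f @` @disc R `<=` K `&` refl_flat p W @` K.
  move=> _ [u du <-]; split; first exact: AK.
  by have [v [dv hv]] := HW u du; exists (f v); [exact: AK|exact: hv].
have dA0 : 0 < `|\det A| by rewrite normr_gt0.
have h : ((3 / 5)%:E * vol K <= vol (K `&` refl_flat p W @` K))%E.
  apply: le_trans (vol_le EE); rewrite vE vK muleCA lee_pmul2l//.
  apply: le_trans (vol_disc_ge R); apply: le_trans (lee_wpmul2l _ vL) _ => //.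
  rewrite -EFinM lee_fin.
  have := sqr_sin_pi3 R; have := sin_pi3_gt0 R; move: (sin _) => q q0 q2.
  (* A rational upper bound for [sqrt 3 / 2], fitted so that [3/5 * 6 * 78/90] is the [78/25] of
     [vol_disc_ge]. *)
  have : q <= 78 / 90.
    by rewrite -ler_sqr ?nnegrE ?(ltW q0)// q2; lra.
  by lra.
have v0 := vol_convex_body_gt0 bK.
have vf : vol K \is a fin_num.
  by rewrite ge0_fin_numE ?vol_ge0//; apply: vol_compact_lty; exact: bK.1.
apply: (@le_trans _ _ (vol (K `&` refl_flat p W @` K) * (vol K)^-1)%E).
  have v1 : 0 < fine (vol K) by rewrite fine_gt0// v0 ltey_eq vf.
  by rewrite -(fineK vf) inver gt_eqF// lee_pdivlMr// fineK.
by apply: ereal_sup_ubound; exists p, W.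
Qed.

Lemma sigma_2_1_ge : ((3 / 5)%:E <= sigma R 2 1)%E.
Proof. by apply: le_ereal_inf_tmp => _ [K bK <-]; exact: Sym_planar_ge. Qed.

End Ellipse.

(** * Comparison of the constants *)

Section Assembly.
Variable R : realType.

Lemma expr_1D_ge (e : R) n : 0 <= e ->
  1 + n%:R * e + n%:R * (n%:R - 1) / 2 * e ^+ 2 <= (1 + e) ^+ n.
Proof.
move=> e0; elim: n => [|n IH]; first by rewrite !mul0r !addr0 expr0.
apply: (@le_trans _ _ ((1 + n%:R * e + n%:R * (n%:R - 1) / 2 * e ^+ 2) * (1 + e))); last first.
  by rewrite [leRHS]exprSr ler_wpM2r// addr_ge0.
rewrite -natr1 -subr_ge0; case: n {IH} => [|n].
  by rewrite le_eqVlt; apply/orP; left; apply/eqP; ring.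
set X := (X in 0 <= X).
have -> : X = n.+1%:R * (n.+1%:R - 1) / 2 * e ^+ 3 by rewrite /X; field.
by rewrite -natr1 addrK !mulr_ge0 ?exprn_ge0// ler0n.
Qed.

Lemma expr_1B_ge (e : R) n : 0 <= e <= 1 -> 1 - n%:R * e <= (1 - e) ^+ n.
Proof.
move=> /andP[e0 e1]; elim: n => [|n IH]; first by rewrite mul0r subr0 expr0.
have e1' : 0 <= 1 - e by rewrite subr_ge0.
apply: (@le_trans _ _ ((1 - n%:R * e) * (1 - e))); last by rewrite [leRHS]exprSr ler_wpM2r.
rewrite -natr1 -subr_ge0; set X := (X in 0 <= X).
have -> : X = n%:R * e ^+ 2 by rewrite /X; ring.
by rewrite mulr_ge0// ?exprn_ge0// ler0n.
Qed.

(** With [d = 1 - w], [(1 + d)^n w^n = (1 - d^2)^n], so [(2 - w)^n = 2 (1 - d^2)^n >= 2 (1 - n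
    d^2)]. The target [5/3] then needs [n d^2 <= 1/6], which follows from a bound on [n d] when
    [n >= 4]; [n = 2] and [n = 3] are computed directly. *)
Lemma cone_constant_le n (w : R) : (2 <= n)%N -> 0 < w < 1 -> w ^+ n = 2^-1 ->
  (2 - w) ^- n <= 3 / 5.
Proof.
move=> n2 /andP[w0 w1] wn.
have w20 : 0 < 2 - w by lra.
have -> : 3 / 5 = (5 / 3)^-1 :> R by rewrite invf_div.
rewrite lef_pV2 ?posrE ?exprn_gt0//.
case: n n2 wn => [|[|[|[|n]]]]// _ wn.
- have : w <= 99 / 140 by rewrite -ler_sqr ?nnegrE ?(ltW w0)// wn; lra.
  by rewrite expr2; nra.
- have w8 : w <= 4 / 5 by rewrite -(@ler_pXn2r _ 3) ?nnegrE ?(ltW w0)// wn; lra.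
  have h : (6 / 5) ^+ 3 <= (2 - w) ^+ 3 by rewrite lerXn2r ?nnegrE ?(ltW w20)//; lra.
  by apply: le_trans h; lra.
move: wn; set N := n.+4 => wn; pose d := 1 - w.
have N4 : (4 : R) <= N%:R by rewrite ler_nat.
have N0 : 0 < N%:R :> R by lra.
have d0 : 0 <= d by rewrite /d; lra.
have d1 : 0 <= d ^+ 2 <= 1.
  by rewrite exprn_ge0//= -(expr1n _ 2) lerXn2r ?nnegrE//; rewrite /d; lra.
have prod : (1 + d) ^+ N * w ^+ N = (1 - d ^+ 2) ^+ N.
  by rewrite -exprMn; congr (_ ^+ _); rewrite /d; ring.
have le2 : (1 + d) ^+ N <= 2.
  have : (1 - d ^+ 2) ^+ N <= 1 by case/andP: d1 => ? ?; rewrite exprn_ile1; lra.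
  by rewrite -prod wn; lra.
pose x := N%:R * d.
have x0 : 0 <= x by rewrite mulr_ge0// ltW.
(* The second-order binomial bound on [(1 + d)^N <= 2] gives [1 + x + (3/8) x^2 <= 2] for [N >= 4],
   which fails beyond [39/50]. *)
have x8 : x <= 39 / 50.
  have := le_trans (expr_1D_ge N d0) le2; rewrite -/x.
  have -> : N%:R * (N%:R - 1) / 2 * d ^+ 2 = (1 - N%:R^-1) / 2 * x ^+ 2.
    by rewrite /x; field; rewrite gt_eqF.
  have Nv : N%:R^-1 <= 4^-1 :> R by rewrite lef_pV2 ?posrE.
  move=> h; rewrite leNgt; apply/negP => x8.
  have xx : (39 / 50) ^+ 2 <= x ^+ 2 by rewrite lerXn2r ?nnegrE ?ltW//; lra.
  have : (3 / 8) * x ^+ 2 <= (1 - N%:R^-1) / 2 * x ^+ 2 by rewrite ler_wpM2r ?sqr_ge0//; lra.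
  by rewrite expr2 in xx; lra.
have Nd : N%:R * d ^+ 2 <= 1 / 6.
  have -> : N%:R * d ^+ 2 = x ^+ 2 / N%:R by rewrite /x; field; rewrite gt_eqF.
  rewrite ler_pdivrMr//.
  have : x ^+ 2 <= (39 / 50) ^+ 2 by rewrite lerXn2r ?nnegrE//; lra.
  by rewrite [(39 / 50) ^+ 2]expr2; lra.
have := expr_1B_ge N d1; rewrite -prod wn.
have -> : 2 - w = 1 + d by rewrite /d; ring.
by lra.
Qed.

Lemma root_two (n : nat) (w := 2 `^ (- n.+1%:R^-1) : R) : w ^+ n.+1 = 2^-1 /\ 0 < w < 1.
Proof.
have w0 : 0 < w by apply: powR_gt0.
have wn : w ^+ n.+1 = 2^-1.
  rewrite -powR_mulrn ?(ltW w0)// -powRrM mulNr mulVf ?pnatr_eq0//.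
  by rewrite powR_inv1.
split => //; rewrite w0/= ltNge; apply/negP => w1.
have : 1 <= w ^+ n.+1 by rewrite exprn_ege1.
by rewrite wn; lra.
Qed.

Lemma sigma_succ (n k : nat) :
  (sigma R n.+2 k.+1 <= Order.max (((2 - 2 `^ (- (n.+1%:R)^-1)) ^- n.+1)%:E) (sigma R n.+1 k))%E.
Proof.
have [] := root_two n; set w := _ `^ _ => wn /andP[w0 w1].
set c := _ ^- _.
have c0 : 0 <= c by rewrite invr_ge0 exprn_ge0// subr_ge0; lra.
rewrite leNgt gt_max; apply/negP => /andP[cs /ereal_inf_lt[_ [K bK <-] Ks]].
have H (e : R) : c <= e -> (Defs.Sym k K <= e%:E)%E -> (sigma R n.+2 k.+1 <= e%:E)%E.
  move=> ce Ke; apply: sigma_cone wn (le_trans c0 ce) ce Ke => //.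
  by rewrite w0/=; lra.
(* The bound passed to [sigma_cone] has to dominate both constants: it is [c] here and the real
   value of [Sym k K] otherwise. *)
have [KC|KC] := leP (Defs.Sym k K) c%:E.
  by move: cs; apply/negP; rewrite -leNgt; exact: H.
move: KC Ks H; case: (Defs.Sym k K) => [r|_|] //; last by rewrite ltNge leey.
rewrite lte_fin => cr rs H.
by move: rs; apply/negP; rewrite -leNgt; apply: H; rewrite // ltW.
Qed.

End Assembly.

Theorem theorem1p2 (R : realType) :
  (forall n k : nat, (2 <= n)%N -> (k < n)%N ->
     (sigma R n.+1 k.+1 <=
        Order.max (((2 - 2 `^ (- (n%:R)^-1)) ^- n)%:E) (sigma R n k))%E)
  /\
  (forall n : nat, (2 <= n)%N ->
     (sigma R n n.-1 <= sigma R 2 1)%E /\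
     (sigma R 2 1 <= ((Num.sqrt 2 + 1) / 3)%:E)%E).
Proof.
split=> [[|n] k //|n n2]; first by move=> _ _; exact: sigma_succ.
split; last exact: sigma_2_1_le.
case: n n2 => [|[|n]]// _; elim: n => [//|n IH].
apply: le_trans (sigma_succ R n.+1 n.+1) _; rewrite ge_max IH andbT.
apply: le_trans (sigma_2_1_ge R); rewrite lee_fin.
by have [wn w01] := root_two R n.+1; exact: cone_constant_le.
Qed.
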